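(* Let $D\subset\mathbb{R}^n$ be a simply connected open set containing $0$, and let $\{f_1,\dots,f_n\}$ be a Combescure sequence of isothermic$_k$ hypersurfaces in $\mathbb{R}^{n+1}$ defined on $D$ with $f_i(0)=0$ for all $i$. Then there exist a solution $(F,\gamma)$ of the $\frac{\mathrm{O}(2n+1-k,k)}{\mathrm{O}(n+1)\times\mathrm{O}(n-k,k)}$-system on $D$, an extended frame $E$ for $(F,\gamma)$, and a null basis $\{{\vec{c}}_1,\dots,{\vec{c}}_n\}$ of $\mathbb{R}^{n-k,k}$ such that, writing $\frac{\partial E}{\partial\lambda}E^{-1}\big|_{\lambda=0}=\begin{pmatrix}0&Y\\-JY^T&0\end{pmatrix}$ with $Y$ an $(n+1)\times n$-matrix-valued map, one has $f_\ell=Y{\vec{c}}_\ell$ for all $1\le\ell\le n$.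
   Context: Fix integers $n\ge2$, $1\le k\le n-1$. Let $\epsilon_i=1$ for $i\le n-k$, $\epsilon_i=-1$ for $n-k<i\le n$, $J=\operatorname{diag}(\epsilon_1,\dots,\epsilon_n)$, $(\vec x,\vec y)_k=\vec x^TJ\vec y$ on $\mathbb{R}^n$ (denoted $\mathbb{R}^{n-k,k}$); a null basis is a basis of vectors ${\vec{c}}$ with $({\vec{c}},{\vec{c}})_k=0$. $\delta=\operatorname{diag}(\mathrm{d} x_1,\dots,\mathrm{d} x_n)$. Let $G=\operatorname{diag}(\mathrm{I}_{n+1},J)$; $\mathrm{O}(2n+1-k,k)^{\mathbb{C}}$ is the group of complex $(2n+1)\times(2n+1)$ matrices $A$ with $A^TGA=G$; $\mathrm{I}_{n+1,n}=\operatorname{diag}(\mathrm{I}_{n+1},-\mathrm{I}_n)$. The $\frac{\mathrm{O}(2n+1-k,k)}{\mathrm{O}(n+1)\times\mathrm{O}(n-k,k)}$-system is the PDE for smooth maps $F=(f_{ij})$ (real $n\times n$, $f_{ii}=0$) and $\gamma=(\gamma_1,\dots,\gamma_n)^T$ requiring flatness of $\omega=\begin{pmatrix}-\delta JF+F^TJ\delta&-\delta J\gamma\\ \gamma^TJ\delta&0\end{pmatrix}$ and $\tau=(F\delta-\delta F^T)J$; equivalently $\theta_\lambda=\begin{pmatrix}\omega&-\lambda\begin{pmatrix}\delta\\0\end{pmatrix}J\\ \lambda(\delta,0)&\tau\end{pmatrix}$ is flat for all $\lambda\in\mathbb{C}$. An extended frame is a smooth $E:D\times\mathbb{C}\to\mathrm{O}(2n+1-k,k)^{\mathbb{C}}$,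 holomorphic in $\lambda$, with $E(\cdot,\lambda)^{-1}\mathrm{d} E(\cdot,\lambda)=\theta_\lambda$, $\overline{E(x,\bar\lambda)}=E(x,\lambda)$ and $\mathrm{I}_{n+1,n}E(x,-\lambda)\mathrm{I}_{n+1,n}^{-1}=E(x,\lambda)$. A hypersurface $f$ in $\mathbb{R}^{n+1}$ is isothermic$_k$ if it is parametrised by line of curvature co-ordinates and its induced metric $\sum u_i^2\mathrm{d} x_i^2$ satisfies $\sum_{i\le n-k}u_i^2=\sum_{i>n-k}u_i^2$. $f\mapsto g$ is a Combescure transform if $f_{x_i}(x)\parallel g_{x_i}(x)$ for all $i,x$. A sequence $\{f_1,\dots,f_n\}$ of isothermic$_k$ hypersurfaces is a Combescure sequence if each $f_i\mapsto f_{i+1}$ is a Combescure transform and the vectors $\vec u_i=(u_{i1},\dots,u_{in})^T$, chosen so that $\mathrm{I}_{f_i}=\sum_ju_{ij}^2\mathrm{d} x_j^2$ and $(f_i)_{x_j}/u_{ij}=(f_1)_{x_j}/u_{1j}$ for all $i,j$, are linearly independent at every point. *)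

(* Defs.v *)
From HB Require Import structures.
From mathcomp Require Import all_boot all_order all_algebra.
From mathcomp Require Import all_classical all_reals all_analysis.
From mathcomp Require Import complex.
Import numFieldNormedType.Exports.
Unset Printing Implicit Defensive.
Import Order.TTheory GRing.Theory Num.Theory.
Local Open Scope classical_set_scope.
Local Open Scope ring_scope.

(* Calculus on open subsets of R^n (points are row vectors 'rV[R]_n). *)

(** i-th standard basis vector of R^n *)
Definition ev {R : realType} {n : nat} (i : 'I_n) : 'rV[R]_n := delta_mx 0 i.

(** partial derivative d/dx_i *)
Definition pd {R : realType} {n : nat} {V : normedModType R} (i : 'I_n)
  (f : 'rV[R]_n -> V) : 'rV[R]_n -> V := fun x => 'D_(ev i) f x.

(** iterated partial derivative d/dx_{l_1} ... d/dx_{l_m} *)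
Fixpoint iterpd {R : realType} {n : nat} {V : normedModType R} (l : seq 'I_n)
  (f : 'rV[R]_n -> V) : 'rV[R]_n -> V :=
  match l with
  | [::] => f
  | i :: l' => pd i (iterpd l' f)
  end.

(** C^infinity on D: all iterated partial derivatives exist and are continuous
    at every point of D. *)
Definition smooth_on {R : realType} {n : nat} {V : normedModType R}
  (D : set 'rV[R]_n) (f : 'rV[R]_n -> V) : Prop :=
  forall l : seq 'I_n,
    (forall x, D x -> {for x, continuous (iterpd l f)}) /\
    (forall (i : 'I_n) x, D x -> derivable (iterpd l f) x (ev i)).

(** path in D parametrised by [0,1] *)
Definition path_in {R : realType} {n : nat} (D : set 'rV[R]_n) (g : R -> 'rV[R]_n) :=
  {within `[0, 1], continuous g} /\ g @` `[0, 1] `<=` D.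

(** simply connected: nonempty, path connected, and every loop is
    (based-)null-homotopic inside D *)
Definition simply_connected {R : realType} {n : nat} (D : set 'rV[R]_n) : Prop :=
  (exists x, D x) /\
  (forall x y, D x -> D y -> exists g, path_in D g /\ g 0 = x /\ g 1 = y) /\
  (forall g, path_in D g -> g 0 = g 1 ->
     exists H : R * R -> 'rV[R]_n,
       {within `[0, 1] `*` `[0, 1], continuous H} /\
       H @` (`[0, 1] `*` `[0, 1]) `<=` D /\
       (forall s, s \in `[0, 1] -> H (s, 0) = g s /\ H (s, 1) = g 0) /\
       (forall t, t \in `[0, 1] -> H (0, t) = g 0 /\ H (1, t) = g 0)).

(* Linear algebra                                                     *)

(** Euclidean inner product on R^m (column vectors) *)
Definition dotv {R : realType} {m : nat} (a b : 'cV[R]_m) : R :=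
  \sum_(r < m) a r 0 * b r 0.

(** epsilon_i (0-indexed: eps i = 1 iff i < n - k, i.e. i+1 <= n-k) *)
Definition eps {R : realType} (n k : nat) (i : 'I_n) : R :=
  if (i < n - k)%N then 1 else -1.

(** J = diag(eps_1, ..., eps_n) *)
Definition Jm {R : realType} (n k : nat) : 'M[R]_n := diag_mx (\row_(i < n) eps n k i).

(** two vectors are parallel (linearly dependent) *)
Definition parallel {R : realType} {m : nat} (a b : 'cV[R]_m) : Prop :=
  (\rank (row_mx a b) <= 1)%N.

(** null basis of R^{n-k,k} *)
Definition null_basis {R : realType} (n k : nat) (c : 'I_n -> 'cV[R]_n) : Prop :=
  (forall l, (c l)^T *m Jm n k *m c l = 0) /\
  row_free (\matrix_(l < n) (c l)^T) /\ row_full (\matrix_(l < n) (c l)^T).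

(* Hypersurfaces                                                      *)

(** f : D -> R^{n+1} is an immersed hypersurface parametrised by line of
    curvature coordinates: smooth, immersion, and both the first and the second
    fundamental forms are diagonal (w.r.t. a unit normal N at each point). *)
Definition curvature_line_param {R : realType} {n : nat} (D : set 'rV[R]_n)
  (f : 'rV[R]_n -> 'cV[R]_(n + 1)) : Prop :=
  smooth_on D f /\
  forall x, D x ->
    row_free (\matrix_(j < n) (pd j f x)^T) /\
    exists N : 'cV[R]_(n + 1),
      dotv N N = 1 /\ (forall j, dotv N (pd j f x) = 0) /\
      (forall i j : 'I_n, i != j ->
         dotv (pd i f x) (pd j f x) = 0 /\ dotv N (pd i (pd j f) x) = 0).

(** isothermic_k: line of curvature coordinates and, with I = sum u_i^2 dx_i^2
    (u_i^2 = |f_{x_i}|^2), sum_{i <= n-k} u_i^2 = sum_{i > n-k} u_i^2. *)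
Definition isothermic {R : realType} {n : nat} (k : nat) (D : set 'rV[R]_n)
  (f : 'rV[R]_n -> 'cV[R]_(n + 1)) : Prop :=
  curvature_line_param D f /\
  forall x, D x ->
    \sum_(j < n | (j < n - k)%N) dotv (pd j f x) (pd j f x) =
    \sum_(j < n | (n - k <= j)%N) dotv (pd j f x) (pd j f x).

(** Combescure transform f -> g *)
Definition combescure {R : realType} {n : nat} (D : set 'rV[R]_n)
  (f g : 'rV[R]_n -> 'cV[R]_(n + 1)) : Prop :=
  forall x, D x -> forall j : 'I_n, parallel (pd j f x) (pd j g x).

(** Combescure sequence {f_1, ..., f_n} (indexed 0..n-1; f_1 is the index of
    value 0) *)
Definition combescure_seq {R : realType} (n k : nat) (D : set 'rV[R]_n)
  (f : 'I_n -> 'rV[R]_n -> 'cV[R]_(n + 1)) : Prop :=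
  (forall i, isothermic k D (f i)) /\
  (forall i j : 'I_n, (j = i.+1 :> nat) -> combescure D (f i) (f j)) /\
  exists u : 'I_n -> 'I_n -> 'rV[R]_n -> R,
    (forall i j x, D x -> u i j x ^+ 2 = dotv (pd j (f i) x) (pd j (f i) x)) /\
    (forall (i i1 j : 'I_n) x, (i1 = 0 :> nat) -> D x ->
       (u i j x)^-1 *: pd j (f i) x = (u i1 j x)^-1 *: pd j (f i1) x) /\
    (forall x, D x -> row_free (\matrix_(i < n) \row_(j < n) u i j x)).

(* The O(2n+1-k,k)/O(n+1)xO(n-k,k)-system                             *)

(** coefficient of dx_i in delta = diag(dx_1, ..., dx_n) *)
Definition Eii {R : realType} {n : nat} (i : 'I_n) : 'M[R]_n := delta_mx i i.

(** coefficient of dx_i in omega *)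
Definition omega_i {R : realType} (n k : nat) (F : 'M[R]_n) (g : 'cV[R]_n)
  (i : 'I_n) : 'M[R]_(n + 1) :=
  block_mx (- (Eii i *m Jm n k *m F) + F^T *m Jm n k *m Eii i)
           (- (Eii i *m Jm n k *m g))
           (g^T *m Jm n k *m Eii i) 0.

(** coefficient of dx_i in tau *)
Definition tau_i {R : realType} (n k : nat) (F : 'M[R]_n) (i : 'I_n) : 'M[R]_n :=
  (F *m Eii i - Eii i *m F^T) *m Jm n k.

(** flatness of the matrix valued 1-form sum_i w_i dx_i on D:
    d w + w /\ w = 0 *)
Definition flat_on {R : realType} {n m : nat} (D : set 'rV[R]_n)
  (w : 'I_n -> 'rV[R]_n -> 'M[R]_m) : Prop :=
  forall (i j : 'I_n) x, D x ->
    pd i (w j) x - pd j (w i) x + (w i x *m w j x - w j x *m w i x) = 0.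

(** (F, gamma) is a (smooth) solution of the system on D *)
Definition solves_system {R : realType} (n k : nat) (D : set 'rV[R]_n)
  (F : 'rV[R]_n -> 'M[R]_n) (g : 'rV[R]_n -> 'cV[R]_n) : Prop :=
  smooth_on D F /\ smooth_on D g /\
  (forall x, D x -> forall i, F x i i = 0) /\
  flat_on D (fun i x => omega_i n k (F x) (g x) i) /\
  flat_on D (fun i x => tau_i n k (F x) i).

(* Extended frames                                                    *)

Definition toC {R : realType} {p q : nat} (A : 'M[R]_(p, q)) : 'M[R[i]]_(p, q) :=
  map_mx (fun r => Complex r 0) A.

(** partial derivative d/dx_i of a complex-matrix valued map of x *)
Definition cpd {R : realType} {n p q : nat} (i : 'I_n)
  (H : 'rV[R]_n -> 'M[R[i]]_(p, q)) : 'rV[R]_n -> 'M[R[i]]_(p, q) :=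
  fun x => map2_mx (fun a b => Complex a b)
             (pd i (fun y => map_mx (@complex.Re R) (H y)) x)
             (pd i (fun y => map_mx (@complex.Im R) (H y)) x).

(** coefficient of dx_i in theta_lambda *)
Definition theta_i {R : realType} (n k : nat) (F : 'M[R]_n) (g : 'cV[R]_n)
  (l : R[i]) (i : 'I_n) : 'M[R[i]]_(n + 1 + n) :=
  block_mx (toC (omega_i n k F g i))
           (- l *: toC (col_mx (Eii i) (0 : 'M[R]_(1, n)) *m Jm n k))
           (l *: toC (row_mx (Eii i) (0 : 'M[R]_(n, 1))))
           (toC (tau_i n k F i)).

(** G = diag(I_{n+1}, J) *)
Definition Gm {R : realType} (n k : nat) : 'M[R]_(n + 1 + n) :=
  block_mx 1%:M 0 0 (Jm n k).

(** I_{n+1,n} = diag(I_{n+1}, -I_n) *)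
Definition Ipm {R : realType} (n : nat) : 'M[R]_(n + 1 + n) :=
  block_mx 1%:M 0 0 (- 1%:M).

(** E : D x C -> matrices is smooth (jointly in x and lambda = a + i b) *)
Definition jointly_smooth {R : realType} {n N : nat} (D : set 'rV[R]_n)
  (E : 'rV[R]_n -> R[i] -> 'M[R[i]]_N) : Prop :=
  let lam (z : 'rV[R]_(n + 2)) : R[i] :=
    Complex (rsubmx z 0 ord0) (rsubmx z 0 ord_max) in
  smooth_on (fun z : 'rV[R]_(n + 2) => D (lsubmx z))
    (fun z => (map_mx (@complex.Re R) (E (lsubmx z) (lam z)),
               map_mx (@complex.Im R) (E (lsubmx z) (lam z)))).

(** holomorphic in lambda on all of C *)
Definition holomorphic {R : realType} {N : nat} (h : R[i] -> 'M[R[i]]_N) : Prop :=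
  forall l : (R[i])^o, derivable (h : (R[i])^o -> 'M[R[i]]_N) l 1.

(** E is an extended frame for (F, gamma) on D *)
Definition extended_frame {R : realType} (n k : nat) (D : set 'rV[R]_n)
  (F : 'rV[R]_n -> 'M[R]_n) (g : 'rV[R]_n -> 'cV[R]_n)
  (E : 'rV[R]_n -> R[i] -> 'M[R[i]]_(n + 1 + n)) : Prop :=
  jointly_smooth D E /\
  (forall x, D x -> holomorphic (E x)) /\
  forall x (l : R[i]), D x ->
    (E x l)^T *m toC (Gm n k) *m E x l = toC (Gm n k) /\
    (forall i, invmx (E x l) *m cpd i (fun y => E y l) x = theta_i n k (F x) (g x) l i) /\
    map_mx (fun z => z^*) (E x (l^*)) = E x l /\
    toC (Ipm n) *m E x (- l) *m invmx (toC (Ipm n)) = E x l.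

(** d E / d lambda at lambda = 0 (complex derivative) *)
Definition dE_dlambda0 {R : realType} {N : nat} (h : R[i] -> 'M[R[i]]_N) : 'M[R[i]]_N :=
  'D_1 (h : (R[i])^o -> 'M[R[i]]_N) (0 : (R[i])^o).

(* Main.v *)
Require Import Defs.
From HB Require Import structures.
From mathcomp Require Import all_boot all_order all_algebra.
From mathcomp Require Import all_classical all_reals all_analysis.
From mathcomp Require Import complex.
From mathcomp Require Import ring lra.
Import numFieldNormedType.Exports.
Import Order.TTheory GRing.Theory Num.Theory.
Local Open Scope classical_set_scope.
Local Open Scope ring_scope.
Set Implicit Arguments.
Unset Strict Implicit.

(* Let e_j be the common unit tangent directions of the f_l and N a unit normal, so that
   A = (e_1 ... e_n N) is orthogonal and d_j f_l = v_lj e_j. Equality of mixed partial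
   derivatives of the f_l, independence of the vectors v_l and the null conditions
   sum_j eps_j v_lj^2 = 0 give A^-1 dA = omega for a pair (F, gamma) made of rotation
   coefficients of A, and W = J (v_lj)^T satisfies dW = - tau W and has null columns.
   Hence omega and tau are flat, and E_0 = diag(A, B), B = (W W(0)^-1)^-1, integrates
   theta_0.

   Let K_i be the coefficient of lambda dx_i in theta_lambda and kappa_i = E_0 K_i E_0^-1.
   The form kappa is exact: it is dZ for Z = (0, Y; - J Y^T, 0), where - Y W(0) is the
   matrix with columns f_l. Moreover the kappa_i commute because K_i K_j = 0 for i <> j.
   So the iterated integrals Q_0 = 1, dQ_(m+1) = Q_m kappa, Q_(m+1)(0) = 0 exist on the
   simply connected domain, and they decrease faster than any geometric sequence.
   The extended frame is E = (sum_m lambda^m Q_m) E_0; its logarithmic derivative at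
   lambda = 0 is Q_1 = Z, and c_l is minus the l-th column of W(0). *)

(** * Partial derivatives *)

Section axis.
Context {R : realType} {N : nat}.
Implicit Types (f g : 'rV[R]_N -> R) (x y z c v : 'rV[R]_N).

(** The power series replaces an existence theorem for linear systems depending on a parameter.
    Gauging theta_lambda by E_0 leaves lambda kappa, so a Poincare lemma applied repeatedly yields
    every coefficient, while joint smoothness, holomorphy and the derivative at 0 are read off from
    the decay of the coefficients.

    Two obstacles shape the analysis. Smoothness only says that iterated partial derivatives exist
    and are continuous, so directional derivatives, symmetry of mixed partials and closure under
    algebraic operations are derived from mean value arguments along the axes. Simple connectedness
    only supplies continuous homotopies, so primitives are globalised by finite sums over fine grids
    and not by integration along paths.

    The mixed partials of the f_l determine d_i v_lj for i <> j but say nothing about d_i v_li;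
    differentiating the null condition supplies these, and this is how the signs eps enter tau. The
    minus sign in c_l comes from the upper right block of theta_lambda. *)

Lemma is_derive_lineP (V : normedModType R) (f : 'rV[R]_N -> V) x v (t : R) df :
  is_derive t 1 (fun s : R => f (x + s *: v)) df <-> is_derive (x + t *: v) v f df.
Proof.
have E : (fun h : R => h^-1 *: (f (x + (h *: 1 + t) *: v) - f (x + t *: v)))
       = (fun h : R => h^-1 *: (f (h *: v + (x + t *: v)) - f (x + t *: v))).
  apply/funext => h; congr (_ *: (f _ - _)).
  have -> : h *: (1 : R) = h by exact: mulr1.
  by rewrite scalerDl addrCA.
by split=> -[d1 d2]; split; move: d1 d2; rewrite /derivable /derive /= E.
Qed.

Lemma axis_MVT f (i : 'I_N) x (h : R) :
  (forall t, 0 <= t <= 1 -> derivable f (x + (t * h) *: ev i) (ev i)) ->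
  exists2 t, 0 <= t <= 1 &
    f (x + h *: ev i) - f x = h * pd i f (x + (t * h) *: ev i).
Proof.
move=> df.
pose g (t : R) := f (x + (t * h) *: ev i).
have dg (t : R) : 0 <= t <= 1 ->
    is_derive t 1 g (h * pd i f (x + (t * h) *: ev i)).
  move=> t01.
  have d1 := (is_derive_lineP f x (ev i) (t * h) _).2 (derivableP (df t t01)).
  have d2 : is_derive t 1 (id * cst h : R -> R) h.
    by apply: is_derive_eq; rewrite scaler0 add0r; exact: mulr1.
  have := @is_derive1_comp _ (fun s : R => f (x + s *: ev i)) (fun s : R => s * h)
     t _ _ d1 d2.
  by rewrite /comp mulrC.
have [t||t] := @MVT_segment _ g (fun t => h * pd i f (x + (t * h) *: ev i)) 0 1 ler01.
- by rewrite in_itv /= => /andP[a b]; apply: dg; rewrite !ltW.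
- apply: derivable_within_continuous => t; rewrite in_itv /= => t01.
  exact: (@ex_derive _ _ _ _ _ _ _ (dg t t01)).
- by rewrite in_itv /g /= mul1r mul0r scale0r addr0 subr0 mulr1; exists t.
Qed.

Lemma mem_ball_rV c r x : 0 < r ->
  ball c r x <-> forall i, `|c 0 i - x 0 i| < r.
Proof.
move=> r0; split=> [[_ H] i|H]; first exact: H.
by split=> // i j; rewrite (ord1 i); exact: H.
Qed.

Lemma ball_rV_gt0 c r x : ball c r x -> 0 < r. Proof. by case. Qed.

(** A staircase from [y] to [z] that changes one coordinate at a time. Balls of row vectors are
    boxes for the sup norm, so the staircase never leaves a ball containing both ends. *)
Definition hybrid y z (j : nat) : 'rV[R]_N :=
  \row_i (if (i < j)%N then z 0 i else y 0 i).

Lemma hybrid0 y z : hybrid y z 0 = y.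
Proof. by apply/rowP => i; rewrite mxE. Qed.

Lemma hybridN y z : hybrid y z N = z.
Proof. by apply/rowP => i; rewrite mxE ltn_ord. Qed.

Lemma hybridS y z (j : 'I_N) :
  hybrid y z j.+1 = hybrid y z j + (z 0 j - y 0 j) *: ev j.
Proof.
apply/rowP => i; rewrite !mxE eqxx /= ltnS.
case: (ltngtP i j) => [ij|ij|/val_inj ->].
- by rewrite (_ : (i == j) = false) ?mulr0 ?addr0 // -val_eqE /= ltn_eqF.
- by rewrite (_ : (i == j) = false) ?mulr0 ?addr0 // -val_eqE /= gtn_eqF.
- by rewrite eqxx mulr1 addrC subrK.
Qed.

Lemma convex_norm (a b c t r : R) : 0 <= t <= 1 ->
  `|c - a| < r -> `|c - b| < r -> `|c - (a + t * (b - a))| < r.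
Proof.
move=> /andP[t0 t1]; rewrite !ltr_norml => /andP[a1 a2] /andP[b1 b2].
have [t_gt0|t_le0] := ltrP 0 t; last first.
  have -> : t = 0 by apply/eqP; rewrite eq_le t_le0.
  by apply/andP; split; lra.
have pa1 : 0 <= (1 - t) * (c - a + r) by apply: mulr_ge0; lra.
have pa2 : 0 <= (1 - t) * (r - (c - a)) by apply: mulr_ge0; lra.
have pb1 : 0 < t * (c - b + r) by apply: mulr_gt0; lra.
have pb2 : 0 < t * (r - (c - b)) by apply: mulr_gt0; lra.
by apply/andP; split; nra.
Qed.

Lemma hybrid_ball c r y z (j : 'I_N) t : ball c r y -> ball c r z -> 0 <= t <= 1 ->
  ball c r (hybrid y z j + (t * (z 0 j - y 0 j)) *: ev j).
Proof.
move=> By Bz t01; have r0 := ball_rV_gt0 By.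
move/(mem_ball_rV _ _ r0): By => By; move/(mem_ball_rV _ _ r0): Bz => Bz.
apply/(mem_ball_rV _ _ r0) => i; rewrite !mxE eqxx /=.
have [->|ij] := eqVneq i j; last by rewrite mulr0 addr0; case: ifP.
by rewrite ltnn mulr1; apply: convex_norm.
Qed.

Lemma ball_segment c r y z t : ball c r y -> ball c r z -> 0 <= t <= 1 ->
  ball c r (y + t *: (z - y)).
Proof.
move=> By Bz t01; have r0 := ball_rV_gt0 By.
move/(mem_ball_rV _ _ r0): By => By; move/(mem_ball_rV _ _ r0): Bz => Bz.
by apply/(mem_ball_rV _ _ r0) => i; rewrite !mxE; apply: convex_norm.
Qed.

Lemma norm_coord x i : `|x 0 i| <= `|x|.
Proof.
rewrite [leRHS]/Num.Def.normr /= mx_normrE.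
exact: (le_bigmax _ (fun k : 'I_1 * 'I_N => `|x k.1 k.2|) (0, i)).
Qed.

(** Telescoping along the staircase, with the mean value theorem on each axis-parallel edge. Each of
    the [N] edges is at most as long as the sup norm of [z - y], whence the factor [N]. The partial
    derivatives only have to exist and be bounded. *)
Lemma ball_lipschitz f c r K :
  (forall y, ball c r y -> forall i, derivable f y (ev i) /\ `|pd i f y| <= K) ->
  forall y z, ball c r y -> ball c r z -> `|f z - f y| <= N%:R * K * `|z - y|.
Proof.
move=> df y z By Bz.
have -> : f z - f y = \sum_(j < N) (f (hybrid y z j.+1) - f (hybrid y z j)).
  rewrite -(big_mkord xpredT (fun j => f (hybrid y z j.+1) - f (hybrid y z j))).
  by rewrite telescope_sumr // hybrid0 hybridN.
apply: le_trans (ler_norm_sum _ _ _) _.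
rewrite -mulrA mulr_natl -[X in _ *+ X]card_ord -sumr_const.
apply: ler_sum => j _; rewrite hybridS.
have [t t01|t t01 ->] := @axis_MVT f j (hybrid y z j) (z 0 j - y 0 j).
  by have [] := df _ (hybrid_ball j By Bz t01) j.
rewrite normrM mulrC; apply: ler_pM => //.
  by have [] := df _ (hybrid_ball j By Bz t01) j.
by have := norm_coord (z - y) j; rewrite !mxE.
Qed.

End axis.

(** * First-order expansion from continuous partial derivatives *)

Section first_order.
Context {R : realType} {N : nat}.
Implicit Types (f g : 'rV[R]_N -> R) (x y z c v : 'rV[R]_N).

Lemma is_derive_comp_real (phi : R -> R) f x v (dphi df : R) :
  is_derive (f x) 1 phi dphi -> is_derive x v f df ->
  is_derive x v (fun y => phi (f y)) (dphi * df).
Proof.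
move=> d1 d2; have e0 : x + (0 : R) *: v = x by rewrite scale0r addr0.
rewrite -e0; apply/is_derive_lineP.
have d3 : is_derive (0 : R) 1 (fun s : R => f (x + s *: v)) df.
  by apply/is_derive_lineP; rewrite e0.
by apply: (@is_derive1_comp _ phi (fun s : R => f (x + s *: v))); rewrite /= e0.
Qed.

Lemma continuous_distP (U V : normedModType R) (f : U -> V) (x : U) :
  {for x, continuous f} <->
  forall e, 0 < e -> \forall y \near x, `|f x - f y| <= e.
Proof. exact: (@cvgrPdist_le _ _ _ (nbhs x) _). Qed.

Lemma is_derive_coord x v i : is_derive x v (fun y => y 0 i) (v 0 i).
Proof.
have E : (fun h : R => h^-1 *: ((h *: v + x) 0 i - x 0 i)) @ 0^' --> v 0 i.
  apply: cvg_near_cst; near=> h.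
  rewrite !mxE addrK /GRing.scale /= mulKf //.
  by near: h; exact: nbhs_dnbhs_neq.
split; first by apply/cvg_ex; exists (v 0 i).
exact/cvg_lim.
Unshelve. all: by end_near. Qed.

Lemma pd_cvg_expand f x :
  (\forall y \near x, forall i, derivable f y (ev i)) ->
  (forall i, {for x, continuous (pd i f)}) ->
  forall e, 0 < e -> \forall y \near x,
    `|f y - f x - \sum_i (y - x) 0 i * pd i f x| <= e * `|y - x|.
Proof.
move=> df cf e e0.
(* [ball_lipschitz] costs a factor [N]; dividing by [N.+1] also covers [N = 0]. *)
pose K := e / N.+1%:R.
have K0 : 0 < K by rewrite divr_gt0.
have near1 : \forall y \near x, forall i, derivable f y (ev i) /\
   `|pd i f y - pd i f x| <= K.
  apply: (@filter_forall _ _ (fun i y => derivable f y (ev i) /\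
    `|pd i f y - pd i f x| <= K) (nbhs x) _) => i; near=> y; split.
    by near: y; apply: filterS df => y; exact.
  rewrite distrC; near: y.
  by have /continuous_distP/(_ K K0) := cf i.
move/nbhs_ballP : near1 => [r /= r0 Hr].
(* Subtracting the candidate linear part leaves a function whose partial derivatives are at most [K]
   near [x]. *)
pose g y := f y - \sum_i y 0 i * pd i f x.
have dg y i : ball x r y -> is_derive y (ev i) g (pd i f y - pd i f x).
  move=> By; have [d1 _] := Hr _ By i.
  have -> : g = f - \sum_(i < N) (fun y => y 0 i * pd i f x).
    by apply/funext => z; rewrite /g !fctE fct_sumE.
  apply: is_deriveB; first exact: derivableP.
  have -> : pd i f x = \sum_j (ev i : 'rV[R]_N) 0 j * pd j f x.
    rewrite (bigD1 i) //= big1 ?addr0; last first.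
      by move=> j ji; rewrite !mxE eqxx (negbTE ji) mul0r.
    by rewrite !mxE !eqxx mul1r.
  apply: is_derive_sum => j.
  have d2 := is_derive_coord y (ev i) j.
  have := is_deriveM d2 (is_derive_cst (pd j f x) y (ev i)).
  by move/@is_derive_eq; apply; rewrite scaler0 add0r /GRing.scale /= mulrC.
near=> y.
have By : ball x r y by near: y; exact: nbhsx_ballx.
have -> : f y - f x - \sum_i (y - x) 0 i * pd i f x = g y - g x.
  have -> : \sum_i (y - x) 0 i * pd i f x =
      \sum_i y 0 i * pd i f x - \sum_i x 0 i * pd i f x.
    by rewrite -sumrB; apply: eq_bigr => i _; rewrite !mxE mulrBl.
  by rewrite /g; ring.
apply: le_trans (ball_lipschitz (K := K) _ (ballxx _ r0) By) _.
  move=> z Bz i; have [d1 d2] := dg z i Bz.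
  by split=> //; rewrite /pd d2; have [] := Hr _ Bz i.
apply: ler_wpM2r => //.
rewrite /K mulrA ler_pdivrMr // mulrC.
by apply: ler_wpM2l; [exact: ltW|rewrite ler_nat].
Unshelve. all: by end_near. Qed.

Lemma is_derive_pd f x v :
  (\forall y \near x, forall i, derivable f y (ev i)) ->
  (forall i, {for x, continuous (pd i f)}) ->
  is_derive x v f (\sum_i v 0 i * pd i f x).
Proof.
move=> df cf; set a := \sum_i _.
suff E : (fun h : R => h^-1 *: (f (h *: v + x) - f x)) @ 0^' --> a.
  split; first by apply/cvg_ex; exists a.
  exact/cvg_lim.
apply/cvgrPdist_le => e e0.
pose K := e / (`|v| + 1).
have v1 : 0 < `|v| + 1 by rewrite ltr_wpDl.
have K0 : 0 < K by rewrite divr_gt0.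
have H := pd_cvg_expand df cf K0.
have c1 : (fun h : R => h *: v + x) @ 0 --> x.
  have : (fun h : R => h *: v + x) @ 0 --> (0 : R) *: v + x.
    by apply: cvgD; [apply: cvgZr_tmp; exact: cvg_id|exact: cvg_cst].
  by rewrite scale0r add0r.
have {}H : \forall h \near (0 : R)^',
   `|f (h *: v + x) - f x - \sum_i (h *: v + x - x) 0 i * pd i f x|
     <= K * `|h *: v + x - x|.
  by apply: cvg_within; exact: (c1 _ H).
near=> h.
have h0 : h != 0 by near: h; exact: nbhs_dnbhs_neq.
have H1 : `|f (h *: v + x) - f x - h * a| <= K * (`|h| * `|v|).
  have -> : h * a = \sum_i (h *: v + x - x) 0 i * pd i f x.
    by rewrite addrK mulr_sumr; apply: eq_bigr => i _; rewrite mxE mulrA.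
  by rewrite -normrZ -[h *: v in leRHS](addrK x); near: h; exact: H.
have -> : a - h^-1 *: (f (h *: v + x) - f x) =
          - (h^-1 * (f (h *: v + x) - f x - h * a)).
  by rewrite /GRing.scale /= [in RHS]mulrBr mulKf // opprB.
rewrite normrN normrM normfV mulrC ler_pdivrMr ?normr_gt0 //.
apply: le_trans H1 _; rewrite mulrCA mulrC; apply: ler_wpM2r => //.
by rewrite /K mulrAC ler_pdivrMr //; apply: ler_wpM2l; [exact: ltW|rewrite lerDl].
Unshelve. all: by end_near. Qed.

Lemma pd_continuous f x :
  (\forall y \near x, forall i, derivable f y (ev i)) ->
  (forall i, {for x, continuous (pd i f)}) ->
  {for x, continuous f}.
Proof.
move=> df cf; pose K := \sum_i `|pd i f x| + 1.
have K0 : 0 < K by rewrite ltr_wpDl // sumr_ge0.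
apply/continuous_distP => e e0.
have H := pd_cvg_expand df cf ltr01.
near=> y.
rewrite distrC.
have H1 : `|f y - f x - \sum_i (y - x) 0 i * pd i f x| <= 1 * `|y - x|.
  by near: y; exact: H.
rewrite -[f y - f x](subrK (\sum_i (y - x) 0 i * pd i f x)).
apply: le_trans (ler_normD _ _) _.
apply: le_trans (lerD H1 (ler_norm_sum _ _ _)) _.
apply: (@le_trans _ _ (K * `|y - x|)).
  rewrite /K mulrDl addrC; apply: lerD => //.
  rewrite mulr_suml; apply: ler_sum => i _; rewrite normrM mulrC.
  by apply: ler_wpM2l => //; exact: norm_coord.
rewrite -ler_pdivlMl // mulrC distrC; near: y.
by apply: cvgr_dist_le; [exact: cvg_id|rewrite divr_gt0].
Unshelve. all: by end_near. Qed.

End first_order.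

(** * Symmetry of mixed second derivatives *)

Section schwarz.
Context {R : realType} {N : nat}.
Implicit Types (f g : 'rV[R]_N -> R) (x y z c v : 'rV[R]_N).

(** The mean value theorem in direction [i], applied to the increment of [f] in direction [j], then
    in direction [j], applied to [pd i f]. For [i != j] every coordinate moves by at most [h], so
    the rectangle stays in the box. *)
Lemma second_difference f x i j (r h : R) : 0 < h -> h < r ->
  (forall y, ball x r y -> derivable f y (ev i) /\ derivable (pd i f) y (ev j)) ->
  i != j ->
  exists2 p, ball x r p &
    f (x + h *: ev i + h *: ev j) - f (x + h *: ev i) - f (x + h *: ev j) + f x
    = h * h * pd j (pd i f) p.
Proof.
move=> h0 hr df ij; have r0 : 0 < r by apply: lt_trans hr.
have inb (s t : R) : 0 <= s <= 1 -> 0 <= t <= 1 ->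
    ball x r (x + (s * h) *: ev i + (t * h) *: ev j).
  move=> /andP[s0 s1] /andP[t0 t1]; apply/(mem_ball_rV _ _ r0) => l.
  have sh : 0 <= s * h by rewrite mulr_ge0 // ltW.
  have th : 0 <= t * h by rewrite mulr_ge0 // ltW.
  have sh1 : s * h < r by apply: le_lt_trans hr; rewrite ler_piMl // ltW.
  have th1 : t * h < r by apply: le_lt_trans hr; rewrite ler_piMl // ltW.
  rewrite !mxE eqxx /= -addrA opprD addNKr normrN.
  have [li|li] := eqVneq l i; have [lj|lj] := eqVneq l j.
  - by rewrite -li lj eqxx in ij.
  - by rewrite mulr1 mulr0 addr0 ger0_norm.
  - by rewrite mulr0 mulr1 add0r ger0_norm.
  - by rewrite !mulr0 addr0 normr0.
have one01 : 0 <= (1 : R) <= 1 by rewrite ler01 lexx.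
pose g y := f (y + h *: ev j) - f y.
have dg (t : R) : 0 <= t <= 1 -> is_derive (x + (t * h) *: ev i) (ev i) g
    (pd i f (x + (t * h) *: ev i + h *: ev j) - pd i f (x + (t * h) *: ev i)).
  move=> t01; apply: is_deriveB.
    apply/is_derive_lineP.
    have -> : (fun s : R => f (x + s *: ev i + h *: ev j)) =
              (fun s : R => f ((x + h *: ev j) + s *: ev i)).
      by apply/funext => s; rewrite addrAC.
    rewrite addrAC; apply/is_derive_lineP/derivableP; rewrite addrAC.
    by have := inb t 1 t01 one01; rewrite mul1r => /df[].
  apply: derivableP.
  have := inb t 0 t01; rewrite mul0r scale0r addr0 lexx ler01 => /(_ isT).
  by case/df.
have [t t01|t t01 E] := @axis_MVT _ _ g i x h; first by case: (dg t t01).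
have [s s01|s s01 E2] := @axis_MVT _ _ (pd i f) j (x + (t * h) *: ev i) h.
  by have /df[] := inb t s t01 s01.
exists (x + (t * h) *: ev i + (s * h) *: ev j); first exact: inb.
rewrite -mulrA -E2.
have -> : pd i f (x + (t * h) *: ev i + h *: ev j) - pd i f (x + (t * h) *: ev i)
   = pd i g (x + (t * h) *: ev i) by case: (dg t t01).
by rewrite -E /g; ring.
Qed.

Lemma dist_le_halves (a b c d e : R) :
  c = d -> `|a - c| <= e / 2 -> `|b - d| <= e / 2 -> `|a - b| <= e.
Proof.
move=> <- H1 H2; rewrite -(subrKA c) (splitr e).
by apply: le_trans (ler_normD _ _) _; rewrite lerD // distrC.
Qed.

Lemma near2_ball (P : set 'rV[R]_N) f g x :
  (\forall y \near x, P y) -> {for x, continuous f} -> {for x, continuous g} ->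
  forall e, 0 < e -> exists2 r, 0 < r & forall y, ball x r y ->
    P y /\ `|f x - f y| <= e /\ `|g x - g y| <= e.
Proof.
move=> nP /continuous_distP cf /continuous_distP cg e e0.
have : \forall y \near x, P y /\ `|f x - f y| <= e /\ `|g x - g y| <= e.
  by apply: filterI => //; apply: filterI; [exact: cf|exact: cg].
by move/nbhs_ballP => [r /= r0 Hr]; exists r => // y; exact: Hr.
Qed.

Lemma pd_comm f x i j :
  (\forall y \near x, derivable f y (ev i) /\ derivable f y (ev j) /\
      derivable (pd i f) y (ev j) /\ derivable (pd j f) y (ev i)) ->
  {for x, continuous (pd j (pd i f))} ->
  {for x, continuous (pd i (pd j f))} ->
  pd j (pd i f) x = pd i (pd j f) x.
Proof.
have [->//|ij] := eqVneq i j.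
move=> df c1 c2; apply/eqP; rewrite -subr_eq0 -normr_le0.
apply/ler_addgt0Pl => e e0; rewrite addr0.
have e20 : 0 < e / 2 by rewrite divr_gt0.
have [r r0 Hr] := near2_ball df c1 c2 e20.
have h0 : 0 < r / 2 by rewrite divr_gt0.
have hr : r / 2 < r by lra.
have [|p Bp Ep] := @second_difference f x i j r (r / 2) h0 hr _ ij.
  by move=> y /Hr[[? [? [? ?]]] _].
have ji : j != i by rewrite eq_sym.
have [|q Bq Eq] := @second_difference f x j i r (r / 2) h0 hr _ ji.
  by move=> y /Hr[[? [? [? ?]]] _].
(* The second difference is symmetric in the two directions, so the two mixed partials agree, though
   at different points [p] and [q] of a small ball; continuity at [x] absorbs the difference. *)
have E : pd j (pd i f) p = pd i (pd j f) q.
  have hh : r / 2 * (r / 2) != 0 by rewrite mulf_neq0 // gt_eqF.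
  apply: (mulfI hh); apply: etrans (esym Ep) _; apply: etrans _ Eq.
  rewrite [x + (r / 2) *: ev i + _]addrAC; congr (_ + _).
  by rewrite [LHS]addrAC.
have [_ [a1 _]] := Hr _ Bp; have [_ [_ a2]] := Hr _ Bq.
exact: dist_le_halves E a1 a2.
Qed.

End schwarz.

(** * Smooth maps *)

Section smooth_theory.
Context {R : realType} {N : nat}.
Variable D : set 'rV[R]_N.
Hypothesis oD : open D.
Implicit Types (f g : 'rV[R]_N -> R) (x y z c v : 'rV[R]_N).

Lemma near_open x : D x -> \forall y \near x, D y.
Proof. by move=> Dx; exact: open_nbhs_nbhs. Qed.

Lemma near_eq_on (V : Type) (f g : 'rV[R]_N -> V) x :
  (forall y, D y -> f y = g y) -> D x -> \forall y \near x, f y = g y.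
Proof. by move=> fg Dx; apply: filterS (near_open Dx). Qed.

Lemma eq_on_is_derive (V : normedModType R) (f g : 'rV[R]_N -> V) x v df :
  (forall y, D y -> f y = g y) -> D x -> is_derive x v f df -> is_derive x v g df.
Proof. by move=> fg Dx; apply: near_eq_is_derive; exact: near_eq_on. Qed.

Lemma eq_on_continuous (V : normedModType R) (f g : 'rV[R]_N -> V) x :
  (forall y, D y -> f y = g y) -> D x ->
  {for x, continuous f} -> {for x, continuous g}.
Proof.
move=> fg Dx /continuous_distP cf; apply/continuous_distP => e e0.
apply: filterS2 (cf e e0) (near_open Dx) => y.
by move=> H Dy; rewrite -!fg.
Qed.

Lemma eq_on_pd (V : normedModType R) (f g : 'rV[R]_N -> V) i x :
  (forall y, D y -> f y = g y) -> D x -> pd i f x = pd i g x.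
Proof. by move=> fg Dx; apply: near_eq_derive; exact: near_eq_on. Qed.

(** A class of continuous functions closed under partial derivatives is smooth. Derivatives need to
    be known on [D] only, because [D] is open. This avoids every formula for higher derivatives. *)
Lemma smooth_ind (V : normedModType R) (P : ('rV[R]_N -> V) -> Prop) :
  (forall h, P h -> forall x, D x -> {for x, continuous h}) ->
  (forall h, P h -> forall i, exists2 k, P k &
     forall x, D x -> is_derive x (ev i) h (k x)) ->
  forall h, P h -> smooth_on D h.
Proof.
move=> cP dP f Pf l.
suff [g Pg E] : exists2 g, P g & forall x, D x -> g x = iterpd l f x.
  split=> [x Dx|i x Dx]; first by exact: eq_on_continuous E Dx (cP g Pg x Dx).
  have [g' _ /(_ x Dx) dg] := dP _ Pg i.
  by have [] := eq_on_is_derive E Dx dg.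
elim: l => [|i l [g Pg E]] /=; first by exists f.
have [g' Pg' dg] := dP _ Pg i.
exists g' => // x Dx; rewrite -(eq_on_pd i E Dx).
by have [_ <-] := dg x Dx.
Qed.

Section basic.
Variable V : normedModType R.
Implicit Types h k : 'rV[R]_N -> V.

Lemma smooth_continuous h x : smooth_on D h -> D x -> {for x, continuous h}.
Proof. by move=> /(_ [::])[H _]; exact: H. Qed.

Lemma smooth_derivable h i x : smooth_on D h -> D x -> derivable h x (ev i).
Proof. by move=> /(_ [::])[_ H]; exact: H. Qed.

Lemma smooth_is_derive h i x : smooth_on D h -> D x ->
  is_derive x (ev i) h (pd i h x).
Proof. by move=> sh Dx; apply: derivableP; exact: smooth_derivable. Qed.

Lemma iterpd_rcons l i h : iterpd l (pd i h) = iterpd (rcons l i) h.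
Proof. by elim: l => //= j l ->. Qed.

Lemma smooth_pd i h : smooth_on D h -> smooth_on D (pd i h).
Proof. by move=> sh l; rewrite iterpd_rcons; exact: sh. Qed.

Lemma eq_smooth h k : smooth_on D h -> (forall x, D x -> h x = k x) -> smooth_on D k.
Proof.
move=> sh hk.
apply: (@smooth_ind _ (fun k => exists2 h, smooth_on D h &
   forall x, D x -> h x = k x)); last by exists h.
- move=> k' [h' sh' E] x Dx; apply: (eq_on_continuous E Dx).
  exact: (smooth_continuous sh' Dx).
- move=> k' [h' sh' E] i; exists (pd i h').
    by exists (pd i h') => //; exact: smooth_pd.
  by move=> x Dx; apply: (eq_on_is_derive E Dx); exact: smooth_is_derive.
Qed.

Lemma smooth_cst (a : V) : smooth_on D (fun _ => a).
Proof.
apply: (@smooth_ind _ (fun k => exists b, k = (fun _ => b))); last by exists a.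
- by move=> _ [b ->] x _; exact: cst_continuous.
- move=> _ [b ->] i; exists (fun _ => 0); first by exists 0.
  by move=> x _; exact: is_derive_cst.
Qed.
End basic.

Lemma smooth_nbhs_derivable f x : smooth_on D f -> D x ->
  \forall y \near x, forall i, derivable f y (ev i).
Proof.
move=> sf Dx; apply: filterS (near_open Dx) => y Dy i.
exact: smooth_derivable.
Qed.

Lemma smooth_is_derive_dir f x v : smooth_on D f -> D x ->
  is_derive x v f (\sum_i v 0 i * pd i f x).
Proof.
move=> sf Dx; apply: is_derive_pd; first exact: smooth_nbhs_derivable.
by move=> i; exact: (smooth_continuous (smooth_pd i sf) Dx).
Qed.

Lemma smooth_pd_comm f i j x : smooth_on D f -> D x ->
  pd i (pd j f) x = pd j (pd i f) x.
Proof.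
move=> sf Dx; have si := smooth_pd i sf; have sj := smooth_pd j sf.
apply: pd_comm.
- apply: filterS (near_open Dx) => y Dy.
  split; first exact: (smooth_derivable sf Dy).
  split; first exact: (smooth_derivable sf Dy).
  split; first exact: (smooth_derivable sj Dy).
  exact: (smooth_derivable si Dy).
- exact: (smooth_continuous (smooth_pd i sj) Dx).
- exact: (smooth_continuous (smooth_pd j si) Dx).
Qed.

(* Stable under partial derivatives as a whole, which makes [smooth_ind] applicable;
   the class of products or of inverses alone would not be. *)
Inductive elementary : ('rV[R]_N -> R) -> Prop :=
| elem_smooth f : smooth_on D f -> elementary f
| elem_add f g : elementary f -> elementary g -> elementary (fun x => f x + g x)
| elem_mul f g : elementary f -> elementary g -> elementary (fun x => f x * g x)
| elem_inv f : (forall x, D x -> f x != 0) -> elementary f ->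
    elementary (fun x => (f x)^-1)
| elem_sqrt f : (forall x, D x -> 0 < f x) -> elementary f ->
    elementary (fun x => Num.sqrt (f x)).

Lemma elementary_cst (a : R) : elementary (fun _ => a).
Proof. exact/elem_smooth/smooth_cst. Qed.

Lemma is_derive_mul f g x v df dg :
  is_derive x v f df -> is_derive x v g dg ->
  is_derive x v (fun y => f y * g y) (df * g x + f x * dg).
Proof.
move=> d1 d2; have d := is_deriveM d1 d2.
by apply: is_derive_eq d _; rewrite addrC mulrC.
Qed.

(** The derivative is written as a product of generators, with no squares or negated terms, so that
    it is visibly [elementary]. *)
Lemma is_derive_inv f x v df : f x != 0 ->
  is_derive x v f df -> is_derive x v (fun y => (f y)^-1) (- 1 * df * (f x)^-1 * (f x)^-1).
Proof.
move=> fx0 d1; have d : is_derive (f x) 1 (fun y : R => y^-1) (- (f x) ^- 2).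
  have d0 := is_deriveV (f := id) fx0 (is_derive_id (f x) 1).
  by apply: is_derive_eq d0 _; exact: mulr1.
apply: is_derive_eq (is_derive_comp_real d d1) _.
by rewrite expr2 invfM; ring.
Qed.

Lemma elementary_continuous f x : elementary f -> D x -> {for x, continuous f}.
Proof.
move=> ef Dx; elim: ef => {f} [f sf|f g _ cf _ cg|f g _ cf _ cg|f f0 _ cf|f f0 _ cf].
- exact: (smooth_continuous sf Dx).
- exact: (cvgD cf cg).
- exact: (cvgM cf cg).
- exact: (cvgV (f0 x Dx) cf).
- by apply: (continuous_comp cf); exact: sqrt_continuous.
Qed.

Lemma elementary_derive f i : elementary f ->
  exists2 g, elementary g & forall x, D x -> is_derive x (ev i) f (g x).
Proof.
elim=> {f} [f sf|f g ef [f' ef' df] eg [g' eg' dg]|f g ef [f' ef' df] eg [g' eg' dg]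
  |f f0 ef [f' ef' df]|f f0 ef [f' ef' df]].
- exists (pd i f); first exact/elem_smooth/smooth_pd.
  by move=> x Dx; exact: smooth_is_derive.
- exists (fun x => f' x + g' x); first exact: elem_add.
  by move=> x Dx; apply: is_deriveD; [exact: df|exact: dg].
- exists (fun x => f' x * g x + f x * g' x).
    by apply: elem_add; apply: elem_mul.
  by move=> x Dx; apply: is_derive_mul; [exact: df|exact: dg].
- exists (fun x => -1 * f' x * (f x)^-1 * (f x)^-1).
    apply: elem_mul; last exact: elem_inv.
    apply: elem_mul; last exact: elem_inv.
    by apply: elem_mul => //; exact: elementary_cst.
  by move=> x Dx; apply: is_derive_inv; [exact: f0|exact: df].
- exists (fun x => (2 * Num.sqrt (f x))^-1 * f' x).
    apply: elem_mul => //; apply: elem_inv.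
      by move=> x Dx; rewrite mulf_neq0 // gt_eqF // sqrtr_gt0 f0.
    by apply: elem_mul; [exact: elementary_cst|exact: elem_sqrt].
  move=> x Dx; apply: is_derive_comp_real; last exact: df.
  by apply: is_derive1_sqrt; exact: f0.
Qed.

Lemma elementary_smooth f : elementary f -> smooth_on D f.
Proof.
apply: smooth_ind => [g eg x|g eg i]; first exact: elementary_continuous.
exact: elementary_derive.
Qed.

Lemma smoothD f g : smooth_on D f -> smooth_on D g -> smooth_on D (fun x => f x + g x).
Proof. by move=> sf sg; apply/elementary_smooth/elem_add; apply: elem_smooth. Qed.

Lemma smoothM f g : smooth_on D f -> smooth_on D g -> smooth_on D (fun x => f x * g x).
Proof. by move=> sf sg; apply/elementary_smooth/elem_mul; apply: elem_smooth. Qed.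

Lemma smoothV f : (forall x, D x -> f x != 0) -> smooth_on D f ->
  smooth_on D (fun x => (f x)^-1).
Proof. by move=> f0 sf; apply/elementary_smooth/elem_inv => //; apply: elem_smooth. Qed.

Lemma smooth_sqrt f : (forall x, D x -> 0 < f x) -> smooth_on D f ->
  smooth_on D (fun x => Num.sqrt (f x)).
Proof. by move=> f0 sf; apply/elementary_smooth/elem_sqrt => //; apply: elem_smooth. Qed.

Lemma smooth_sum (I : Type) (r : seq I) (P : pred I) (F : I -> 'rV[R]_N -> R) :
  (forall i, P i -> smooth_on D (F i)) ->
  smooth_on D (fun x => \sum_(i <- r | P i) F i x).
Proof.
move=> sF; elim: r => [|i r IH].
  by apply: (eq_smooth (smooth_cst (0 : R))) => x _; rewrite big_nil.
case Pi : (P i); last by apply: (eq_smooth IH) => x _; rewrite big_cons Pi.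
by apply: (eq_smooth (smoothD (sF i Pi) IH)) => x _; rewrite big_cons Pi.
Qed.

Lemma smooth_prod (I : Type) (r : seq I) (P : pred I) (F : I -> 'rV[R]_N -> R) :
  (forall i, P i -> smooth_on D (F i)) ->
  smooth_on D (fun x => \prod_(i <- r | P i) F i x).
Proof.
move=> sF; elim: r => [|i r IH].
  by apply: (eq_smooth (smooth_cst (1 : R))) => x _; rewrite big_nil.
case Pi : (P i); last by apply: (eq_smooth IH) => x _; rewrite big_cons Pi.
by apply: (eq_smooth (smoothM (sF i Pi) IH)) => x _; rewrite big_cons Pi.
Qed.

(** * Matrix-valued maps, entry by entry *)

Section matrices.
Variables p q : nat.
Implicit Types M : 'rV[R]_N -> 'M[R]_(p, q).

Lemma is_derive_mxP M x v dM :
  is_derive x v M dM <-> forall a b, is_derive x v (fun y => M y a b) (dM a b).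
Proof.
split=> [[d1 d2] a b|H].
  split; first by move/derivable_mxP: d1; exact.
  by move: d2; rewrite derive_mx // => <-; rewrite mxE.
have d : derivable M x v by apply/derivable_mxP => a b; case: (H a b).
by split=> //; rewrite derive_mx //; apply/matrixP => a b; rewrite mxE; case: (H a b).
Qed.

Lemma continuous_mxP M x :
  {for x, continuous M} <-> forall a b, {for x, continuous (fun y => M y a b)}.
Proof.
split=> [cM a b|cM].
  exact: (@continuous_comp _ _ _ M (fun A : 'M[R]_(p, q) => A a b) x cM
           (@coord_continuous _ _ _ a b _)).
apply/continuous_distP => e e0.
have H : \forall y \near x, forall ab : 'I_p * 'I_q,
    `|M x ab.1 ab.2 - M y ab.1 ab.2| <= e.
  apply: (@filter_forall _ _ (fun (ab : 'I_p * 'I_q) y =>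
    `|M x ab.1 ab.2 - M y ab.1 ab.2| <= e) (nbhs x) _) => -[a b] /=.
  by have /continuous_distP := cM a b; exact.
apply: filterS H => y H.
rewrite [leLHS]/Num.Def.normr /= mx_normrE; apply/bigmax_leP; split; first exact: ltW.
by move=> ab _; rewrite !mxE.
Qed.

Lemma smooth_mxP M :
  smooth_on D M <-> forall a b, smooth_on D (fun y => M y a b).
Proof.
split=> [sM a b|sM].
  apply: (@smooth_ind R (fun f : 'rV[R]_N -> R =>
     exists2 M' : 'rV[R]_N -> 'M[R]_(p, q), smooth_on D M' &
     f = fun y => M' y a b)); last by exists M.
  - move=> _ [M' sM' ->] x Dx.
    exact: ((continuous_mxP M' x).1 (smooth_continuous sM' Dx) a b).
  - move=> _ [M' sM' ->] i; exists (fun y => pd i M' y a b).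
      by exists (pd i M'); [exact: smooth_pd|].
    by move=> x Dx; have /is_derive_mxP := smooth_is_derive i sM' Dx; exact.
apply: (@smooth_ind _ (fun M => forall a b, smooth_on D (fun y => M y a b))) => //.
- by move=> M' sM' x Dx; apply/continuous_mxP => a b; exact: (smooth_continuous (sM' a b) Dx).
- move=> M' sM' i; exists (fun y => \matrix_(a, b) pd i (fun y => M' y a b) y).
    move=> a b; apply: (eq_smooth (smooth_pd i (sM' a b))) => x _.
    by rewrite mxE.
  by move=> x Dx; apply/is_derive_mxP => a b; rewrite mxE; exact: smooth_is_derive.
Qed.

Lemma pd_mxE M i x a b : smooth_on D M -> D x ->
  pd i M x a b = pd i (fun y => M y a b) x.
Proof.
move=> sM Dx; have /is_derive_mxP/(_ a b)[_ H] := smooth_is_derive i sM Dx.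
by rewrite -H.
Qed.
End matrices.

Lemma pd_val (V : normedModType R) (h : 'rV[R]_N -> V) x i dh :
  is_derive x (ev i) h dh -> pd i h x = dh.
Proof. by case. Qed.

Lemma is_derive_mulmx p q r (A : 'rV[R]_N -> 'M[R]_(p, q)) (B : 'rV[R]_N -> 'M[R]_(q, r))
  x v A' B' : is_derive x v A A' -> is_derive x v B B' ->
  is_derive x v (fun y => A y *m B y) (A' *m B x + A x *m B').
Proof.
move=> /is_derive_mxP dA /is_derive_mxP dB; apply/is_derive_mxP => a b.
rewrite !mxE -big_split /=.
have -> : (fun y => (A y *m B y) a b) = \sum_j (fun y => A y a j * B y j b).
  by apply/funext => y; rewrite mxE fct_sumE.
by apply: is_derive_sum => j; exact: is_derive_mul.
Qed.

Lemma is_derive_trmx p q (A : 'rV[R]_N -> 'M[R]_(p, q)) x v A' :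
  is_derive x v A A' -> is_derive x v (fun y => (A y)^T) A'^T.
Proof.
move=> /is_derive_mxP dA; apply/is_derive_mxP => a b; rewrite mxE.
by under eq_fun do rewrite mxE.
Qed.

Lemma smooth_mulmx p q r (A : 'rV[R]_N -> 'M[R]_(p, q)) (B : 'rV[R]_N -> 'M[R]_(q, r)) :
  smooth_on D A -> smooth_on D B -> smooth_on D (fun y => A y *m B y).
Proof.
move=> /smooth_mxP sA /smooth_mxP sB; apply/smooth_mxP => a b.
have H := @smooth_sum _ (index_enum 'I_q) xpredT (fun j y => A y a j * B y j b)
  (fun j _ => smoothM (sA a j) (sB j b)).
by apply: (eq_smooth H) => x _; rewrite mxE.
Qed.

Lemma smooth_trmx p q (A : 'rV[R]_N -> 'M[R]_(p, q)) :
  smooth_on D A -> smooth_on D (fun y => (A y)^T).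
Proof.
move=> /smooth_mxP sA; apply/smooth_mxP => a b.
by apply: (eq_smooth (sA b a)) => x _; rewrite mxE.
Qed.

Lemma smooth_det p (A : 'rV[R]_N -> 'M[R]_p) :
  smooth_on D A -> smooth_on D (fun y => \det (A y)).
Proof.
move=> /smooth_mxP sA; apply: smooth_sum => s _; apply: smoothM; first exact: smooth_cst.
by apply: smooth_prod => i _; exact: sA.
Qed.

Lemma pd_mx_comm p q (A : 'rV[R]_N -> 'M[R]_(p, q)) i j x :
  smooth_on D A -> D x -> pd i (pd j A) x = pd j (pd i A) x.
Proof.
move=> sA Dx; apply/matrixP => a b.
have E k l : pd k (pd l A) x a b = pd k (pd l (fun y => A y a b)) x.
  have E1 := pd_mxE k a b (smooth_pd l sA) Dx.
  have E2 := eq_on_pd k (fun y Dy => pd_mxE l a b sA Dy) Dx.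
  exact: (etrans E1 E2).
have E3 := smooth_pd_comm i j ((smooth_mxP A).1 sA a b) Dx.
exact: (etrans (E i j) (etrans E3 (esym (E j i)))).
Qed.

End smooth_theory.

(** * The Poincare lemma on simply connected domains *)

Section parametric_integral.
Context {R : realType}.
Notation mu := (@lebesgue_measure R).

Lemma within01_integrable (f : R -> R) :
  (forall (t : R), 0 <= t <= 1 -> derivable f t 1) ->
  mu.-integrable `[0, 1] (EFin \o f).
Proof.
move=> df; apply: continuous_compact_integrable; first exact: segment_compact.
by apply: derivable_within_continuous => t; rewrite in_itv /= => t01; exact: df.
Qed.

(* Psi is an antiderivative in t of d(phi)/dh at h = 0. *)
Lemma is_derive_integral01 (phi dphi : R -> R -> R) (Psi : R -> R) (eta M : R) :
  0 < eta ->
  (forall (h t : R), -eta < h < eta -> 0 <= t <= 1 -> derivable (phi h) t 1) ->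
  (forall (h t : R), -eta < h < eta -> 0 <= t <= 1 ->
     is_derive h 1 (phi ^~ t) (dphi h t)) ->
  (forall (h t : R), -eta < h < eta -> 0 <= t <= 1 -> `|dphi h t| <= M) ->
  (forall (t : R), 0 <= t <= 1 -> derivable (dphi 0) t 1) ->
  (forall (t : R), 0 <= t <= 1 -> is_derive t 1 Psi (dphi 0 t)) ->
  is_derive (0 : R) 1 (fun h => \int[mu]_(t in `[0, 1]) phi h t) (Psi 1 - Psi 0).
Proof.
move=> eta0 dt dh bM ddphi dPsi.
have z01 : 0 <= (0 : R) <= 1 by rewrite lexx ler01.
have o01 : 0 <= (1 : R) <= 1 by rewrite lexx ler01.
have zI : - eta < 0 < eta by rewrite oppr_lt0 eta0.
have I0 : `](- eta), eta[%classic (0 : R) by rewrite /= in_itv.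
have intphi (h : R) : `](- eta), eta[%classic h -> mu.-integrable `[0, 1] (EFin \o phi h).
  rewrite /= in_itv /= => hI; apply: within01_integrable => t t01; exact: dt.
have der (h t : R) : `](- eta), eta[%classic h -> `[0, 1]%classic t -> derivable (phi ^~ t) h 1.
  rewrite /= !in_itv /= => hI tI; by case: (dh h t hI tI).
have M0 (t : R) : 0 <= (fun _ : R => M) t.
  by apply: le_trans (bM 0 0 zI z01).
have intM : mu.-integrable `[0, 1] (EFin \o (fun _ : R => M)).
  by apply: within01_integrable => t _; exact: derivable_cst.
have dphiE (h t : R) : - eta < h < eta -> 0 <= t <= 1 -> partial1of2 phi h t = dphi h t.
  by move=> hI tI; rewrite partial1of2E; case: (dh h t hI tI).
have ub (h t : R) : `](- eta), eta[%classic h -> `[0, 1]%classic t ->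
    `|partial1of2 phi h t| <= (fun _ : R => M) t.
  rewrite /= !in_itv /= => hI tI; rewrite dphiE //; exact: bM.
have H := @cvg_differentiation_under_integral R _ _ mu phi `[0, 1]%classic
  (measurable_itv _) 0 (- eta) eta I0 intphi der (fun=> M) M0 intM ub.
have E : \int[mu]_(t in `[0, 1]) partial1of2 phi 0 t = Psi 1 - Psi 0.
  rewrite (@eq_Rintegral _ _ _ mu _ (dphi 0)); last first.
    by move=> t; rewrite inE /= in_itv /= => tI; exact: dphiE.
  rewrite /Rintegral (@continuous_FTC2 _ (dphi 0) Psi 0 1 ltr01) //.
  - by apply: derivable_within_continuous => t; rewrite in_itv /= => t01; exact: ddphi.
  - have cP (t : R) : 0 <= t <= 1 -> Psi @ t --> Psi t.
      move=> t01; apply: differentiable_continuous; apply/derivable1_diffP.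
      by case: (dPsi t t01).
    split.
    + by move=> t; rewrite in_itv /= => /andP[a b]; have [|] := dPsi t _; rewrite ?ltW.
    + by apply: cvg_at_right_filter; exact: cP.
    + by apply: cvg_at_left_filter; exact: cP.
  - move=> t; rewrite in_itv /= => /andP[a b]; rewrite derive1E.
    by have [|_ ->] := dPsi t _; rewrite ?ltW.
rewrite E in H.
have H' : (fun h : R => h^-1 *: ((\int[mu]_(t in `[0, 1]) phi (h *: 1 + 0) t) -
   \int[mu]_(t in `[0, 1]) phi 0 t)) @ 0^' --> Psi 1 - Psi 0.
  move: H; apply: cvg_trans; apply: near_eq_cvg; near=> h.
  have -> : h *: (1 : R) + 0 = h + 0 by congr (_ + _); exact: mulr1.
  by [].
split; first by apply/cvg_ex; exists (Psi 1 - Psi 0).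
exact: (cvg_lim _ H').
Unshelve. all: by end_near. Qed.

End parametric_integral.

(** * Local primitives of closed forms *)

Section poincare_local.
Context {R : realType} {n : nat}.
Notation mu := (@lebesgue_measure R).
Variable D : set 'rV[R]_n.
Hypothesis oD : open D.
Variable alpha : 'I_n -> 'rV[R]_n -> R.
Hypothesis smooth_alpha : forall i, smooth_on D (alpha i).
Hypothesis closed_alpha : forall i j x, D x -> pd i (alpha j) x = pd j (alpha i) x.
Implicit Types x y z c v : 'rV[R]_n.

Definition segment_integral x y : R :=
  \int[mu]_(t in `[0, 1]) (\sum_j (y - x) 0 j * alpha j (x + t *: (y - x))).

(** The common bound on [alpha] and its first derivatives gives the constant majorant for
    differentiation under the integral sign. *)
Definition tame_ball c r := [/\ 0 < r, ball c r `<=` D &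
  exists M, forall y, ball c r y -> forall i j,
    `|alpha i y| <= M /\ `|pd i (alpha j) y| <= M].

Lemma continuous_bounded_near (f : 'rV[R]_n -> R) x : {for x, continuous f} ->
  \forall y \near x, `|f y| <= `|f x| + 1.
Proof.
move=> /continuous_distP cf; apply: filterS (cf 1 ltr01) => y H.
rewrite -[f y](subrK (f x)) addrC; apply: le_trans (ler_normD _ _) _.
by rewrite lerD // distrC.
Qed.

Lemma tame_ball_ex x : D x -> exists r, tame_ball x r.
Proof.
move=> Dx.
pose M := \sum_i `|alpha i x| + \sum_i \sum_j `|pd i (alpha j) x| + 1.
have leM1 i : `|alpha i x| + 1 <= M.
  rewrite /M (bigD1 i) //= lerD2r -addrA lerDl addr_ge0 // sumr_ge0 // => k _.
  by rewrite sumr_ge0.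
have leM2 i j : `|pd i (alpha j) x| + 1 <= M.
  rewrite /M lerD2r; apply: ler_wpDl; first by rewrite sumr_ge0.
  rewrite (bigD1 i) //= (bigD1 j) //= -addrA lerDl addr_ge0 //.
    by rewrite sumr_ge0.
  by rewrite sumr_ge0 // => k _; rewrite sumr_ge0.
have H : \forall y \near x, D y /\ forall ij : 'I_n * 'I_n,
   `|alpha ij.1 y| <= M /\ `|pd ij.1 (alpha ij.2) y| <= M.
  apply: filterI; first exact: near_open.
  apply: (@filter_forall _ _ (fun (ij : 'I_n * 'I_n) y =>
    `|alpha ij.1 y| <= M /\ `|pd ij.1 (alpha ij.2) y| <= M) (nbhs x) _) => -[i j].
  apply: filterI.
    have c := smooth_continuous (smooth_alpha i) Dx.
    by apply: filterS (continuous_bounded_near c) => y /le_trans; apply.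
  have c := smooth_continuous (smooth_pd i (smooth_alpha j)) Dx.
  by apply: filterS (continuous_bounded_near c) => y /le_trans; apply.
move/nbhs_ballP: H => [r /= r0 H]; exists r; split=> //.
  by move=> y /H[].
by exists M => y /H[_ H2] i j; exact: (H2 (i, j)).
Qed.

Lemma derivable_along (f : 'rV[R]_n -> R) x v (t : R) : smooth_on D f ->
  D (x + t *: v) -> derivable (fun s : R => f (x + s *: v)) t 1.
Proof.
move=> sf Dx.
by have /is_derive_lineP[] := smooth_is_derive_dir oD v sf Dx.
Qed.

Lemma derivable_sum_fun m (h : 'I_m -> R -> R) (t : R) :
  (forall i, derivable (h i) t 1) -> derivable (fun s => \sum_i h i s) t 1.
Proof.
move=> dh; have -> : (fun s => \sum_i h i s) = \sum_i h i.
  by apply/funext => s; rewrite fct_sumE.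
exact: derivable_sum.
Qed.

Lemma is_derive_sum_fun m (h : 'I_m -> R -> R) (dh : 'I_m -> R) (t : R) :
  (forall i, is_derive t 1 (h i) (dh i)) ->
  is_derive t 1 (fun s => \sum_i h i s) (\sum_i dh i).
Proof.
move=> H; have -> : (fun s => \sum_i h i s) = \sum_i h i.
  by apply/funext => s; rewrite fct_sumE.
exact: is_derive_sum.
Qed.

Lemma is_derive_mul1 (f g : R -> R) (t df dg : R) :
  is_derive t 1 f df -> is_derive t 1 g dg ->
  is_derive t 1 (fun s => f s * g s) (df * g t + f t * dg).
Proof.
move=> d1 d2; have d := is_deriveM d1 d2.
by apply: is_derive_eq d _; rewrite addrC mulrC.
Qed.

Lemma is_derive_affine (a b t : R) : is_derive t 1 (fun s => a + s * b) b.
Proof.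
have d1 : is_derive t 1 (fun s : R => s * b) b.
  have d := is_derive_mul1 (is_derive_id t 1) (is_derive_cst b t 1).
  by apply: is_derive_eq d _; rewrite mulr0 addr0 mul1r.
have d := is_deriveD (is_derive_cst a t 1) d1.
by apply: is_derive_eq d _; rewrite add0r.
Qed.

(** Moving the endpoint in direction [i] changes the integrand at rate alpha_i + t sum_j (y - x)_j
    d_i alpha_j. Since d_i alpha_j = d_j alpha_i, this is the [t]-derivative of t alpha_i (x + t (y
    - x)), the function [Psi] below, whose increment over [0, 1] is alpha_i (y). *)
Lemma segment_integral_pd c r x y i : tame_ball c r -> ball c r x -> ball c r y ->
  is_derive y (ev i) (segment_integral x) (alpha i y).
Proof.
move=> [r0 BD [M bM]] Bx By.
have [eta eta0 Heta] : exists2 eta, 0 < eta & forall (h : R), - eta < h < eta ->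
    ball c r (y + h *: ev i).
  have cl : (fun h : R => y + h *: ev i) @ 0 --> y.
    have : (fun h : R => y + h *: ev i) @ 0 --> y + (0 : R) *: ev i.
      by apply: cvgD; [exact: cvg_cst|apply: cvgZr_tmp; exact: cvg_id].
    by rewrite scale0r addr0.
  have nB : nbhs y (ball c r) by apply: open_nbhs_nbhs; split => //; exact: ball_open.
  have /nbhs_ballP[e /= e0 He] := cl _ nB.
  exists e => // h hI; apply: He; rewrite /ball /= sub0r normrN ltr_norml.
  by [].
pose p (h t : R) := x + t *: (y + h *: ev i - x).
have Bp (h t : R) : - eta < h < eta -> 0 <= t <= 1 -> ball c r (p h t).
  by move=> hI tI; apply: ball_segment => //; exact: Heta.
have Dp (h t : R) : - eta < h < eta -> 0 <= t <= 1 -> D (p h t).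
  by move=> hI tI; apply: BD; exact: Bp.
have zI : - eta < 0 < eta by rewrite oppr_lt0 eta0.
have pE (h t : R) : p h t = x + t *: (y - x) + (0 + h * t) *: ev i.
  by rewrite /p (addrAC y) scalerDr scalerA addrA add0r (mulrC h).
pose vh (h : R) j := (y + h *: ev i - x) 0 j.
pose phi (h t : R) := \sum_j vh h j * alpha j (p h t).
pose dphi (h t : R) := \sum_j ((j == i)%:R * alpha j (p h t)
   + vh h j * (t * pd i (alpha j) (p h t))).
pose Psi (t : R) := t * alpha i (p 0 t).
suff d : is_derive (0 : R) 1 (fun h => \int[mu]_(t in `[0, 1]) phi h t) (Psi 1 - Psi 0).
  have e0 : y + (0 : R) *: ev i = y by rewrite scale0r addr0.
  have PE : Psi 1 - Psi 0 = alpha i y.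
    by rewrite /Psi /p mul1r mul0r subr0 scale1r e0 addrC subrK.
  rewrite -{1}e0; apply/is_derive_lineP; apply: is_derive_eq d PE.
pose K := `|x| + `|y| + eta.
have vK (h : R) j : - eta < h < eta -> `|vh h j| <= K.
  move=> hI; rewrite /vh !mxE eqxx /= /K.
  have h1 : `|h * (j == i)%:R| <= eta.
    case: (j == i); last by rewrite mulr0 normr0 ltW.
    by rewrite mulr1 ltW // ltr_norml.
  have h2 := norm_coord x j; have h3 := norm_coord y j.
  apply: le_trans (ler_normB _ _) _.
  by have h4 := ler_normD (y 0 j) (h * (j == i)%:R); lra.
have K0 : 0 <= K by rewrite /K !addr_ge0 // ltW.
have M0 : 0 <= M by have [H _] := bM _ Bx i i; apply: le_trans H.
apply: (@is_derive_integral01 _ phi dphi Psi eta (\sum_(j < n) (M + K * M))) => //.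
- move=> h t hI tI; apply: derivable_sum_fun => j.
  apply: derivableM; first exact: derivable_cst.
  exact: derivable_along (smooth_alpha j) (Dp h t hI tI).
- move=> h t hI tI; apply: is_derive_sum_fun => j.
  apply: (@is_derive_mul1 (vh ^~ j) (fun h => alpha j (p h t))).
    have -> : vh ^~ j = (fun h : R => (y 0 j - x 0 j) + h * (j == i)%:R).
      by apply/funext => s; rewrite /vh !mxE eqxx /= addrAC.
    exact: is_derive_affine.
  have E : (fun s : R => alpha j (p s t)) =
      (fun s : R => alpha j (x + t *: (y - x) + (0 + s * t) *: ev i)).
    by apply/funext => s; rewrite pE.
  have E1 := pE h t.
  have d1 := smooth_is_derive i (smooth_alpha j) (Dp h t hI tI).
  rewrite E1 in d1; move/is_derive_lineP: d1 => d1.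
  have d2 := is_derive_affine 0 t h.
  have := @is_derive1_comp _ (fun s : R => alpha j (x + t *: (y - x) + s *: ev i))
    (fun s : R => 0 + s * t) h _ _ d1 d2.
  by rewrite E /comp E1 mulrC.
- move=> h t hI tI; apply: le_trans (ler_norm_sum _ _ _) _; apply: ler_sum => j _.
  apply: le_trans (ler_normD _ _) _; have [b1 _] := bM _ (Bp h t hI tI) j j.
  have [_ b2] := bM _ (Bp h t hI tI) i j.
  move/andP: tI => [t0 t1]; apply: lerD; rewrite !normrM.
    by case: (j == i); rewrite ?normr1 ?mul1r // normr0 mul0r.
  apply: ler_pM => //; first exact: vK.
  by rewrite -[M]mul1r; apply: ler_pM => //; rewrite ger0_norm.
- move=> t tI; apply: derivable_sum_fun => j; apply: derivableD.
    apply: derivableM; first exact: derivable_cst.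
    exact: derivable_along (smooth_alpha j) (Dp 0 t zI tI).
  apply: derivableM; first exact: derivable_cst.
  apply: derivableM; first exact: derivable_id.
  exact: derivable_along (smooth_pd i (smooth_alpha j)) (Dp 0 t zI tI).
- move=> t tI.
  have d1 := smooth_is_derive_dir oD (y + 0 *: ev i - x) (smooth_alpha i) (Dp 0 t zI tI).
  move/is_derive_lineP: d1 => d1.
  have d2 := is_derive_mul1 (is_derive_id t 1) d1.
  apply: is_derive_eq d2 _.
  rewrite /dphi big_split /=; congr (_ + _).
    rewrite (bigD1 i) //= eqxx big1 ?addr0 // => j /negbTE ->.
    by rewrite mul0r.
  rewrite mulr_sumr; apply: eq_bigr => j _.
  by rewrite mulrCA; congr (_ * (_ * _)); apply: closed_alpha; exact: Dp.
Qed.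

Lemma segment_integral_refl x : segment_integral x x = 0.
Proof.
rewrite /segment_integral (@eq_Rintegral _ _ _ mu _ (fun _ => 0)).
  by rewrite Rintegral_cst //= mul0r.
by move=> t _; rewrite big1 // => j _; rewrite subrr mxE mul0r.
Qed.

(** The two integrals to a moving endpoint, from [x] and from [y], have the same partial
    derivatives, so their difference is constant on the ball; compare its values at [y] and at
    [z]. *)
Lemma segment_integral_add c r x y z : tame_ball c r ->
  ball c r x -> ball c r y -> ball c r z ->
  segment_integral x y + segment_integral y z = segment_integral x z.
Proof.
move=> tB Bx By Bz.
pose g w := segment_integral x w - segment_integral y w.
have dg w i : ball c r w -> is_derive w (ev i) g 0.
  move=> Bw; have d1 := segment_integral_pd i tB Bx Bw.
  have d2 := segment_integral_pd i tB By Bw.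
  by apply: is_derive_eq (is_deriveB d1 d2) _; rewrite subrr.
have H := @ball_lipschitz _ _ g c r 0 _ y z By Bz.
have /H : forall w, ball c r w -> forall i, derivable g w (ev i) /\ `|pd i g w| <= 0.
  move=> w Bw i; have [a b] := dg w i Bw; split=> //.
  by rewrite (_ : pd i g w = 0) ?normr0.
rewrite mulr0 mul0r normr_le0 subr_eq0 /g segment_integral_refl subr0.
by move/eqP <-; rewrite subrK.
Qed.

End poincare_local.

(** * Retraction onto the unit interval and uniform grids *)

Section unit_interval.
Context {R : realType}.

(** Precomposing with this retraction turns continuity within [0, 1], or within the unit square,
    into continuity everywhere. *)
Definition clamp (t : R) : R := Num.min 1 (Num.max 0 t).

Lemma clamp01 t : 0 <= clamp t <= 1.
Proof. by rewrite /clamp le_min ler01 le_max lexx /= ge_min lexx. Qed.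

Lemma clamp_id t : 0 <= t <= 1 -> clamp t = t.
Proof. by move=> /andP[a b]; rewrite /clamp max_r // min_r. Qed.

Lemma clamp0 t : t <= 0 -> clamp t = 0.
Proof. by move=> a; rewrite /clamp max_l // min_r // ler01. Qed.

Lemma clamp1 t : 1 <= t -> clamp t = 1.
Proof. by move=> a; rewrite /clamp min_l // le_max a orbT. Qed.

Lemma clamp_continuous : continuous clamp.
Proof.
move=> t; apply: continuous_min; first exact: cvg_cst.
by apply: continuous_max; [exact: cvg_cst|exact: cvg_id].
Qed.

Lemma continuous_retract (T U V : topologicalType) (A : set U) (g : U -> V) (r : T -> U) :
  (forall t, A (r t)) -> continuous r -> {within A, continuous g} ->
  continuous (g \o r).
Proof.
move=> Ar cr /subspace_continuousP cg t.
apply: (@cvg_comp _ _ _ r g (nbhs t) (within A (nbhs (r t)))); last exact: cg.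
move=> B HB; have H := cr t _ HB.
change (nbhs t (r @^-1` B)).
apply: (@filterS _ _ _ (r @^-1` (fun s => A s -> B s)) _ _ H) => s Hs.
exact: (Hs (Ar s)).
Qed.

Lemma grid01 (i m : nat) : (i <= m)%N -> 0 <= (i%:R / m%:R : R) <= 1.
Proof.
move=> im; rewrite divr_ge0 ?ler0n //=; case: m im => [|m] im.
  by rewrite invr0 mulr0 ler01.
by rewrite ler_pdivrMr ?ltr0n // mul1r ler_nat.
Qed.

Lemma grid_step (i m : nat) (d : R) : (0 < m)%N -> m%:R^-1 < d ->
  `|i%:R / m%:R - i.+1%:R / m%:R| < d.
Proof.
move=> m0 md; rewrite -mulrBl -[i.+1]addn1 natrD opprD addrA subrr add0r mulN1r.
by rewrite normrN ger0_norm // invr_ge0 ler0n.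
Qed.

Lemma grid_fine (d : R) : 0 < d -> \forall m \near \oo, (0 < m)%N /\ m%:R^-1 < d.
Proof.
move=> d0; near=> m.
have m0 : (0 < m)%N by near: m; exact: nbhs_infty_gt.
split=> //; rewrite invf_plt ?posrE ?ltr0n //.
near: m; exact: nbhs_infty_gtr.
Unshelve. all: by end_near. Qed.

End unit_interval.

(** * From local to global: chains of good balls and homotopies *)

Section monodromy.
Context {R : realType} {n : nat}.
Variable D : set 'rV[R]_n.
Variable good : 'rV[R]_n -> R -> Prop.
Hypothesis good_sub : forall c r, good c r -> ball c r `<=` D.
Hypothesis good_ex : forall x, D x -> exists2 r, 0 < r & good x r.
Implicit Types x y z c v : 'rV[R]_n.

(** [T] stays general because the lemma serves the interval, for paths, and the square, for
    homotopies. Around each point one good ball works for all nearby points and all radii below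
    [e / 2]; compactness then makes the radius uniform. *)
Lemma lebesgue_number (T : pseudoMetricType R) (h : T -> 'rV[R]_n) (K : set T) :
  continuous h -> (forall p, D (h p)) -> compact K ->
  exists2 d : R, 0 < d & forall p, K p -> exists c r, good c r /\
    forall q, ball p d q -> ball c r (h q).
Proof.
move=> ch Dh /compact_near_coveringP cK.
pose P (d : R) (p : T) := exists c r, good c r /\ forall q, ball p d q -> ball c r (h q).
have HP : forall p, K p -> \forall p' \near p & d \near (0 : R)^'+, P d p'.
  move=> p Kp; have [r r0 gr] := good_ex (Dh p).
  have /nbhs_ballP[e /= e0 He] := ch p _ (nbhsx_ballx (h p) r r0).
  have e20 : 0 < e / 2 by rewrite divr_gt0.
  exists (ball p (e / 2), [set d | d < e / 2]).
    by split; [exact: nbhsx_ballx|exact: nbhs_right_lt].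
  move=> [p' d] /= [pp' de]; exists (h p), r; split=> // q p'q.
  apply: He; rewrite [e]splitr; apply: ball_triangle pp' _.
  by apply: le_ball p'q; exact: ltW.
have H : \forall d \near (0 : R)^'+, K `<=` P d by exact: cK.
have H2 : \forall d \near (0 : R)^'+, 0 < d /\ K `<=` P d.
  by apply: filterI => //; exact: nbhs_right_gt.
by have [d [d0 Hd]] := filter_ex H2; exists d.
Qed.

Lemma path_clamp_continuous g : path_in D g -> continuous (g \o clamp).
Proof.
move=> [cg _]; apply: continuous_retract cg; last exact: clamp_continuous.
by move=> t; rewrite /= in_itv /=; exact: clamp01.
Qed.

Lemma path_mem g t : path_in D g -> 0 <= t <= 1 -> D (g t).
Proof. by move=> [_ H] t01; apply: H; exists t => //=; rewrite in_itv. Qed.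

Lemma path_grid g : path_in D g -> \forall m \near \oo, (0 < m)%N /\
  forall i, (i < m)%N -> exists c r, good c r /\
    ball c r (g (i%:R / m%:R)) /\ ball c r (g (i.+1%:R / m%:R)).
Proof.
move=> pg; have [|d d0 Hd] := lebesgue_number (path_clamp_continuous pg) _
   (@segment_compact R 0 1).
  by move=> t; exact: (path_mem pg (clamp01 t)).
apply: filterS (grid_fine d0) => m [m0 md]; split=> // i im.
have [|c [r [gr Hq]]] := Hd (i%:R / m%:R).
  by rewrite /= in_itv /= grid01 // ltnW.
exists c, r; split=> //; split.
  have := Hq (i%:R / m%:R) (ballxx _ d0).
  by rewrite /= clamp_id // grid01 // ltnW.
have := Hq (i.+1%:R / m%:R); rewrite /= clamp_id ?grid01 //; apply.
exact: grid_step.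
Qed.

Hypothesis D_path_connected :
  forall x y, D x -> D y -> exists g, path_in D g /\ g 0 = x /\ g 1 = y.

(** A path subdivided finely enough is a finite chain of good balls. Besides constancy of functions,
    this yields the eventual constancy of path sums and the growth bounds of the iterated integrals,
    with [good] chosen differently each time. *)
Lemma connected_propagate (A : 'rV[R]_n -> Prop) :
  (forall c r x y, good c r -> ball c r x -> ball c r y -> A x -> A y) ->
  forall x y, D x -> D y -> A x -> A y.
Proof.
move=> HA x y Dx Dy Ax; have [g [pg [g0 g1]]] := D_path_connected Dx Dy.
have [m [m0 Hm]] := filter_ex (path_grid pg).
have H i : (i <= m)%N -> A (g (i%:R / m%:R)).
  elim: i => [_|i IH im]; first by rewrite mul0r g0.
  have [c [r [gr [B1 B2]]]] := Hm i im.
  by apply: HA gr B1 B2 _; apply: IH; exact: ltnW.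
by have := H m (leqnn m); rewrite divff ?g1 // pnatr_eq0 -lt0n.
Qed.

Hypothesis D_null_homotopic : forall g, path_in D g -> g 0 = g 1 ->
  exists H : R * R -> 'rV[R]_n,
    {within `[0, 1] `*` `[0, 1], continuous H} /\
    H @` (`[0, 1] `*` `[0, 1]) `<=` D /\
    (forall s, s \in `[0, 1] -> H (s, 0) = g s /\ H (s, 1) = g 0) /\
    (forall t, t \in `[0, 1] -> H (0, t) = g 0 /\ H (1, t) = g 0).

Variable I : 'rV[R]_n -> 'rV[R]_n -> R.
Hypothesis I_add : forall c r x y z, good c r ->
  ball c r x -> ball c r y -> ball c r z -> I x y + I y z = I x z.

Lemma I_refl x : D x -> I x x = 0.
Proof.
move=> Dx; have [r r0 gr] := good_ex Dx; have Bx := ballxx x r0.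
by apply: (addrI (I x x)); rewrite (I_add gr Bx Bx Bx) addr0.
Qed.

(** Stands for the integral along [g]. For the paths chosen in [global_primitive] it is eventually
    constant in [m], so no limit has to be taken. *)
Definition path_sum (m : nat) (g : R -> 'rV[R]_n) : R :=
  \sum_(i < m) I (g (i%:R / m%:R)) (g (i.+1%:R / m%:R)).

(** Each small square lies in a good ball, so going around it either way gives the same sum. Hence
    consecutive rows differ by a telescoping sum of vertical edges, which vanishes because both
    sides of the grid stay at the base point. The top row is constant and contributes 0. *)
Lemma homotopy_grid (a : nat -> nat -> 'rV[R]_n) (m : nat) :
  (forall i j, (i < m)%N -> (j < m)%N -> exists c r, good c r /\
    [/\ ball c r (a i j), ball c r (a i.+1 j), ball c r (a i j.+1) &
        ball c r (a i.+1 j.+1)]) ->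
  (forall j, (j <= m)%N -> a 0 j = a 0 0 /\ a m j = a 0 0) ->
  (forall i, (i <= m)%N -> a i m = a 0 0) -> D (a 0 0) ->
  \sum_(i < m) I (a i 0) (a i.+1 0) = 0.
Proof.
move=> Ha side top D0.
have row j : (j < m)%N ->
    \sum_(i < m) I (a i j) (a i.+1 j) = \sum_(i < m) I (a i j.+1) (a i.+1 j.+1).
  move=> jm; apply/eqP; rewrite -subr_eq0 -sumrB.
  rewrite (eq_bigr (fun i : 'I_m =>
     - (I (a i.+1 j) (a i.+1 j.+1) - I (a i j) (a i j.+1)))); last first.
    move=> i _; have [c [r [gr [B1 B2 B3 B4]]]] := Ha i j (ltn_ord i) jm.
    have e1 := I_add gr B1 B2 B4; have e2 := I_add gr B1 B3 B4.
    by lra.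
  rewrite sumrN -(big_mkord xpredT (fun i => I (a i.+1 j) (a i.+1 j.+1) - I (a i j) (a i j.+1))).
  rewrite telescope_sumr //.
  have [-> ->] := side j (ltnW jm); have [-> ->] := side j.+1 jm.
  by rewrite subrr oppr0.
have rows j : (j <= m)%N -> \sum_(i < m) I (a i 0) (a i.+1 0) =
    \sum_(i < m) I (a i j) (a i.+1 j).
  elim: j => [//|j IH] jm; exact: (etrans (IH (ltnW jm)) (row j jm)).
rewrite (rows m (leqnn m)) big1 // => i _.
by rewrite (top i (ltnW (ltn_ord i))) (top i.+1 (ltn_ord i)); exact: I_refl.
Qed.

Lemma loop_sum g : path_in D g -> g 0 = g 1 -> \forall m \near \oo, path_sum m g = 0.
Proof.
move=> pg g01; have [H [cH [HD [bot sid]]]] := D_null_homotopic pg g01.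
pose cl (p : R * R) : R * R := (clamp p.1, clamp p.2).
have cl01 p : (`[0, 1] `*` `[0, 1])%classic (cl p).
  by split; rewrite /= in_itv /=; exact: clamp01.
have ccl : continuous cl.
  move=> p; apply: (@cvg_pair _ _ _ (nbhs p) (nbhs (clamp p.1)) (nbhs (clamp p.2))).
    by apply: (@continuous_comp _ _ _ (@fst R R) clamp); [exact: cvg_fst|exact: clamp_continuous].
  by apply: (@continuous_comp _ _ _ (@snd R R) clamp); [exact: cvg_snd|exact: clamp_continuous].
have DH p : D ((H \o cl) p) by apply: HD; exists (cl p).
have [d d0 Hd] := lebesgue_number (continuous_retract cl01 ccl cH) DH
  (compact_setX (@segment_compact R 0 1) (@segment_compact R 0 1)).
apply: filterS (grid_fine d0) => m [m0 md].
pose a i j := H ((i%:R / m%:R), (j%:R / m%:R)).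
have clE i j : (i <= m)%N -> (j <= m)%N -> (H \o cl) ((i%:R / m%:R), (j%:R / m%:R)) = a i j.
  by move=> im jm; rewrite /a /= /cl /= !clamp_id // grid01.
have z01 : (0 : R) \in `[0, 1] by rewrite in_itv /= lexx ler01.
have o01 : (1 : R) \in `[0, 1] by rewrite in_itv /= lexx ler01.
have mm1 : m%:R / m%:R = 1 :> R by rewrite divff // pnatr_eq0 -lt0n.
have a0 i : (i <= m)%N -> a i 0 = g (i%:R / m%:R).
  by move=> im; rewrite /a mul0r; case: (bot (i%:R / m%:R)); rewrite // in_itv /= grid01.
have a00 : a 0%N 0%N = g 0 by rewrite a0 // mul0r.
transitivity (\sum_(i < m) I (a i 0) (a i.+1 0)).
  by apply: eq_bigr => i _; rewrite !a0 // ltnW.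
apply: homotopy_grid.
- move=> i j im jm.
  have [|c [r [gr Hq]]] := Hd ((i%:R / m%:R), (j%:R / m%:R)).
    by split; rewrite /= in_itv /= grid01 // ltnW.
  have st k : ball (k%:R / m%:R : R) d (k.+1%:R / m%:R) by exact: grid_step.
  exists c, r; split=> //; split; rewrite -clE ?(ltnW im) ?(ltnW jm) //; apply: Hq.
  + exact: ballxx.
  + by split; [exact: st|exact: ballxx].
  + by split; [exact: ballxx|exact: st].
  + by split; exact: st.
- move=> j jm; rewrite a00 /a mul0r mm1.
  by apply: sid; rewrite in_itv /= grid01.
- move=> i im; rewrite a00 /a mm1.
  by case: (bot (i%:R / m%:R)); rewrite // in_itv /= grid01.
- by rewrite a00; apply: path_mem => //; rewrite lexx ler01.
Qed.

(** Concatenation of three paths as a sum of clamped pieces minus the junction values: continuity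
    needs no gluing argument. Equal thirds make the grid with [3m] steps restrict to the grid with
    [m] steps on each piece. *)
Definition cat3 (p q r : R -> 'rV[R]_n) (t : R) : 'rV[R]_n :=
  p (clamp (3 * t)) + q (clamp (3 * t - 1)) + r (clamp (3 * t - 2)) - p 1 - q 1.

Section cat3.
Variables p q r : R -> 'rV[R]_n.
Hypotheses (pp : path_in D p) (pq : path_in D q) (pr : path_in D r).
Hypotheses (p1 : p 1 = q 0) (q1 : q 1 = r 0).

Lemma cat3_1 t : 0 <= t <= 1 -> cat3 p q r (t / 3) = p t.
Proof.
move=> /andP[t0 t1]; rewrite /cat3; have -> : 3 * (t / 3) = t by field.
have e1 : clamp (t - 1) = 0 by apply: clamp0; lra.
have e2 : clamp (t - 2) = 0 by apply: clamp0; lra.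
rewrite e1 e2 clamp_id ?t0 ?t1 //.
by rewrite p1 q1 [p t + _ + _]addrAC addrK addrK.
Qed.

Lemma cat3_2 t : 0 <= t <= 1 -> cat3 p q r ((1 + t) / 3) = q t.
Proof.
move=> /andP[t0 t1]; rewrite /cat3; have -> : 3 * ((1 + t) / 3) = 1 + t by field.
have e1 : clamp (1 + t) = 1 by apply: clamp1; lra.
have e2 : clamp (1 + t - 2) = 0 by apply: clamp0; lra.
have e3 : 1 + t - 1 = t by ring.
rewrite e1 e2 e3 clamp_id ?t0 ?t1 //.
by rewrite -q1 addrAC addrK addrC addKr.
Qed.

Lemma cat3_3 t : 0 <= t <= 1 -> cat3 p q r ((2 + t) / 3) = r t.
Proof.
move=> /andP[t0 t1]; rewrite /cat3; have -> : 3 * ((2 + t) / 3) = 2 + t by field.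
have e1 : clamp (2 + t) = 1 by apply: clamp1; lra.
have e2 : clamp (2 + t - 1) = 1 by apply: clamp1; lra.
have e3 : 2 + t - 2 = t by ring.
rewrite e1 e2 e3 clamp_id ?t0 ?t1 //.
by rewrite -[LHS]addrA -opprD [p 1 + q 1 + _]addrC addrK.
Qed.

Lemma cat3_path : path_in D (cat3 p q r).
Proof.
split.
  apply: continuous_subspaceT => t.
  have aff (a : R) : continuous (fun t : R => 3 * t - a).
    by move=> s; apply: cvgB; [apply: cvgM; [exact: cvg_cst|exact: cvg_id]|exact: cvg_cst].
  have aff0 : continuous (fun t : R => 3 * t).
    by move=> s; apply: cvgM; [exact: cvg_cst|exact: cvg_id].
  have cc (g : R -> 'rV[R]_n) (h : R -> R) : path_in D g -> continuous h ->
      continuous (fun t => g (clamp (h t))).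
    move=> pg ch s; have pc : continuous (g \o clamp) := path_clamp_continuous pg.
    exact: (@continuous_comp _ _ _ h (g \o clamp) s (ch s) (pc (h s))).
  have c1 := cc _ _ pp aff0 t; have c2 := cc _ _ pq (aff 1) t.
  have c3 := cc _ _ pr (aff 2) t.
  exact: (cvgB (cvgB (cvgD (cvgD c1 c2) c3) (cvg_cst (p 1))) (cvg_cst (q 1))).
move=> _ [t /= + <-]; rewrite in_itv /= => /andP[t0 t1].
have [h1|h1] := lerP (3 * t) 1.
  have -> : t = (3 * t) / 3 by field.
  by rewrite cat3_1; [apply: path_mem => //|]; apply/andP; split; lra.
have [h2|h2] := lerP (3 * t) 2.
  have -> : t = (1 + (3 * t - 1)) / 3 by field.
  by rewrite cat3_2; [apply: path_mem => //|]; apply/andP; split; lra.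
have -> : t = (2 + (3 * t - 2)) / 3 by field.
by rewrite cat3_3; [apply: path_mem => //|]; apply/andP; split; lra.
Qed.

Lemma path_sum_cat3 m : (0 < m)%N ->
  path_sum (m + (m + m)) (cat3 p q r) = path_sum m p + (path_sum m q + path_sum m r).
Proof.
move=> m0; have mn : m%:R != 0 :> R by rewrite pnatr_eq0 -lt0n.
have mm : (m + (m + m))%:R = 3 * m%:R :> R by rewrite !natrD; ring.
have e1 i : (i <= m)%N -> cat3 p q r (i%:R / (m + (m + m))%:R) = p (i%:R / m%:R).
  move=> im; rewrite -(cat3_1 (grid01 im)); congr cat3; rewrite mm; field.
  by rewrite mn.
have e2 i : (i <= m)%N -> cat3 p q r ((m + i)%:R / (m + (m + m))%:R) = q (i%:R / m%:R).
  move=> im; rewrite -(cat3_2 (grid01 im)); congr cat3; rewrite mm natrD; field.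
  by rewrite mn.
have e3 i : (i <= m)%N -> cat3 p q r ((m + (m + i))%:R / (m + (m + m))%:R) = r (i%:R / m%:R).
  move=> im; rewrite -(cat3_3 (grid01 im)); congr cat3; rewrite mm !natrD; field.
  by rewrite mn.
rewrite /path_sum big_split_ord /= big_split_ord /=.
congr (_ + (_ + _)); apply: eq_bigr => i _.
- by rewrite !e1 // ltnW.
- by rewrite -addnS !e2 // ltnW.
- by rewrite -!addnS !e3 // ltnW.
Qed.
End cat3.

Definition segment_path x y (t : R) := x + t *: (y - x).

Lemma segment_path_in c r x y : good c r -> ball c r x -> ball c r y ->
  path_in D (segment_path x y).
Proof.
move=> gr Bx By; split.
  apply: continuous_subspaceT => t.
  by apply: cvgD; [exact: cvg_cst|apply: cvgZr_tmp; exact: cvg_id].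
move=> _ [t /= + <-]; rewrite in_itv /= => t01.
by apply: (good_sub gr); exact: ball_segment.
Qed.

Lemma path_sum_segment c r x y m : good c r -> ball c r x -> ball c r y ->
  (0 < m)%N -> path_sum m (segment_path x y) = I x y.
Proof.
move=> gr Bx By m0.
pose g k := segment_path x y (k%:R / m%:R).
have Bg k : (k <= m)%N -> ball c r (g k).
  by move=> km; apply: ball_segment => //; exact: grid01.
have g0 : g 0%N = x by rewrite /g /segment_path mul0r scale0r addr0.
have gm : g m = y.
  rewrite /g /segment_path divff; last by rewrite pnatr_eq0 -lt0n.
  by rewrite scale1r addrC subrK.
have H k : (k <= m)%N -> \sum_(i < k) I (g i) (g i.+1) = I x (g k).
  elim: k => [_|k IH km].
    by rewrite big_ord0 g0 (I_refl (good_sub gr Bx)).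
  rewrite big_ord_recr /= IH; last exact: ltnW.
  exact: (I_add gr Bx (Bg k (ltnW km)) (Bg k.+1 km)).
exact: (etrans (H m (leqnn m)) (congr1 (I x) gm)).
Qed.

(** The value at [x] is the eventual path sum along a chosen path from [x0] to [x]. The loop made of
    that path, a segment and a path back to [x0] has eventual sum 0, which gives the increment over
    the segment. *)
Lemma global_primitive x0 : D x0 -> exists phi : 'rV[R]_n -> R,
  forall c r x y, good c r -> ball c r x -> ball c r y -> phi y = phi x + I x y.
Proof.
move=> D0.
(* Keeping [D x] under the existential lets choice return a total function; outside [D] the path is
   a dummy. *)
have exP x : exists g, D x -> path_in D g /\ g 0 = x0 /\ g 1 = x.
  have [Dx|nDx] := pselect (D x); last by exists (fun _ => 0).
  by have [g Hg] := D_path_connected D0 Dx; exists g.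
have exQ x : exists g, D x -> path_in D g /\ g 0 = x /\ g 1 = x0.
  have [Dx|nDx] := pselect (D x); last by exists (fun _ => 0).
  by have [g Hg] := D_path_connected Dx D0; exists g.
have [P HP] := choice exP; have [Q HQ] := choice exQ.
have loop c r x y : good c r -> ball c r x -> ball c r y ->
    \forall m \near \oo, path_sum m (P x) + (I x y + path_sum m (Q y)) = 0.
  move=> gr Bx By; have Dx := good_sub gr Bx; have Dy := good_sub gr By.
  have [pP [P0 P1]] := HP x Dx; have [pQ [Q0 Q1]] := HQ y Dy.
  have pS := segment_path_in gr Bx By.
  have S0 : P x 1 = segment_path x y 0 by rewrite P1 /segment_path scale0r addr0.
  have S1 : segment_path x y 1 = Q y 0.
    by rewrite Q0 /segment_path scale1r addrC subrK.
  have pC := cat3_path pP pS pQ S0 S1.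
  have c0 : cat3 (P x) (segment_path x y) (Q y) 0 = cat3 (P x) (segment_path x y) (Q y) 1.
    have h01 : 0 <= (0 : R) <= 1 by rewrite lexx ler01.
    have h11 : 0 <= (1 : R) <= 1 by rewrite lexx ler01.
    have := cat3_1 S0 S1 h01; have := cat3_3 (P x) (segment_path x y) (Q y) h11.
    have -> : (2 + 1) / 3 = 1 :> R by field.
    by rewrite mul0r => -> ->; rewrite P0 Q1.
  have [N _ HN] := loop_sum pC c0.
  (* The successor makes [m] positive, as a subdivision into [m] steps requires. *)
  exists N.+1 => // m /= Nm; have m0 : (0 < m)%N by apply: leq_trans Nm.
  have := HN (m + (m + m))%N; rewrite path_sum_cat3 // (path_sum_segment gr) //.
  by apply; rewrite /= (leq_trans _ (leq_addr _ _)) // ltnW.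
have step c r x y : good c r -> ball c r x -> ball c r y ->
    \forall m \near \oo, path_sum m (P y) = path_sum m (P x) + I x y.
  move=> gr Bx By; have Dy := good_sub gr By.
  (* The loop over the segment from [x] to [y] and the loop over the trivial segment at [y] both
     return along [Q y]; comparing them eliminates it. *)
  apply: filterS2 (loop _ _ _ _ gr Bx By) (loop _ _ _ _ gr By By) => m.
  rewrite (I_refl Dy) add0r => /eqP + /eqP; rewrite !addr_eq0 => /eqP -> /eqP ->.
  by rewrite opprD addrAC addNr add0r.
have ev_cst x : D x -> exists a, \forall m \near \oo, path_sum m (P x) = a.
  move=> Dx; apply: (@connected_propagate (fun x => exists a,
    \forall m \near \oo, path_sum m (P x) = a) _ x0 x D0 Dx).
    move=> c r y z gr By Bz [a Ha]; exists (a + I y z).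
    by apply: filterS2 (step _ _ _ _ gr By Bz) Ha => m -> ->.
  have [pP [P0 P1]] := HP x0 D0; exists 0; apply: loop_sum => //.
  by rewrite P0 P1.
have exphi x : exists a, D x -> \forall m \near \oo, path_sum m (P x) = a.
  have [Dx|nDx] := pselect (D x); last by exists 0.
  by have [a Ha] := ev_cst x Dx; exists a.
have [phi Hphi] := choice exphi.
exists phi => c r x y gr Bx By.
have Dx := good_sub gr Bx; have Dy := good_sub gr By.
have /filter_ex[m //] : \forall m \near \oo, phi y = phi x + I x y.
by apply: filterS3 (step _ _ _ _ gr Bx By) (Hphi x Dx) (Hphi y Dy) => m e1 <- <-.
Qed.

End monodromy.

(** * Constancy and primitives on a simply connected domain *)

Section poincare.
Context {R : realType} {n : nat}.
Variable D : set 'rV[R]_n.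
Hypothesis oD : open D.
Hypothesis scD : simply_connected D.

Lemma constant_on (f : 'rV[R]_n -> R) :
  (forall x i, D x -> is_derive x (ev i) f 0) ->
  forall x y, D x -> D y -> f x = f y.
Proof.
move=> df x y Dx Dy; have [_ [pc _]] := scD.
pose good (c : 'rV[R]_n) (r : R) := ball c r `<=` D.
apply: (@connected_propagate R n D good _ pc (fun z => f x = f z) _ x y Dx Dy) => //.
  move=> z Dz; have /nbhs_ballP[r r0 H] := near_open oD Dz.
  by exists r.
move=> c r z w gr Bz Bw ->; apply/esym/eqP.
have H : forall y, ball c r y -> forall i, derivable f y (ev i) /\ `|pd i f y| <= 0.
  move=> v Bv i; have [a b] := df v i (gr _ Bv); split=> //.
  by rewrite /pd b normr0.
have := ball_lipschitz H Bz Bw.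
by rewrite mulr0 mul0r normr_le0 subr_eq0.
Qed.

Lemma poincare (alpha : 'I_n -> 'rV[R]_n -> R) x0 : D x0 ->
  (forall i, smooth_on D (alpha i)) ->
  (forall i j x, D x -> pd i (alpha j) x = pd j (alpha i) x) ->
  exists phi : 'rV[R]_n -> R, phi x0 = 0 /\
    forall x i, D x -> is_derive x (ev i) phi (alpha i x).
Proof.
move=> D0 sa ca; have [_ [pc nh]] := scD.
have [phi Hphi] := @global_primitive R n D (tame_ball D alpha)
  (fun c r H => let: And3 _ s _ := H in s)
  (fun x Dx => let: ex_intro r H := tame_ball_ex oD sa Dx in
     ex_intro2 _ _ r (let: And3 r0 _ _ := H in r0) H)
  pc nh (segment_integral alpha) (fun c r x y z => @segment_integral_add R n D oD alpha sa ca c r x y z)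
  x0 D0.
exists (fun x => phi x - phi x0); split; first by rewrite subrr.
move=> x i Dx; have [r tB] := tame_ball_ex oD sa Dx.
have [r0 _ _] := tB; have Bx := ballxx x r0.
have d1 := segment_integral_pd oD sa ca i tB Bx Bx.
have d2 := is_deriveD (is_derive_cst (phi x - phi x0) x (ev i)) d1.
apply: near_eq_is_derive (is_derive_eq d2 (add0r _)).
have : \forall y \near x, ball x r y by exact: nbhsx_ballx.
apply: filterS => y By /=.
by rewrite (Hphi x r x y tB Bx By) /= addrAC.
Qed.

End poincare.

(** * Iterated integrals *)

Section iterated_integrals.
Context {R : realType} {n p : nat}.
Variable D : set 'rV[R]_n.
Hypothesis oD : open D.
Hypothesis scD : simply_connected D.
Hypothesis D0 : D 0.
Implicit Types x y z c v : 'rV[R]_n.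

(** The class fed to [smooth_ind] is [f] together with all smooth functions; continuity of [f]
    itself comes from its continuous partial derivatives. *)
Lemma smooth_of_derive (f : 'rV[R]_n -> R) (g : 'I_n -> 'rV[R]_n -> R) :
  (forall i, smooth_on D (g i)) ->
  (forall x i, D x -> is_derive x (ev i) f (g i x)) -> smooth_on D f.
Proof.
move=> sg df.
have cf x : D x -> {for x, continuous f}.
  move=> Dx; apply: pd_continuous.
    by apply: filterS (near_open oD Dx) => y Dy i; case: (df y i Dy).
  move=> i; apply: (eq_on_continuous oD _ Dx (smooth_continuous (sg i) Dx)).
  by move=> y Dy; case: (df y i Dy).
apply: (@smooth_ind _ _ D oD R (fun h => h = f \/ smooth_on D h)); last by left.
- by move=> h [->|sh] x Dx; [exact: cf|exact: (smooth_continuous sh Dx)].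
- move=> h [->|sh] i.
    by exists (g i); [right; exact: sg|move=> x Dx; exact: df].
  exists (pd i h); first by right; exact: (smooth_pd i sh).
  by move=> x Dx; exact: (smooth_is_derive i sh Dx).
Qed.

Lemma poincare_mx (w : 'I_n -> 'rV[R]_n -> 'M[R]_p) :
  (forall i, smooth_on D (w i)) ->
  (forall i j x, D x -> pd i (w j) x = pd j (w i) x) ->
  exists q : 'rV[R]_n -> 'M[R]_p, [/\ q 0 = 0, smooth_on D q &
    (forall x i, D x -> is_derive x (ev i) q (w i x))].
Proof.
move=> sw cw.
have sE i a b := (smooth_mxP oD (w i)).1 (sw i) a b.
have ex (ab : 'I_p * 'I_p) : exists f : 'rV[R]_n -> R, f 0 = 0 /\
    forall x i, D x -> is_derive x (ev i) f (w i x ab.1 ab.2).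
  apply: (poincare oD scD D0 (fun i => sE i ab.1 ab.2)) => i j x Dx.
  have e1 := pd_mxE i ab.1 ab.2 (sw j) Dx.
  have e2 := pd_mxE j ab.1 ab.2 (sw i) Dx.
  apply: etrans (esym e1) _; apply: etrans _ e2.
  exact: (congr1 (fun A : 'M[R]_p => A ab.1 ab.2) (cw i j x Dx)).
have [f Hf] := choice ex.
exists (fun x => \matrix_(a, b) f (a, b) x); split.
- by apply/matrixP => a b; rewrite !mxE; case: (Hf (a, b)).
- apply/(smooth_mxP oD) => a b.
  have s := smooth_of_derive (fun i => sE i a b) (proj2 (Hf (a, b))).
  by apply: (eq_smooth oD s) => x _; rewrite mxE.
- move=> x i Dx; apply/is_derive_mxP => a b.
  have d := (Hf (a, b)).2 x i Dx.
  by under eq_fun do rewrite mxE.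
Qed.

Variable kappa : 'I_n -> 'rV[R]_n -> 'M[R]_p.
Hypothesis smooth_kappa : forall i, smooth_on D (kappa i).
Hypothesis closed_kappa : forall i j x, D x -> pd i (kappa j) x = pd j (kappa i) x.
Hypothesis comm_kappa : forall i j x, D x ->
  kappa i x *m kappa j x = kappa j x *m kappa i x.

(** The form Q_m kappa is closed: d_i (Q_m kappa_j) = Q_(m-1) kappa_i kappa_j + Q_m d_i kappa_j,
    where the first term is symmetric in i, j by commutation and the second by closedness of
    kappa. *)
Lemma iterated_integrals : exists Q : nat -> 'rV[R]_n -> 'M[R]_p,
  [/\ Q 0%N = (fun _ => 1%:M), forall m, smooth_on D (Q m),
      forall m, Q m.+1 0 = 0 &
      forall m x i, D x -> is_derive x (ev i) (Q m.+1) (Q m x *m kappa i x)].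
Proof.
(* The invariant records that dq = q' kappa for some q', which is what makes q kappa closed. For the
   constant Q_0 one takes q' = 0. *)
pose P (q : 'rV[R]_n -> 'M[R]_p) := smooth_on D q /\ exists q', forall x i, D x ->
  is_derive x (ev i) q (q' x *m kappa i x).
have ex (q : 'rV[R]_n -> 'M[R]_p) : exists r : 'rV[R]_n -> 'M[R]_p, P q ->
    P r /\ r 0 = 0 /\ forall x i, D x -> is_derive x (ev i) r (q x *m kappa i x).
  have [[sq [q' dq]]|nP] := pselect (P q); last by exists q.
  have [||r [r0 sr dr]] := poincare_mx (w := fun i x => q x *m kappa i x).
  - by move=> i; exact: (smooth_mulmx oD sq (smooth_kappa i)).
  - move=> i j x Dx.
    have d1 := is_derive_mulmx (dq x i Dx) (smooth_is_derive i (smooth_kappa j) Dx).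
    have d2 := is_derive_mulmx (dq x j Dx) (smooth_is_derive j (smooth_kappa i) Dx).
    apply: etrans (pd_val d1) _; apply: etrans _ (esym (pd_val d2)).
    by rewrite (closed_kappa i j Dx) -!mulmxA (comm_kappa i j Dx).
  by exists r => _; split=> //; split=> //; exists q.
have [step Hstep] := choice ex.
pose Q m := iter m step (fun _ => 1%:M).
have PQ m : P (Q m).
  elim: m => [|m IH]; last by case: (Hstep _ IH).
  split; first exact: smooth_cst.
  exists (fun _ => 0) => x i Dx; rewrite mul0mx; exact: is_derive_cst.
exists Q; split=> //.
- by move=> m; case: (PQ m).
- by move=> m; case: (Hstep _ (PQ m)) => _ [].
- by move=> m; case: (Hstep _ (PQ m)) => _ [].
Qed.

End iterated_integrals.

(** * Decay of the iterated integrals *)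

Section growth.
Context {R : realType} {n p : nat}.
Variable D : set 'rV[R]_n.
Hypothesis oD : open D.
Hypothesis scD : simply_connected D.
Hypothesis D0 : D 0.
Implicit Types x y z c v : 'rV[R]_n.
Variable kappa : 'I_n -> 'rV[R]_n -> 'M[R]_p.
Hypothesis smooth_kappa : forall i, smooth_on D (kappa i).
Variable Q : nat -> 'rV[R]_n -> 'M[R]_p.
Hypothesis Q_0 : Q 0%N = (fun _ => 1%:M).
Hypothesis Q_at0 : forall m, Q m.+1 0 = 0.
Hypothesis smooth_Q : forall m, smooth_on D (Q m).
Hypothesis derive_Q : forall m x i, D x ->
  is_derive x (ev i) (Q m.+1) (Q m x *m kappa i x).

Lemma mx_norm_leP q r (A : 'M[R]_(q, r)) (C : R) : 0 <= C ->
  (`|A| <= C) <-> forall a b, `|A a b| <= C.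
Proof.
move=> C0; rewrite [`|A|]/Num.Def.normr /= mx_normrE; split=> [/bigmax_leP[_ H] a b|H].
  exact: (H (a, b)).
by apply/bigmax_leP; split=> // -[a b] _; exact: H.
Qed.

Lemma mx_norm_entry q r (A : 'M[R]_(q, r)) a b : `|A a b| <= `|A|.
Proof. exact: (mx_norm_leP A (normr_ge0 _)).1. Qed.

(** Both g - f and g + f are nondecreasing. The majorant [dg] may vary with [t], as the exponential
    comparison function in [growth_ball] requires. *)
Lemma mean_value_le (f g df dg : R -> R) :
  (forall t : R, 0 <= t <= 1 -> is_derive t 1 f (df t)) ->
  (forall t : R, 0 <= t <= 1 -> is_derive t 1 g (dg t)) ->
  (forall t : R, 0 <= t <= 1 -> `|df t| <= dg t) ->
  forall t : R, 0 <= t <= 1 -> `|f t - f 0| <= g t - g 0.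
Proof.
move=> Hf Hg H t /andP[t0 t1].
have mono (h dh : R -> R) : (forall t : R, 0 <= t <= 1 -> is_derive t 1 h (dh t)) ->
    (forall t : R, 0 <= t <= 1 -> 0 <= dh t) -> 0 <= h t - h 0.
  move=> Hh dh0; have [|  |s sI ->] := @MVT_segment _ h dh 0 t t0.
  - move=> s; rewrite in_itv /= => /andP[a b]; apply: Hh; lra.
  - apply: derivable_within_continuous => s; rewrite in_itv /= => /andP[a b].
    by have [] := Hh s; [lra|].
  - rewrite in_itv /= in sI; case/andP: sI => a b.
    by apply: mulr_ge0; [apply: dh0; lra|lra].
have e1 : 0 <= (g t - f t) - (g 0 - f 0).
  apply: (mono (fun t => g t - f t) (fun t => dg t - df t)).
    by move=> s sI; apply: is_deriveB; [exact: Hg|exact: Hf].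
  by move=> s sI; have := H s sI; rewrite ler_norml => /andP[a b]; lra.
have e2 : 0 <= (g t + f t) - (g 0 + f 0).
  apply: (mono (fun t => g t + f t) (fun t => dg t + df t)).
    by move=> s sI; apply: is_deriveD; [exact: Hg|exact: Hf].
  by move=> s sI; have := H s sI; rewrite ler_norml => /andP[a b]; lra.
by rewrite ler_norml; apply/andP; split; lra.
Qed.

Definition kappa_ball c r := ball c r `<=` D /\
  exists M, forall y, ball c r y -> forall i a b, `|kappa i y a b| <= M.

Lemma kappa_ball_ex x : D x -> exists2 r, 0 < r & kappa_ball x r.
Proof.
move=> Dx.
pose M := \sum_i (`|kappa i x| + 1).
have H : \forall y \near x, D y /\ forall i, `|kappa i y| <= M.
  apply: filterI; first exact: near_open.
  apply: (@filter_forall _ _ (fun i y => `|kappa i y| <= M) (nbhs x) _) => i.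
  have /continuous_distP/(_ 1 ltr01) := smooth_continuous (smooth_kappa i) Dx.
  apply: filterS => y Hy; rewrite /M (bigD1 i) //=.
  apply: ler_wpDr; first by apply: sumr_ge0 => j _; rewrite addr_ge0.
  rewrite -[kappa i y](subrK (kappa i x)) addrC; apply: le_trans (ler_normD _ _) _.
  by rewrite lerD // distrC.
move/nbhs_ballP: H => [r /= r0 H]; exists r => //; split.
  by move=> y /H[].
exists M => y /H[_ H2] i a b; apply: le_trans (H2 i); exact: mx_norm_entry.
Qed.

(** Asking this for every [rho] makes the power series with coefficients [Q m x] entire in
    lambda. *)
Definition summable_at x := forall rho, 0 < rho -> exists C, forall m,
  `|Q m x| * rho ^+ m <= C.

(* By induction on m, |Q_m| rho^m <= C e^(K t) at time t of the segment from y to z: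
   integrating dQ_(m+1) = Q_m kappa reproduces the bound with the same C and K. *)
Lemma growth_ball c r y : kappa_ball c r -> ball c r y -> summable_at y ->
  forall rho, 0 < rho -> exists C, forall z, ball c r z ->
    forall m, `|Q m z| * rho ^+ m <= C.
Proof.
move=> [BD [M0 bM0]] By Sy rho rho0; have [C0 HC0] := Sy rho rho0.
have r0 := ball_rV_gt0 By.
pose M := Num.max 0 M0; have M_ge0 : 0 <= M by rewrite le_max lexx.
have bM w : ball c r w -> forall i a b, `|kappa i w a b| <= M.
  by move=> Bw i a b; rewrite le_max (bM0 w Bw) orbT.
pose C := Num.max 0 C0; have C_ge0 : 0 <= C by rewrite le_max lexx.
have HC m : `|Q m y| * rho ^+ m <= C by rewrite le_max HC0 orbT.
(* There are [n] directions, a displacement of at most [2 * r] in each, and [p] products with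
   entries of kappa bounded by [M]; the factor [rho] pays for passing from rho^m to rho^(m+1). *)
pose K := n%:R * (2 * r) * (p%:R * M) * rho.
have K_ge0 : 0 <= K by rewrite /K !mulr_ge0 // ltW.
exists (C * expR K) => z Bz m.
pose g (t : R) := y + t *: (z - y).
have Bg (t : R) : 0 <= t <= 1 -> ball c r (g t) by move=> tI; exact: ball_segment.
have dyz i : `|(z - y) 0 i| <= 2 * r.
  have h1 := (mem_ball_rV c y r0).1 By i; have h2 := (mem_ball_rV c z r0).1 Bz i.
  rewrite !mxE (_ : z 0 i - y 0 i = (c 0 i - y 0 i) - (c 0 i - z 0 i)); last by ring.
  by apply: le_trans (ler_normB _ _) _; lra.
have rhom k : 0 < rho ^+ k by exact: exprn_gt0.
suff key (t : R) : 0 <= t <= 1 -> `|Q m (g t)| * rho ^+ m <= C * expR (t * K).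
  have o01 : 0 <= (1 : R) <= 1 by rewrite lexx ler01.
  by have := key 1 o01; rewrite /g scale1r addrC subrK mul1r.
elim: m t => [|m IH] t tI.
  have := HC 0%N; rewrite Q_0 => H0; apply: le_trans H0 _.
  rewrite -[leLHS]mulr1; apply: ler_wpM2l => //.
  by rewrite -expR0 ler_expR mulr_ge0 //; case/andP: tI.
rewrite -ler_pdivlMr //; apply/mx_norm_leP.
  by rewrite divr_ge0 ?mulr_ge0 ?expR_ge0 // ltW.
move=> a b.
pose df (s : R) := \sum_i (z - y) 0 i * (Q m (g s) *m kappa i (g s)) a b.
(* The comparison function: its derivative is [K * G], and the induction hypothesis bounds the
   derivative of the entry of [Q m.+1] along the segment by the same quantity. *)
pose G (s : R) := C * expR (s * K) / rho ^+ m.+1.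
have dQ (s : R) : 0 <= s <= 1 -> is_derive s 1 (fun u => Q m.+1 (g u) a b) (df s).
  move=> sI; have Dg := BD _ (Bg s sI).
  have sQ := (smooth_mxP oD _).1 (smooth_Q m.+1) a b.
  have d := smooth_is_derive_dir oD (z - y) sQ Dg.
  move/is_derive_lineP: d => d; apply: (is_derive_eq d).
  apply: eq_bigr => i _; congr (_ * _).
  have /is_derive_mxP/(_ a b) d' := derive_Q m i Dg.
  exact: (pd_val d').
have dG (s : R) : 0 <= s <= 1 -> is_derive s 1 G (K * G s).
  move=> sI.
  have d1 : is_derive s 1 (fun u : R => expR (u * K)) (K * expR (s * K)).
    have d0 : is_derive s 1 (fun u : R => u * K) K.
      have d := is_derive_affine 0 K s.
      by move: d; under eq_fun do rewrite add0r.
    have := @is_derive1_comp _ expR (fun u : R => u * K) s _ _ (is_derive_expR _) d0.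
    by rewrite mulrC.
  have d2 := is_derive_mul1 (is_derive_mul1 (is_derive_cst C s 1) d1)
    (is_derive_cst (rho ^+ m.+1)^-1 s 1).
  by apply: (is_derive_eq d2); rewrite /G /= !(mul0r, mulr0, add0r, addr0); ring.
have H (s : R) : 0 <= s <= 1 -> `|df s| <= K * G s.
  move=> sI; have IHs := IH s sI; rewrite -ler_pdivlMr // in IHs.
  apply: (@le_trans _ _ (\sum_(i < n) (2 * r) * (p%:R * ((C * expR (s * K) / rho ^+ m) * M)))).
    apply: le_trans (ler_norm_sum _ _ _) _; apply: ler_sum => i _; rewrite normrM.
    apply: ler_pM => //; rewrite mxE.
    apply: le_trans (ler_norm_sum _ _ _) _.
    rewrite mulr_natl -[X in _ *+ X]card_ord -sumr_const; apply: ler_sum => j _.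
    rewrite normrM; apply: ler_pM => //; last exact: (bM _ (Bg s sI)).
    by apply: le_trans IHs; exact: mx_norm_entry.
  rewrite sumr_const card_ord -mulr_natl /K /G exprS.
  have rn : rho != 0 by rewrite gt_eqF.
  have rmn : rho ^+ m != 0 by rewrite expf_neq0.
  move: (rho ^+ m) rmn (expR (s * K)) => u u0 e.
  rewrite le_eqVlt; apply/orP; left; apply/eqP; field.
  by rewrite rn u0.
have z01 : 0 <= (0 : R) <= 1 by rewrite lexx ler01.
have E := mean_value_le dQ dG H tI.
have F : `|Q m.+1 (g 0) a b| <= G 0.
  rewrite /G mul0r expR0 mulr1 ler_pdivlMr //.
  apply: le_trans (HC m.+1); rewrite /g scale0r addr0; apply: ler_wpM2r; first exact: ltW.
  exact: mx_norm_entry.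
rewrite -/(G t) -[Q m.+1 (g t) a b](subrK (Q m.+1 (g 0) a b)).
apply: le_trans (ler_normD _ _) _.
by have := lerD E F; rewrite subrK.
Qed.

(** At the origin only [Q 0] survives, so the bounds are trivial there; [growth_ball] carries them
    along a finite chain of balls, where the constants may change from ball to ball. *)
Lemma summable_on x : D x -> summable_at x.
Proof.
move=> Dx; have [_ [pc _]] := scD.
apply: (@connected_propagate R n D kappa_ball kappa_ball_ex pc summable_at _ 0 x D0 Dx).
- by move=> c r y z tB By Bz Sy rho /(growth_ball tB By Sy)[C HC]; exists C; exact: HC.
- move=> rho rho0; exists (`|Q 0%N 0| + 0) => -[|m].
    by rewrite expr0 mulr1 addr0.
  by rewrite Q_at0 normr0 mul0r addr0.
Qed.

Lemma growth x : D x -> exists2 r, 0 < r & ball x r `<=` D /\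
  forall rho, 0 < rho -> exists C, forall y, ball x r y ->
    forall m, `|Q m y| * rho ^+ m <= C.
Proof.
move=> Dx; have [r r0 kB] := kappa_ball_ex Dx; exists r => //; split; first by case: kB.
exact: growth_ball kB (ballxx x r0) (summable_on Dx).
Qed.

End growth.

(** * Power series with smooth coefficients *)

Section geometric_sums.
Context {R : realType}.
Implicit Types a b : nat -> R.

Definition sumR a : R := limn (series a).

(** The ratio one half is a normalisation: coefficients bounded by C / (2 rho)^m, multiplied by m-th
    powers of size at most rho^m, have this form. *)
Definition geo_le (C : R) a := forall m, `|a m| <= C * 2^-1 ^+ m.

Let half_lt1 : `|2^-1 : R| < 1.
Proof. by rewrite ger0_norm; lra. Qed.

Lemma geo_norm_cvg C a : geo_le C a -> cvgn [normed series a].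
Proof.
move=> H; have C0 : 0 <= C by have := H 0%N; rewrite expr0 mulr1; apply: le_trans.
apply: (@series_le_cvg _ (fun m => `|a m|) (geometric C 2^-1)) => //.
- by move=> m; apply: geometric_ge0 => //; lra.
- exact: is_cvg_geometric_series.
Qed.

Lemma geo_cvg C a : geo_le C a -> cvgn (series a).
Proof. by move=> /geo_norm_cvg; exact: normed_cvg. Qed.

Lemma sumR_norm C a : geo_le C a -> `|sumR a| <= 2 * C.
Proof.
move=> H; have cn := geo_norm_cvg H.
apply: le_trans (lim_series_norm cn) _.
have cg := @cvg_geometric_series _ C _ half_lt1.
have -> : 2 * C = limn (series (geometric C (2^-1 : R))).
  by rewrite (cvg_lim _ cg) //; field.
by apply: lim_series_le => //; exact: is_cvg_geometric_series.
Qed.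

Lemma sumRD C C' a b : geo_le C a -> geo_le C' b ->
  sumR (fun m => a m + b m) = sumR a + sumR b.
Proof. by move=> /geo_cvg ca /geo_cvg cb; exact: (lim_seriesD ca cb). Qed.

Lemma sumRB C C' a b : geo_le C a -> geo_le C' b ->
  sumR (fun m => a m - b m) = sumR a - sumR b.
Proof. by move=> /geo_cvg ca /geo_cvg cb; exact: (lim_seriesB ca cb). Qed.

Lemma sumRZ C k a : geo_le C a -> sumR (fun m => k * a m) = k * sumR a.
Proof. by move=> /geo_cvg ca; exact: (lim_seriesZ k ca). Qed.

Lemma geoD C C' a b : geo_le C a -> geo_le C' b ->
  geo_le (C + C') (fun m => a m + b m).
Proof.
by move=> Ha Hb m; rewrite mulrDl; apply: le_trans (ler_normD _ _) _; apply: lerD.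
Qed.

Lemma geoZ C k a : geo_le C a -> geo_le (`|k| * C) (fun m => k * a m).
Proof. by move=> H m; rewrite normrM -mulrA ler_wpM2l. Qed.

Lemma geoB C C' a b : geo_le C a -> geo_le C' b ->
  geo_le (C + C') (fun m => a m - b m).
Proof.
by move=> Ha Hb m; rewrite mulrDl; apply: le_trans (ler_normB _ _) _; apply: lerD.
Qed.

Lemma geo_weak C C' a : C <= C' -> geo_le C a -> geo_le C' a.
Proof.
move=> CC H m; apply: le_trans (H m) _; exact: ler_wpM2r.
Qed.

Lemma sumR_single a k : (forall m, m != k -> a m = 0) -> sumR a = a k.
Proof.
move=> H; apply: cvg_lim => //; apply: cvg_near_cst.
exists k.+1 => // m /= km; rewrite /series /= big_mkord.
rewrite (bigD1 (Ordinal km)) //= big1 ?addr0 // => i ik.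
by apply: H; rewrite -val_eqE in ik.
Qed.

Lemma sumR_shift C a : geo_le C a ->
  sumR (fun m => if m is m'.+1 then a m' else 0) = sumR a.
Proof.
move=> /geo_cvg ca; apply: cvg_lim => //; rewrite -cvg_shiftS.
move: ca; rewrite /sumR; apply: cvg_trans; apply: near_eq_cvg; near=> m.
rewrite /series /= big_nat_recl // add0r.
by apply: eq_big_nat.
Unshelve.
all: by end_near.
Qed.

End geometric_sums.

(** * Termwise differentiation of series *)

Section series_smooth.
Context {R : realType} {N : nat}.
Variable D : set 'rV[R]_N.
Hypothesis oD : open D.
Variable S : (nat -> 'rV[R]_N -> R) -> Prop.
Hypothesis S_bound : forall f z, S f -> D z ->
  exists C, \forall y \near z, geo_le C (f ^~ y).
Hypothesis S_derive : forall f i, S f -> exists2 g, S g &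
  forall m z, D z -> is_derive z (ev i) (f m) (g m z).
Implicit Types x y z c v : 'rV[R]_N.

Lemma S_ball f z : S f -> D z -> exists2 r, 0 < r & ball z r `<=` D /\
  exists2 C, 0 <= C & forall y, ball z r y -> forall m,
    `|f m y| <= C * 2^-1 ^+ m /\
    forall i, derivable (f m) y (ev i) /\ `|pd i (f m) y| <= C * 2^-1 ^+ m.
Proof.
move=> Sf Dz; have [C0 H0] := S_bound Sf Dz.
have ex i : exists g, S g /\ forall m z, D z -> is_derive z (ev i) (f m) (g m z).
  by have [g Sg dg] := S_derive i Sf; exists g.
have [g Hg] := choice ex.
have exC i : exists C, \forall y \near z, geo_le C (g i ^~ y).
  exact: (S_bound (proj1 (Hg i)) Dz).
have [C HC] := choice exC.
pose M := `|C0| + \sum_i `|C i|.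
have M1 : C0 <= M by rewrite /M ler_wpDr ?ler_norm // sumr_ge0.
have M2 i : C i <= M.
  rewrite /M ler_wpDl // (bigD1 i) //= ler_wpDr ?ler_norm // sumr_ge0 //.
have : \forall y \near z, D y /\ geo_le M (f ^~ y) /\ forall i, geo_le M (g i ^~ y).
  apply: filterI; first exact: near_open.
  apply: filterI; first by apply: filterS H0 => y; exact: geo_weak.
  apply: (@filter_forall _ _ (fun i y => geo_le M (g i ^~ y)) (nbhs z) _) => i.
  by apply: filterS (HC i) => y; exact: geo_weak.
move/nbhs_ballP => [r /= r0 Hr]; exists r => //; split; first by move=> y /Hr[].
exists M; first by rewrite /M addr_ge0 // sumr_ge0.
move=> y By m; have [Dy [H1 H2]] := Hr y By.
split=> [|i]; first exact: H1.
have [_ d] := Hg i; have [d1 d2] := d m y Dy; split=> //.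
by rewrite /pd d2; exact: H2.
Qed.

Definition sum_fun (f : nat -> 'rV[R]_N -> R) z := sumR (f ^~ z).

Lemma sum_fun_continuous f z : S f -> D z -> {for z, continuous (sum_fun f)}.
Proof.
move=> Sf Dz; have [r r0 [BD [C C0 HC]]] := S_ball Sf Dz.
apply/continuous_distP => e e0.
pose K := 2 * (N%:R * C) + 1; have K0 : 0 < K by rewrite ltr_wpDl // !mulr_ge0.
near=> y.
have By : ball z r y by near: y; exact: nbhsx_ballx.
have g1 : geo_le C (f ^~ y) by move=> m; have [] := HC y By m.
have g2 : geo_le C (f ^~ z) by move=> m; have [] := HC z (ballxx z r0) m.
rewrite /sum_fun -(sumRB g2 g1).
have g3 : geo_le (N%:R * C * `|z - y|) (fun m => f m z - f m y).
  move=> m; have -> : N%:R * C * `|z - y| * 2^-1 ^+ m =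
      N%:R * (C * 2^-1 ^+ m) * `|z - y| by ring.
  apply: (@ball_lipschitz _ _ (f m) z r _ _ y z By (ballxx z r0)) => w Bw i.
  by have [_ H] := HC w Bw m; exact: H.
apply: le_trans (sumR_norm g3) _.
apply: (@le_trans _ _ (K * `|z - y|)).
  by rewrite /K; have := normr_ge0 (z - y); move: `|z - y| => u u0; nra.
rewrite mulrC -ler_pdivlMr //; near: y.
by apply: cvgr_dist_le; [exact: cvg_id|rewrite divr_gt0].
Unshelve. all: by end_near. Qed.

(** The mean value theorem is applied twice, to [f m] and then to [g m], so that the difference
    quotient of the m-th term misses [g m z] by at most |h| C 2^-m. Summing gives an error of at
    most 2 C |h|. The class [S] provides the needed bounds on the derivatives of [g m]. *)
Lemma sum_fun_derive f g i z : S g ->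
  (forall m z, D z -> is_derive z (ev i) (f m) (g m z)) -> S f -> D z ->
  is_derive z (ev i) (sum_fun f) (sum_fun g z).
Proof.
move=> Sg dfg Sf Dz.
have [r r0 [BD [C C0 HC]]] := S_ball Sg Dz.
have [r' r0' [_ [C' C0' HC']]] := S_ball Sf Dz.
suff E : (fun h : R => h^-1 *: (sum_fun f (h *: ev i + z) - sum_fun f z)) @ 0^' -->
    sum_fun g z.
  split; first by apply/cvg_ex; exists (sum_fun g z).
  exact: cvg_lim.
apply/cvgrPdist_le => e e0.
pose K := 2 * C + 1; have K0 : 0 < K by rewrite ltr_wpDl // mulr_ge0.
near=> h.
have h0 : h != 0 by near: h; exact: nbhs_dnbhs_neq.
have hr : `|h| < r by near: h; exact: dnbhs0_lt.
have hr' : `|h| < r' by near: h; exact: dnbhs0_lt.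
have Be (s : R) (t : R) : 0 < s -> `|t| < s -> ball z s (z + t *: ev i).
  move=> s0 ts; apply/(mem_ball_rV _ _ s0) => j.
  rewrite !mxE eqxx /= opprD addNKr normrN; case: (j == i).
    by rewrite mulr1.
  by rewrite mulr0 normr0.
have th (t : R) : 0 <= t <= 1 -> `|t * h| < r.
  move=> /andP[t0 t1]; apply: le_lt_trans hr; rewrite normrM ger0_norm //.
  by rewrite ler_piMl.
have g1 : geo_le C' (fun m => f m (z + h *: ev i)).
  by move=> m; have [] := HC' _ (Be r' h r0' hr') m.
have g2 : geo_le C' (f ^~ z) by move=> m; have [] := HC' z (ballxx z r0') m.
have g3 : geo_le C (g ^~ z) by move=> m; have [] := HC z (ballxx z r0) m.
have g4 : geo_le (`|h| * C)
    (fun m => g m z - h^-1 * (f m (z + h *: ev i) - f m z)).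
  move=> m.
  have [t tI|t tI E1] := @axis_MVT _ _ (f m) i z h.
    by have [] := dfg m _ (BD _ (Be r _ r0 (th t tI))).
  have [s sI|s sI E2] := @axis_MVT _ _ (g m) i z (t * h).
    have [|_ H] := HC (z + (s * (t * h)) *: ev i) _ m; last by have [] := H i.
    apply: Be => //; rewrite mulrA; apply: th.
    move/andP: sI => [a b]; move/andP: tI => [c d].
    by rewrite mulr_ge0 //= mulr_ile1.
  have Bs : ball z r (z + (s * (t * h)) *: ev i).
    apply: Be => //; rewrite mulrA; apply: th.
    move/andP: sI => [a b]; move/andP: tI => [c d].
    by rewrite mulr_ge0 //= mulr_ile1.
  have -> : h^-1 * (f m (z + h *: ev i) - f m z) = g m (z + (t * h) *: ev i).
    rewrite E1 mulKf //.
    exact: (pd_val (dfg m _ (BD _ (Be r _ r0 (th t tI))))).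
  rewrite distrC E2 normrM -mulrA; apply: ler_pM => //.
    by rewrite normrM; case/andP: tI => t0 t1; rewrite ger0_norm // ler_piMl.
  by have [_ H] := HC _ Bs m; have [] := H i.
have -> : sum_fun g z - h^-1 *: (sum_fun f (h *: ev i + z) - sum_fun f z) =
    sumR (fun m => g m z - h^-1 * (f m (z + h *: ev i) - f m z)).
  rewrite (sumRB g3 (geoZ _ (geoB g1 g2))) (sumRZ _ (geoB g1 g2)) (sumRB g1 g2).
  by rewrite /sum_fun [h *: _ + z]addrC.
apply: le_trans (sumR_norm g4) _.
apply: (@le_trans _ _ (K * `|h|)).
  by rewrite /K; have := normr_ge0 h; move: `|h| => u u0; nra.
rewrite mulrC -ler_pdivlMr //; near: h.
by apply: dnbhs0_le; rewrite divr_gt0.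
Unshelve. all: by end_near. Qed.

Lemma sum_fun_smooth f : S f -> smooth_on D (sum_fun f).
Proof.
move=> Sf.
apply: (@smooth_ind _ _ D oD R (fun h => exists2 f, S f & h = sum_fun f)).
- by move=> _ [f' Sf' ->] x; exact: sum_fun_continuous.
- move=> _ [f' Sf' ->] i; have [g Sg dg] := S_derive i Sf'.
  exists (sum_fun g); first by exists g.
  by move=> x; exact: sum_fun_derive.
- by exists f.
Qed.

End series_smooth.

(** * Powers of lambda in real coordinates *)

Section complex_powers.
Context {R : realType} {n : nat}.
Implicit Types (z v : 'rV[R]_(n + 2)).

(** The reading of the last two coordinates as a complex number used in [jointly_smooth]. *)
Definition lam z : R[i] := Complex (rsubmx z 0 ord0) (rsubmx z 0 ord_max).
Definition cre (k : nat) z : R := complex.Re (lam z ^+ k).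
Definition cim (k : nat) z : R := complex.Im (lam z ^+ k).

Lemma ReD (a b : R[i]) : complex.Re (a + b) = complex.Re a + complex.Re b.
Proof. by case: a; case: b. Qed.

Lemma ImD (a b : R[i]) : complex.Im (a + b) = complex.Im a + complex.Im b.
Proof. by case: a; case: b. Qed.

Lemma ReM (a b : R[i]) : complex.Re (a * b) =
  complex.Re a * complex.Re b - complex.Im a * complex.Im b.
Proof. by case: a => ? ?; case: b. Qed.

Lemma ImM (a b : R[i]) : complex.Im (a * b) =
  complex.Re a * complex.Im b + complex.Im a * complex.Re b.
Proof. by case: a => ? ?; case: b. Qed.

Lemma lam_re z : complex.Re (lam z) = z 0 (rshift n ord0).
Proof. by rewrite /= mxE. Qed.

Lemma lam_im z : complex.Im (lam z) = z 0 (rshift n ord_max).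
Proof. by rewrite /= mxE. Qed.

Lemma creS k z : cre k.+1 z =
  z 0 (rshift n ord0) * cre k z - z 0 (rshift n ord_max) * cim k z.
Proof. by rewrite /cre exprS ReM lam_re lam_im. Qed.

Lemma cimS k z : cim k.+1 z =
  z 0 (rshift n ord0) * cim k z + z 0 (rshift n ord_max) * cre k z.
Proof. by rewrite /cim exprS ImM lam_re lam_im. Qed.

(** The real and imaginary parts of d(lambda^k) = k lambda^(k-1) d lambda, with d lambda = vs + i
    vt. For k = 0 the predecessor is 0 again, but the factor k annihilates the term. *)
Lemma is_derive_cpow k z v :
  let vs := v 0 (rshift n ord0) in let vt := v 0 (rshift n ord_max) in
  is_derive z v (cre k) (k%:R * (vs * cre k.-1 z - vt * cim k.-1 z)) /\
  is_derive z v (cim k) (k%:R * (vs * cim k.-1 z + vt * cre k.-1 z)).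
Proof.
move=> vs vt; elim: k => [|k [IH1 IH2]].
  rewrite !mul0r; split.
    by rewrite (_ : cre 0 = fun _ => 1); [exact: is_derive_cst|apply/funext].
  by rewrite (_ : cim 0 = fun _ => 0); [exact: is_derive_cst|apply/funext].
have ds := is_derive_coord z v (rshift n ord0).
have dt := is_derive_coord z v (rshift n ord_max).
have e1 : k%:R * cre k z = k%:R * (z 0 (rshift n ord0) * cre k.-1 z -
    z 0 (rshift n ord_max) * cim k.-1 z).
  by case: k {IH1 IH2} => [|k]; [rewrite !mul0r|rewrite creS].
have e2 : k%:R * cim k z = k%:R * (z 0 (rshift n ord0) * cim k.-1 z +
    z 0 (rshift n ord_max) * cre k.-1 z).
  by case: k {IH1 IH2 e1} => [|k]; [rewrite !mul0r|rewrite cimS].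
split.
- have -> : cre k.+1 = (fun y => y 0 (rshift n ord0) * cre k y -
      y 0 (rshift n ord_max) * cim k y) by apply/funext => y; exact: creS.
  have d := is_deriveB (is_derive_mul ds IH1) (is_derive_mul dt IH2).
  apply: (is_derive_eq d); rewrite -/vs -/vt /= -natr1.
  have -> : (k%:R + 1) * (vs * cre k z - vt * cim k z) =
    vs * (k%:R * cre k z) - vt * (k%:R * cim k z) + (vs * cre k z - vt * cim k z) by ring.
  by rewrite e1 e2; ring.
- have -> : cim k.+1 = (fun y => y 0 (rshift n ord0) * cim k y +
      y 0 (rshift n ord_max) * cre k y) by apply/funext => y; exact: cimS.
  have d := is_deriveD (is_derive_mul ds IH2) (is_derive_mul dt IH1).
  apply: (is_derive_eq d); rewrite -/vs -/vt /= -natr1.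
  have -> : (k%:R + 1) * (vs * cim k z + vt * cre k z) =
    vs * (k%:R * cim k z) + vt * (k%:R * cre k z) + (vs * cim k z + vt * cre k z) by ring.
  by rewrite e1 e2; ring.
Qed.

(** The norm |Re| + |Im| is submultiplicative, so the bound needs no square roots. *)
Lemma cpow_bound k z :
  `|cre k z| + `|cim k z| <= (`|z 0 (rshift n ord0)| + `|z 0 (rshift n ord_max)|) ^+ k.
Proof.
elim: k => [|k IH]; first by rewrite /cre /cim expr0 /= normr1 normr0 addr0.
rewrite creS cimS exprS.
apply: (@le_trans _ _ ((`|z 0 (rshift n ord0)| + `|z 0 (rshift n ord_max)|) *
  (`|cre k z| + `|cim k z|))); last by apply: ler_wpM2l => //; rewrite addr_ge0.
apply: le_trans (lerD (ler_normB _ _) (ler_normD _ _)) _.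
rewrite !normrM le_eqVlt; apply/orP; left; apply/eqP; ring.
Qed.

Lemma is_derive_lsubmx (V : normedModType R) (f : 'rV[R]_n -> V) z v df :
  is_derive (lsubmx z) (lsubmx v) f df -> is_derive z v (fun y => f (lsubmx y)) df.
Proof.
have E : (fun h : R => h^-1 *: (f (lsubmx (h *: v + z)) - f (lsubmx z)))
       = (fun h : R => h^-1 *: (f (h *: lsubmx v + lsubmx z) - f (lsubmx z))).
  by apply/funext => h; rewrite linearP.
by move=> [d1 d2]; split; move: d1 d2; rewrite /derivable /derive /= E.
Qed.

Lemma lsubmx_ev_lshift (j : 'I_n) : lsubmx (ev (lshift 2 j) : 'rV[R]_(n + 2)) = ev j.
Proof. by apply/rowP => i; rewrite !mxE eq_lshift. Qed.

Lemma lsubmx_ev_rshift (j : 'I_2) : lsubmx (ev (rshift n j) : 'rV[R]_(n + 2)) = 0.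
Proof. by apply/rowP => i; rewrite !mxE eq_lrshift andbF. Qed.

End complex_powers.

(** * Power series in lambda built from the iterated integrals *)

Section frame_series.
Context {R : realType} {n p : nat}.
Variable D : set 'rV[R]_n.
Hypothesis oD : open D.
Variable kappa : 'I_n -> 'rV[R]_n -> 'M[R]_p.
Hypothesis smooth_kappa : forall i, smooth_on D (kappa i).
Variable Q : nat -> 'rV[R]_n -> 'M[R]_p.
Hypothesis Q_0 : Q 0%N = (fun _ => 1%:M).
Hypothesis smooth_Q : forall m, smooth_on D (Q m).
Hypothesis derive_Q : forall m x i, D x ->
  is_derive x (ev i) (Q m.+1) (Q m x *m kappa i x).
Hypothesis growth_Q : forall x, D x -> forall rho, 0 < rho ->
  exists C, \forall y \near x, forall m, `|Q m y| * rho ^+ m <= C.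

(** The coefficients of lambda times the series with coefficients [q]. *)
Definition shift_seq (q : nat -> 'rV[R]_n -> R) : nat -> 'rV[R]_n -> R :=
  fun m x => if m is m'.+1 then q m' x else 0.

(* Coefficient sequences of the power series in lambda: a class of rapidly decreasing
   sequences stable under partial derivatives. The factor (m - a) is the one produced
   by differentiating lambda^(m - a); for m < a truncation makes it vanish. *)
Inductive frame_seq : (nat -> 'rV[R]_n -> R) -> Prop :=
| frame_base a b : frame_seq (fun m x => Q m x a b)
| frame_zero : frame_seq (fun _ _ => 0)
| frame_shift q : frame_seq q -> frame_seq (shift_seq q)
| frame_add q r : frame_seq q -> frame_seq r -> frame_seq (fun m x => q m x + r m x)
| frame_mul (s : 'rV[R]_n -> R) q : smooth_on D s -> frame_seq q -> frame_seq (fun m x => s x * q m x)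
| frame_muln a q : frame_seq q -> frame_seq (fun m x => (m - a)%:R * q m x).

Lemma frame_sum (I : Type) (r : seq I) (q : I -> nat -> 'rV[R]_n -> R) :
  (forall i, frame_seq (q i)) -> frame_seq (fun m x => \sum_(i <- r) q i m x).
Proof.
move=> H; elim: r => [|i r IH].
  rewrite (_ : (fun _ _ => _) = fun _ _ => 0); first exact: frame_zero.
  by apply/funext => m; apply/funext => x; rewrite big_nil.
rewrite (_ : (fun _ _ => _) = fun m x => q i m x + \sum_(j <- r) q j m x).
  by apply: frame_add.
by apply/funext => m; apply/funext => x; rewrite big_cons.
Qed.

Lemma frame_rapid q x : frame_seq q -> D x -> forall rho, 0 < rho ->
  exists C, \forall y \near x, forall m, `|q m y| * rho ^+ m <= C.
Proof.
move=> Fq Dx; elim: Fq => {q} [a b||q _ IH|q r _ IHq _ IHr|s q ss _ IH|a q _ IH] rho rho0.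
- have [C HC] := growth_Q Dx rho0; exists C; apply: filterS HC => y Hy m.
  apply: le_trans (Hy m); apply: ler_wpM2r; last exact: mx_norm_entry.
  by rewrite exprn_ge0 // ltW.
- by exists 0; apply: filterS (near_open oD Dx) => y _ m; rewrite normr0 mul0r.
- have [C HC] := IH rho rho0; exists (Num.max 0 (rho * C)).
  apply: filterS HC => y Hy [|m] /=; rewrite le_max.
    by rewrite normr0 mul0r lexx.
  by rewrite exprS mulrCA; apply/orP; right; rewrite ler_wpM2l // ltW.
- have [C HC] := IHq rho rho0; have [C' HC'] := IHr rho rho0; exists (C + C').
  apply: filterS2 HC HC' => y Hy Hy' m; apply: le_trans (lerD (Hy m) (Hy' m)).
  by rewrite -mulrDl ler_wpM2r ?ler_normD // exprn_ge0 // ltW.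
- have [C HC] := IH rho rho0; exists ((`|s x| + 1) * C).
  have Hs := continuous_bounded_near (smooth_continuous ss Dx).
  apply: filterS2 Hs HC => y Hy Hy' m; rewrite normrM -mulrA.
  by apply: ler_pM => //; rewrite mulr_ge0 // exprn_ge0 // ltW.
(* Doubling [rho] absorbs the polynomial factor, because m - a <= 2^m. *)
- have rho20 : 0 < 2 * rho by rewrite mulr_gt0.
  have [C HC] := IH _ rho20; exists C; apply: filterS HC => y Hy m.
  apply: le_trans (Hy m); rewrite normrM exprMn [leRHS]mulrA.
  apply: ler_wpM2r; first by rewrite exprn_ge0 // ltW.
  rewrite mulrC; apply: ler_wpM2l; first by [].
  rewrite normr_nat -natrX ler_nat; apply: leq_trans (leq_subr _ _) _.
  exact/ltnW/ltn_expl.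
Qed.

(** The essential case is dQ_m = Q_(m-1) kappa, a shifted sequence multiplied by smooth functions;
    the default 0 of the shift at m = 0 matches the constant Q_0. *)
Lemma frame_derive q i : frame_seq q -> exists2 q', frame_seq q' &
  forall m x, D x -> is_derive x (ev i) (q m) (q' m x).
Proof.
elim=> {q} [a b||q _ [q' Fq' dq]|q r _ [q' Fq' dq] _ [r' Fr' dr]
    |s q ss Fq [q' Fq' dq]|a q _ [q' Fq' dq]].
- exists (fun m x => \sum_j kappa i x j b * shift_seq (fun m x => Q m x a j) m x).
    apply: frame_sum => j; apply: frame_mul; last exact/frame_shift/frame_base.
    exact: ((smooth_mxP oD _).1 (smooth_kappa i) j b).
  move=> [|m] x Dx.
    rewrite big1; last by move=> j _; rewrite mulr0.
    by rewrite Q_0; exact: is_derive_cst.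
  have /is_derive_mxP/(_ a b) d := derive_Q m i Dx.
  by apply: (is_derive_eq d); rewrite mxE; apply: eq_bigr => j _; rewrite mulrC.
- exists (fun _ _ => 0); first exact: frame_zero.
  by move=> m x _; exact: is_derive_cst.
- exists (shift_seq q'); first exact: frame_shift.
  by move=> [|m] x Dx; [exact: is_derive_cst|exact: dq].
- exists (fun m x => q' m x + r' m x); first exact: frame_add.
  by move=> m x Dx; apply: is_deriveD; [exact: dq|exact: dr].
- exists (fun m x => pd i s x * q m x + s x * q' m x).
    apply: frame_add; first exact: (frame_mul (smooth_pd i ss) Fq).
    exact: (frame_mul ss Fq').
  by move=> m x Dx; apply: is_derive_mul; [exact: (smooth_is_derive i ss Dx)|exact: dq].
- exists (fun m x => (m - a)%:R * q' m x); first exact: frame_muln.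
  move=> m x Dx.
  have d := is_derive_mul (is_derive_cst ((m - a)%:R : R) x (ev i)) (dq m x Dx).
  by apply: (is_derive_eq d); rewrite mul0r add0r.
Qed.

Definition cyl : set 'rV[R]_(n + 2) := [set z | D (lsubmx z)].

Lemma lsubmx_continuous : continuous (@lsubmx R 1 n 2).
Proof.
move=> z; apply/continuous_mxP => a b.
have -> : (fun y : 'M[R]_(1, n + 2) => lsubmx y a b) =
    (fun y : 'M[R]_(1, n + 2) => y a (lshift 2 b)).
  by apply/funext => y; rewrite mxE.
exact: coord_continuous.
Qed.

Lemma open_cyl : open cyl.
Proof.
apply: (@open_comp _ _ (@lsubmx R 1 n 2) D) => // z _; exact: lsubmx_continuous.
Qed.

(** Terms of the series in the joint variable (x, lambda), [a] being the number of derivatives taken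
    in lambda. Real and imaginary parts are both generators because differentiation in Im lambda
    exchanges them. *)
Inductive pow_seq : (nat -> 'rV[R]_(n + 2) -> R) -> Prop :=
| pow_re a q : frame_seq q -> pow_seq (fun m z => cre (m - a) z * q m (lsubmx z))
| pow_im a q : frame_seq q -> pow_seq (fun m z => cim (m - a) z * q m (lsubmx z))
| pow_add f g : pow_seq f -> pow_seq g -> pow_seq (fun m z => f m z + g m z).

Lemma frame_derive_lsubmx q i : frame_seq q -> exists2 q', frame_seq q' &
  forall m z, cyl z ->
    is_derive z (ev i) (fun y => q m (lsubmx y)) (q' m (lsubmx z)).
Proof.
move=> Fq; rewrite -(splitK i); case: (fintype.split i) => j /=.
  have [q' Fq' dq] := frame_derive j Fq; exists q' => // m z Dz.
  by apply: is_derive_lsubmx; rewrite lsubmx_ev_lshift; exact: dq.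
exists (fun _ _ => 0); first exact: frame_zero.
move=> m z Dz; apply: is_derive_lsubmx; rewrite lsubmx_ev_rshift.
exact: is_derive0.
Qed.

Lemma pow_derive f i : pow_seq f -> exists2 g, pow_seq g &
  forall m z, cyl z -> is_derive z (ev i) (f m) (g m z).
Proof.
pose vs : R := (ev i : 'rV[R]_(n + 2)) 0 (rshift n ord0).
pose vt : R := (ev i : 'rV[R]_(n + 2)) 0 (rshift n ord_max).
have sc (c : R) : smooth_on D (fun _ : 'rV[R]_n => c) by exact: smooth_cst.
elim=> {f} [a q Fq|a q Fq|f g _ [f' Sf' df] _ [g' Sg' dg]].
- have [q' Fq' dq] := frame_derive_lsubmx i Fq.
  exists (fun m z => cre (m - a.+1) z * (vs * ((m - a)%:R * q m (lsubmx z))) +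
     cim (m - a.+1) z * (- vt * ((m - a)%:R * q m (lsubmx z))) +
     cre (m - a) z * q' m (lsubmx z)).
    apply: pow_add; last exact: pow_re.
    apply: pow_add.
      exact: (@pow_re a.+1 (fun m x => vs * ((m - a)%:R * q m x))
        (frame_mul (sc vs) (frame_muln a Fq))).
    exact: (@pow_im a.+1 (fun m x => - vt * ((m - a)%:R * q m x))
        (frame_mul (sc (- vt)) (frame_muln a Fq))).
  move=> m z Dz.
  have d := is_derive_mul (proj1 (is_derive_cpow (m - a) z (ev i))) (dq m z Dz).
  by apply: (is_derive_eq d); rewrite subnS -/vs -/vt; ring.
- have [q' Fq' dq] := frame_derive_lsubmx i Fq.
  exists (fun m z => cim (m - a.+1) z * (vs * ((m - a)%:R * q m (lsubmx z))) +
     cre (m - a.+1) z * (vt * ((m - a)%:R * q m (lsubmx z))) +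
     cim (m - a) z * q' m (lsubmx z)).
    apply: pow_add; last exact: pow_im.
    apply: pow_add.
      exact: (@pow_im a.+1 (fun m x => vs * ((m - a)%:R * q m x))
        (frame_mul (sc vs) (frame_muln a Fq))).
    exact: (@pow_re a.+1 (fun m x => vt * ((m - a)%:R * q m x))
        (frame_mul (sc vt) (frame_muln a Fq))).
  move=> m z Dz.
  have d := is_derive_mul (proj2 (is_derive_cpow (m - a) z (ev i))) (dq m z Dz).
  by apply: (is_derive_eq d); rewrite subnS -/vs -/vt; ring.
- exists (fun m z => f' m z + g' m z); first exact: pow_add.
  by move=> m z Dz; apply: is_deriveD; [exact: df|exact: dg].
Qed.

Lemma pow_bound f z : pow_seq f -> cyl z ->
  exists C, \forall y \near z, geo_le C (f ^~ y).
Proof.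
move=> Sf Dz.
pose h (y : 'rV[R]_(n + 2)) := `|y 0 (rshift n ord0)| + `|y 0 (rshift n ord_max)|.
pose rho := h z + 1.
have rho1 : 1 <= rho by rewrite /rho lerDr addr_ge0.
have rho0 : 0 < rho by apply: lt_le_trans rho1.
have nh : \forall y \near z, h y <= rho.
  have ch : {for z, continuous h}.
    have c1 := @coord_continuous R 1 (n + 2) 0 (rshift n ord0) z.
    have c2 := @coord_continuous R 1 (n + 2) 0 (rshift n ord_max) z.
    exact: (cvgD (cvg_norm c1) (cvg_norm c2)).
  have /continuous_distP/(_ 1 ltr01) := ch.
  by apply: filterS => y; rewrite ler_norml /rho => /andP[a b]; lra.
(* Rapid decay is invoked at [2 * rho]: rho^m absorbs the power of lambda, and the spare 2^m becomes
   the geometric ratio. Having [rho >= 1] allows the exponent m - a to be raised to m. *)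
have rho20 : 0 < 2 * rho by rewrite mulr_gt0.
have main (c : nat -> 'rV[R]_(n + 2) -> R) (a : nat) q : frame_seq q ->
    (forall k y, `|c k y| <= h y ^+ k) ->
    exists C, \forall y \near z, geo_le C (fun m => c (m - a)%N y * q m (lsubmx y)).
  move=> Fq Hc; have [C HC] := frame_rapid Fq Dz rho20.
  exists C; have HC' := lsubmx_continuous HC.
  have HC2 : \forall y \near z, forall m, `|q m (lsubmx y)| * (2 * rho) ^+ m <= C.
    exact: HC'.
  apply: filterS2 nh HC2 => y Hy Hq m; rewrite normrM.
  have c1 : `|c (m - a)%N y| <= rho ^+ m.
    apply: le_trans (Hc _ _) _; apply: (@le_trans _ _ (rho ^+ (m - a))).
      by apply: lerXn2r; rewrite ?nnegrE ?addr_ge0 // ltW.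
    by rewrite ler_weXn2l // leq_subr.
  have := Hq m; rewrite exprMn => H2.
  have p2 : 0 < 2 ^+ m :> R by rewrite exprn_gt0.
  rewrite exprVn ler_pdivlMr //; apply: le_trans H2.
  rewrite mulrC mulrA [leLHS]mulrC; apply: ler_wpM2l => //.
  by apply: ler_wpM2l => //; exact: ltW.
elim: Sf => {f} [a q Fq|a q Fq|f g _ [C HC] _ [C' HC']].
- apply: main => // k y; apply: le_trans (cpow_bound k y); by rewrite lerDl.
- apply: main => // k y; apply: le_trans (cpow_bound k y); by rewrite lerDr.
- exists (C + C'); apply: filterS2 HC HC' => y Hy Hy'; exact: geoD.
Qed.

Definition csum (q : nat -> 'rV[R]_n -> R) x (l : R[i]) : R[i] :=
  Complex (sumR (fun m => complex.Re (l ^+ m) * q m x))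
          (sumR (fun m => complex.Im (l ^+ m) * q m x)).

(** The termwise derivative of [csum] in lambda. The redundant [m - 0] is the shape produced by
    [frame_muln 0] under [pow_re 1] and [pow_im 1]. *)
Definition dcsum (q : nat -> 'rV[R]_n -> R) x (l : R[i]) : R[i] :=
  Complex (sumR (fun m => complex.Re (l ^+ (m - 1)) * ((m - 0)%:R * q m x)))
          (sumR (fun m => complex.Im (l ^+ (m - 1)) * ((m - 0)%:R * q m x))).

Definition cpoint x (l : R[i]) : 'rV[R]_(n + 2) :=
  row_mx x (\row_(k < 2) if k == ord0 then complex.Re l else complex.Im l).

Lemma lsubmx_cpoint x l : lsubmx (cpoint x l) = x.
Proof. exact: row_mxKl. Qed.

Lemma lam_cpoint x l : lam (cpoint x l) = l.
Proof. by rewrite /lam /cpoint row_mxKr !mxE /=; case: l. Qed.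

Definition re_part q := sum_fun (fun m (z : 'rV[R]_(n + 2)) => cre (m - 0) z * q m (lsubmx z)).
Definition im_part q := sum_fun (fun m (z : 'rV[R]_(n + 2)) => cim (m - 0) z * q m (lsubmx z)).

Lemma re_partE q z : re_part q z = complex.Re (csum q (lsubmx z) (lam z)).
Proof. by congr sumR; apply/funext => m; rewrite subn0. Qed.

Lemma im_partE q z : im_part q z = complex.Im (csum q (lsubmx z) (lam z)).
Proof. by congr sumR; apply/funext => m; rewrite subn0. Qed.

Lemma re_part_smooth q : frame_seq q -> smooth_on cyl (re_part q).
Proof.
by move=> Fq; exact: (sum_fun_smooth open_cyl pow_bound pow_derive (pow_re 0 Fq)).
Qed.

Lemma im_part_smooth q : frame_seq q -> smooth_on cyl (im_part q).
Proof.
by move=> Fq; exact: (sum_fun_smooth open_cyl pow_bound pow_derive (pow_im 0 Fq)).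
Qed.

Lemma geo_at q x l : frame_seq q -> D x ->
  (exists C, geo_le C (fun m => complex.Re (l ^+ m) * q m x)) /\
  (exists C, geo_le C (fun m => complex.Im (l ^+ m) * q m x)).
Proof.
move=> Fq Dx; have Dz : cyl (cpoint x l) by rewrite /cyl /= lsubmx_cpoint.
split.
  have [C HC] := pow_bound (pow_re 0 Fq) Dz; exists C => m.
  by have := nbhs_singleton HC m; rewrite subn0 /cre lam_cpoint lsubmx_cpoint.
have [C HC] := pow_bound (pow_im 0 Fq) Dz; exists C => m.
by have := nbhs_singleton HC m; rewrite subn0 /cim lam_cpoint lsubmx_cpoint.
Qed.

Lemma csumD q r x l : frame_seq q -> frame_seq r -> D x ->
  csum (fun m x => q m x + r m x) x l = csum q x l + csum r x l.
Proof.
move=> Fq Fr Dx; have [[C1 H1] [C2 H2]] := geo_at l Fq Dx.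
have [[C3 H3] [C4 H4]] := geo_at l Fr Dx.
apply/eqP; rewrite eq_complex /=; apply/andP; split; apply/eqP.
  by rewrite -(sumRD H1 H3); congr sumR; apply/funext => m; rewrite mulrDr.
by rewrite -(sumRD H2 H4); congr sumR; apply/funext => m; rewrite mulrDr.
Qed.

Lemma csumZ (s : 'rV[R]_n -> R) q x l : frame_seq q -> D x ->
  csum (fun m x => s x * q m x) x l = Complex (s x) 0 * csum q x l.
Proof.
move=> Fq Dx; have [[C1 H1] [C2 H2]] := geo_at l Fq Dx.
apply/eqP; rewrite eq_complex /= !mul0r subr0 addr0; apply/andP; split; apply/eqP.
  by rewrite -(sumRZ _ H1); congr sumR; apply/funext => m; rewrite mulrCA.
by rewrite -(sumRZ _ H2); congr sumR; apply/funext => m; rewrite mulrCA.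
Qed.

Lemma csum_zero x l : csum (fun _ _ => 0) x l = 0.
Proof.
by apply/eqP; rewrite eq_complex /=; apply/andP; split; apply/eqP;
  rewrite (@sumR_single _ _ 0%N) ?mulr0 // => m _; rewrite mulr0.
Qed.

Lemma csum_sum (I : Type) (r : seq I) (q : I -> nat -> 'rV[R]_n -> R) x l :
  (forall i, frame_seq (q i)) -> D x ->
  csum (fun m x => \sum_(i <- r) q i m x) x l = \sum_(i <- r) csum (q i) x l.
Proof.
move=> Fq Dx; elim: r => [|i r IH].
  rewrite big_nil -(csum_zero x l); congr csum.
  by apply/funext => m; apply/funext => y; rewrite big_nil.
rewrite big_cons -IH -csumD //; last exact: frame_sum.
by congr csum; apply/funext => m; apply/funext => y; rewrite big_cons.
Qed.

Lemma csum_shift q x l : frame_seq q -> D x ->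
  csum (shift_seq q) x l = l * csum q x l.
Proof.
move=> Fq Dx; have [[C1 H1] [C2 H2]] := geo_at l Fq Dx.
have G1 := geoB (geoZ (complex.Re l) H1) (geoZ (complex.Im l) H2).
have G2 := geoD (geoZ (complex.Re l) H2) (geoZ (complex.Im l) H1).
apply/eqP; rewrite eq_complex ReM ImM /=; apply/andP; split; apply/eqP.
  rewrite -(sumRZ _ H1) -(sumRZ _ H2) -(sumRB (geoZ _ H1) (geoZ _ H2)) -(sumR_shift G1).
  congr sumR; apply/funext => -[|m] /=; first by rewrite mulr0.
  by rewrite exprS ReM; ring.
rewrite -(sumRZ _ H1) -(sumRZ _ H2) -(sumRD (geoZ _ H2) (geoZ _ H1)) -(sumR_shift G2).
congr sumR; apply/funext => -[|m] /=; first by rewrite mulr0.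
by rewrite exprS ImM; ring.
Qed.

Lemma csum_at0 q x : csum q x 0 = Complex (q 0%N x) 0.
Proof.
apply/eqP; rewrite eq_complex /=; apply/andP; split; apply/eqP.
  rewrite (@sumR_single _ _ 0%N) ?expr0 ?mul1r // => -[|m] // _.
  by rewrite expr0n /= mul0r.
by rewrite (@sumR_single _ _ 0%N) ?expr0 ?mul0r // => -[|m] // _; rewrite expr0n /= mul0r.
Qed.

Lemma dcsum_at0 q x : dcsum q x 0 = Complex (q 1%N x) 0.
Proof.
apply/eqP; rewrite eq_complex /=; apply/andP; split; apply/eqP.
  rewrite (@sumR_single _ _ 1%N) ?subn0 ?subnn ?expr0 ?mul1r //.
  by move=> [|[|m]] // _; rewrite ?mul0r ?mulr0 // subn1 expr0n /= mul0r.
rewrite (@sumR_single _ _ 1%N) ?subnn ?expr0 ?mul0r //.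
by move=> [|[|m]] // _; rewrite ?mul0r ?mulr0 // subn1 expr0n /= mul0r.
Qed.

Lemma csum_conj q x l : frame_seq q -> D x ->
  csum q x (conjc l) = conjc (csum q x l).
Proof.
move=> Fq Dx; have [_ [C HC]] := geo_at l Fq Dx.
have E m : conjc l ^+ m = conjc (l ^+ m) by rewrite rmorphXn.
apply/eqP; rewrite eq_complex /=; apply/andP; split; apply/eqP.
  by congr sumR; apply/funext => m; rewrite E; case: (l ^+ m).
rewrite -mulN1r -(sumRZ _ HC); congr sumR; apply/funext => m; rewrite E.
have -> w : complex.Im (conjc w) = - complex.Im w :> R by case: w.
by rewrite mulN1r mulNr.
Qed.

(** Replacing l by -l multiplies the m-th term by (-1)^m, which the parity hypothesis on the
    coefficients trades for the constant factor s. *)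
Lemma csum_neg q (s : R) x l : (forall m, q m x = s * (-1) ^+ m * q m x) ->
  frame_seq q -> D x -> csum q x (- l) = Complex s 0 * csum q x l.
Proof.
move=> Hq Fq Dx; have [[C1 H1] [C2 H2]] := geo_at l Fq Dx.
have E m : complex.Re ((- l) ^+ m) = (-1) ^+ m * complex.Re (l ^+ m) /\
    complex.Im ((- l) ^+ m) = (-1) ^+ m * complex.Im (l ^+ m).
  have -> : (- l) ^+ m = Complex ((-1) ^+ m) 0 * l ^+ m.
    elim: m => [|m IH]; first by rewrite !expr0 mulr1.
    rewrite !exprS IH; move: (l ^+ m) ((-1) ^+ m) => w s'.
    case: l w {H1 H2 IH} => [a b] [c d]; apply/eqP; rewrite eq_complex /=.
    by apply/andP; split; apply/eqP; ring.
  by rewrite ReM ImM /= !mul0r subr0 addr0.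
have sq m : (-1) ^+ m * ((-1) ^+ m) = 1 :> R by rewrite -exprMn mulrNN mulr1 expr1n.
apply/eqP; rewrite eq_complex /= !mul0r subr0 addr0; apply/andP; split; apply/eqP.
  rewrite -(sumRZ _ H1); congr sumR; apply/funext => m.
  rewrite (E m).1 {1}Hq; transitivity (((-1) ^+ m * (-1) ^+ m) * (s * (complex.Re (l ^+ m) * q m x))).
    by ring.
  by rewrite sq mul1r.
rewrite -(sumRZ _ H2); congr sumR; apply/funext => m.
rewrite (E m).2 {1}Hq; transitivity (((-1) ^+ m * (-1) ^+ m) * (s * (complex.Im (l ^+ m) * q m x))).
  by ring.
by rewrite sq mul1r.
Qed.

Lemma part_derive_lshift q q' i : frame_seq q -> frame_seq q' ->
  (forall m x, D x -> is_derive x (ev i) (q m) (q' m x)) ->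
  forall z, cyl z -> is_derive z (ev (lshift 2 i)) (re_part q) (re_part q' z) /\
    is_derive z (ev (lshift 2 i)) (im_part q) (im_part q' z).
Proof.
move=> Fq Fq' dq z Dz.
have dl m z' : cyl z' -> is_derive z' (ev (lshift 2 i)) (fun y => q m (lsubmx y)) (q' m (lsubmx z')).
  by move=> Dz'; apply: is_derive_lsubmx; rewrite lsubmx_ev_lshift; exact: dq.
have e0 k : (ev (lshift 2 i) : 'rV[R]_(n + 2)) 0 (rshift n k) = 0.
  by rewrite mxE eq_rlshift andbF.
split; apply: (sum_fun_derive open_cyl pow_bound pow_derive _ _ _ Dz).
- exact: (pow_re 0 Fq').
- move=> m z' Dz'.
  have d := is_derive_mul (proj1 (is_derive_cpow (m - 0) z' (ev (lshift 2 i)))) (dl m z' Dz').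
  by apply: (is_derive_eq d); rewrite !e0 !mul0r subr0 mulr0 mul0r add0r.
- exact: (pow_re 0 Fq).
- exact: (pow_im 0 Fq').
- move=> m z' Dz'.
  have d := is_derive_mul (proj2 (is_derive_cpow (m - 0) z' (ev (lshift 2 i)))) (dl m z' Dz').
  by apply: (is_derive_eq d); rewrite !e0 !mul0r addr0 mulr0 mul0r add0r.
- exact: (pow_im 0 Fq).
Qed.

Lemma cpoint_line x l i (s : R) :
  cpoint x l + s *: ev (lshift 2 i) = cpoint (x + s *: ev i) l.
Proof.
apply/rowP => j; rewrite !mxE; case: (splitP j) => k jk; rewrite !mxE.
  have -> : j = lshift 2 k by apply/val_inj.
  by rewrite eq_lshift.
have -> : j = rshift n k by apply/val_inj.
by rewrite eq_rlshift andbF mulr0 addr0.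
Qed.

Lemma csum_derive q q' i x l : frame_seq q -> frame_seq q' ->
  (forall m x, D x -> is_derive x (ev i) (q m) (q' m x)) -> D x ->
  is_derive x (ev i) (fun y => complex.Re (csum q y l)) (complex.Re (csum q' x l)) /\
  is_derive x (ev i) (fun y => complex.Im (csum q y l)) (complex.Im (csum q' x l)).
Proof.
move=> Fq Fq' dq Dx; have Dz : cyl (cpoint x l) by rewrite /cyl /= lsubmx_cpoint.
have [d1 d2] := part_derive_lshift Fq Fq' dq Dz.
have ex : x + (0 : R) *: ev i = x by rewrite scale0r addr0.
have ez : cpoint x l + (0 : R) *: ev (lshift 2 i) = cpoint x l by rewrite scale0r addr0.
rewrite re_partE lsubmx_cpoint lam_cpoint in d1.
rewrite im_partE lsubmx_cpoint lam_cpoint in d2.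
split; rewrite -{1}ex; apply/is_derive_lineP.
- rewrite -ez in d1; move/is_derive_lineP: d1.
  rewrite (_ : (fun s : R => re_part q _) = fun s : R => complex.Re (csum q (x + s *: ev i) l)) //.
  by apply/funext => s; rewrite cpoint_line re_partE lsubmx_cpoint lam_cpoint.
- rewrite -ez in d2; move/is_derive_lineP: d2.
  rewrite (_ : (fun s : R => im_part q _) = fun s : R => complex.Im (csum q (x + s *: ev i) l)) //.
  by apply/funext => s; rewrite cpoint_line im_partE lsubmx_cpoint lam_cpoint.
Qed.

(** The Cauchy-Riemann equations: the four real derivatives in the lambda directions assemble into
    multiplication by one complex number, [dcsum q x l]. *)
Lemma part_derive_rshift q x l : frame_seq q -> D x ->
  let z := cpoint x l in
  [/\ is_derive z (ev (rshift n ord0)) (re_part q) (complex.Re (dcsum q x l)),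
      is_derive z (ev (rshift n ord_max)) (re_part q) (- complex.Im (dcsum q x l)),
      is_derive z (ev (rshift n ord0)) (im_part q) (complex.Im (dcsum q x l)) &
      is_derive z (ev (rshift n ord_max)) (im_part q) (complex.Re (dcsum q x l))].
Proof.
move=> Fq Dx z; have Dz : cyl z by rewrite /cyl /= lsubmx_cpoint.
have dl m (z' : 'rV[R]_(n + 2)) k :
    is_derive z' (ev (rshift n k)) (fun y : 'rV[R]_(n + 2) => q m (lsubmx y)) (0 : R).
  by apply: is_derive_lsubmx; rewrite lsubmx_ev_rshift; exact: is_derive0.
have e k k' : (ev (rshift n k) : 'rV[R]_(n + 2)) 0 (rshift n k') = (k' == k)%:R.
  by rewrite mxE eq_rshift.
have sm : smooth_on D (fun _ : 'rV[R]_n => - 1 : R) by exact: smooth_cst.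
have g1 : pow_seq (fun m z => cre (m - 1) z * ((m - 0)%:R * q m (lsubmx z))).
  exact: (@pow_re 1 (fun m x => (m - 0)%:R * q m x) (frame_muln 0 Fq)).
have g2 : pow_seq (fun m z => cim (m - 1) z * ((m - 0)%:R * q m (lsubmx z))).
  exact: (@pow_im 1 (fun m x => (m - 0)%:R * q m x) (frame_muln 0 Fq)).
have g3 : pow_seq (fun m z => cim (m - 1) z * (- 1 * ((m - 0)%:R * q m (lsubmx z)))).
  exact: (@pow_im 1 (fun m x => -1 * ((m - 0)%:R * q m x)) (frame_mul sm (frame_muln 0 Fq))).
have E1 : complex.Re (dcsum q x l) =
    sum_fun (fun m z => cre (m - 1) z * ((m - 0)%:R * q m (lsubmx z))) z.
  by congr sumR; apply/funext => m; rewrite /cre lam_cpoint lsubmx_cpoint.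
have E2 : complex.Im (dcsum q x l) =
    sum_fun (fun m z => cim (m - 1) z * ((m - 0)%:R * q m (lsubmx z))) z.
  by congr sumR; apply/funext => m; rewrite /cim lam_cpoint lsubmx_cpoint.
have E3 : - complex.Im (dcsum q x l) =
    sum_fun (fun m z => cim (m - 1) z * (- 1 * ((m - 0)%:R * q m (lsubmx z)))) z.
  rewrite E2 /sum_fun; have [C HC] := pow_bound g2 Dz.
  have H := sumRZ (-1) (nbhs_singleton HC); apply: (etrans (etrans (esym (mulN1r _)) (esym H))).
  by congr sumR; apply/funext => m; rewrite mulrCA.
have s10 : (ord_max == ord0 :> 'I_2) = false by [].
have s01 : (ord0 == ord_max :> 'I_2) = false by [].
split.
- rewrite E1; apply: (sum_fun_derive open_cyl pow_bound pow_derive g1 _ (pow_re 0 Fq) Dz).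
  move=> m z' _.
  have d := is_derive_mul (proj1 (is_derive_cpow (m - 0) z' (ev (rshift n ord0)))) (dl m z' ord0).
  by apply: (is_derive_eq d); rewrite !e eqxx s10 subn1 subn0 mulr1n mulr0n; ring.
- rewrite E3; apply: (sum_fun_derive open_cyl pow_bound pow_derive g3 _ (pow_re 0 Fq) Dz).
  move=> m z' _.
  have d := is_derive_mul (proj1 (is_derive_cpow (m - 0) z' (ev (rshift n ord_max)))) (dl m z' ord_max).
  by apply: (is_derive_eq d); rewrite !e eqxx s01 subn1 subn0 mulr1n mulr0n; ring.
- rewrite E2; apply: (sum_fun_derive open_cyl pow_bound pow_derive g2 _ (pow_im 0 Fq) Dz).
  move=> m z' _.
  have d := is_derive_mul (proj2 (is_derive_cpow (m - 0) z' (ev (rshift n ord0)))) (dl m z' ord0).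
  by apply: (is_derive_eq d); rewrite !e eqxx s10 subn1 subn0 mulr1n mulr0n; ring.
- rewrite E1; apply: (sum_fun_derive open_cyl pow_bound pow_derive g1 _ (pow_im 0 Fq) Dz).
  move=> m z' _.
  have d := is_derive_mul (proj2 (is_derive_cpow (m - 0) z' (ev (rshift n ord_max)))) (dl m z' ord_max).
  by apply: (is_derive_eq d); rewrite !e eqxx s01 subn1 subn0 mulr1n mulr0n; ring.
Qed.

(** With x fixed only the two lambda coordinates move, so the first-order expansion in n + 2
    variables keeps two terms. *)
Lemma part_expand (F : 'rV[R]_(n + 2) -> R) x l (a b : R) : smooth_on cyl F -> D x ->
  is_derive (cpoint x l) (ev (rshift n ord0)) F a ->
  is_derive (cpoint x l) (ev (rshift n ord_max)) F b ->
  forall e, 0 < e -> exists2 d, 0 < d & forall h : R[i],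
    `|complex.Re h| < d -> `|complex.Im h| < d ->
    `|F (cpoint x (l + h)) - F (cpoint x l) - (complex.Re h * a + complex.Im h * b)|
      <= e * Num.max `|complex.Re h| `|complex.Im h|.
Proof.
move=> sF Dx da db e e0; have Dz : cyl (cpoint x l) by rewrite /cyl /= lsubmx_cpoint.
have := pd_cvg_expand (smooth_nbhs_derivable open_cyl sF Dz)
  (fun i => smooth_continuous (smooth_pd i sF) Dz) e0.
move/nbhs_ballP => [d /= d0 Hd]; exists d => // h h1 h2.
have E k : (cpoint x (l + h) - cpoint x l) 0 (rshift n k) =
    if k == ord0 then complex.Re h else complex.Im h.
  rewrite /cpoint !mxE !(unsplitK (inr k)) !mxE.
  by rewrite ReD ImD; case: (k == ord0); rewrite addrAC subrr add0r.
have E' k : (cpoint x (l + h) - cpoint x l) 0 (lshift 2 k) = 0.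
  by rewrite /cpoint !mxE !(unsplitK (inl k)) subrr.
have B : ball (cpoint x l) d (cpoint x (l + h)).
  apply/(mem_ball_rV _ _ d0) => j; rewrite distrC.
  have -> : cpoint x (l + h) 0 j - cpoint x l 0 j = (cpoint x (l + h) - cpoint x l) 0 j.
    by rewrite !mxE.
  rewrite -(splitK j); case: (fintype.split j) => k /=; first by rewrite E' normr0.
  by rewrite E; case: ifP.
have := Hd _ B; rewrite big_split_ord /= big1; last by move=> k _; rewrite E' mul0r.
rewrite add0r big_ord_recl big_ord1 !E /=.
have -> : pd (rshift n ord0) F (cpoint x l) = a by exact: (pd_val da).
have -> : lift ord0 ord0 = ord_max :> 'I_2 by apply/val_inj.
have -> : pd (rshift n ord_max) F (cpoint x l) = b by exact: (pd_val db).
move=> /le_trans; apply; apply: ler_wpM2l; first exact: ltW.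
apply/mx_norm_leP; first by rewrite le_max normr_ge0.
move=> i j; rewrite (ord1 i) -(splitK j); case: (fintype.split j) => k /=.
  by rewrite E' normr0 le_max normr_ge0.
by rewrite E le_max; case: ifP; rewrite lexx ?orbT.
Qed.

End frame_series.

(** * Complex derivatives from real expansions *)

Section complex_derivative.
Context {R : realType}.
Notation C := R[i].

Lemma norm_Re_le (h : C) : (`|complex.Re h|)%:C%C <= `|h|.
Proof. exact: normc_ge_Re. Qed.

Lemma norm_Im_le (h : C) : (`|complex.Im h|)%:C%C <= `|h|.
Proof.
rewrite normc_def lecR -sqrtr_sqr; apply: ler_wsqrtr.
by rewrite lerDr sqr_ge0.
Qed.

Lemma norm_le_ReIm (h : C) : `|h| <= (`|complex.Re h| + `|complex.Im h|)%:C%C.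
Proof.
rewrite normc_def lecR -[leRHS]ger0_norm ?addr_ge0 // -sqrtr_sqr; apply: ler_wsqrtr.
rewrite sqrrD !real_normK ?num_real // addrAC -[leLHS]addr0 lerD2l.
by rewrite mulrn_wge0 // mulr_ge0.
Qed.

Lemma norm_max_le (h : C) : (Num.max `|complex.Re h| `|complex.Im h|)%:C%C <= `|h|.
Proof.
by case: (lerP `|complex.Re h| `|complex.Im h|) => _; [exact: norm_Im_le|exact: norm_Re_le].
Qed.

(** The hypothesis is used with half of the tolerance for each part, since |w| <= |Re w| + |Im w|
    while max (|Re h|, |Im h|) <= |h|. A positive complex tolerance is automatically real. *)
Lemma cvg_complex_scalar (H : C -> C) (T l : C) :
  (forall e : R, 0 < e -> exists2 d, 0 < d & forall h : C,
     `|complex.Re h| < d -> `|complex.Im h| < d ->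
     `|complex.Re (H (l + h) - H l - h * T)| <= e * Num.max `|complex.Re h| `|complex.Im h| /\
     `|complex.Im (H (l + h) - H l - h * T)| <= e * Num.max `|complex.Re h| `|complex.Im h|) ->
  forall e : C, 0 < e -> \forall h \near (0 : C^o)^',
    `|T - h^-1 * (H (h * 1 + l) - H l)| <= e.
Proof.
move=> Hd e e0.
have [e1 e10 E] : exists2 e1 : R, 0 < e1 & e = e1%:C%C.
  move: e0; case: e => a b; rewrite ltcE /= => /andP[/eqP -> a0].
  by exists a.
have e20 : 0 < e1 / 2 by rewrite divr_gt0.
have [d d0 Hh] := Hd _ e20.
have dC : 0 < d%:C%C :> C by rewrite ltcR.
near=> h.
have h0 : (h : C^o) != 0 by near: h; exact: (@nbhs_dnbhs_neq C^o 0).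
have hd : `|h : C^o| < d%:C%C by near: h; exact: (@dnbhs0_lt C C^o _ dC).
have h1 : `|complex.Re h| < d by rewrite -ltcR; apply: le_lt_trans hd; exact: norm_Re_le.
have h2 : `|complex.Im h| < d by rewrite -ltcR; apply: le_lt_trans hd; exact: norm_Im_le.
have [b1 b2] := Hh h h1 h2.
rewrite mulr1 [h + l]addrC.
have -> : T - h^-1 * (H (l + h) - H l) = - (h^-1 * (H (l + h) - H l - h * T)).
  by rewrite [in RHS]mulrBr mulKf // opprB.
rewrite normrN normrM normfV ler_pdivrMl ?normr_gt0 //.
apply: le_trans (norm_le_ReIm _) _.
apply: (@le_trans _ _ ((Num.max `|complex.Re h| `|complex.Im h|)%:C%C * e)).
  rewrite E -rmorphM lecR; apply: le_trans (lerD b1 b2) _.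
  by rewrite -mulrDl -splitr mulrC.
by apply: ler_wpM2r; [exact: ltW|exact: norm_max_le].
Unshelve. all: by end_near. Qed.

Lemma is_derive_cvg (K : numFieldType) (V W : normedModType K) (f : V -> W) x v df :
  (fun h : K => h^-1 *: (f (h *: v + x) - f x)) @ 0^' --> df -> is_derive x v f df.
Proof.
by move=> E; split; [apply/cvg_ex; exists df|exact/cvg_lim].
Qed.

Lemma is_derive_complex_mx p (H : C -> 'M[C]_p) (T : 'M[C]_p) (l : C) :
  (forall a b (e : R), 0 < e -> exists2 d, 0 < d & forall h : C,
     `|complex.Re h| < d -> `|complex.Im h| < d ->
     `|complex.Re (H (l + h) a b - H l a b - h * T a b)| <=
        e * Num.max `|complex.Re h| `|complex.Im h| /\
     `|complex.Im (H (l + h) a b - H l a b - h * T a b)| <=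
        e * Num.max `|complex.Re h| `|complex.Im h|) ->
  is_derive (l : C^o) (1 : C^o) (H : C^o -> 'M[C]_p) T.
Proof.
move=> Hd; apply: is_derive_cvg => A [P HP sPA].
have near_ab : \forall h \near (0 : C^o)^', forall ab : 'I_p * 'I_p,
    P ab.1 ab.2 (h^-1 * (H (h * 1 + l) ab.1 ab.2 - H l ab.1 ab.2)).
  apply: (@filter_forall _ _ (fun (ab : 'I_p * 'I_p) (h : C^o) =>
    P ab.1 ab.2 (h^-1 * (H (h * 1 + l) ab.1 ab.2 - H l ab.1 ab.2)))
    (0 : C^o)^' _) => -[a b] /=.
  have c : (fun h : C^o => h^-1 * (H (h * 1 + l) a b - H l a b) : C^o) @ 0^' --> (T a b : C^o).
    apply/cvgrPdist_le => e e0.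
    exact: (cvg_complex_scalar (H := fun u => H u a b) (Hd a b) e0).
  exact: c _ (HP a b).
apply: filterS near_ab => h Hh; apply: sPA => a b.
by rewrite !mxE; exact: (Hh (a, b)).
Qed.

End complex_derivative.

(** * The moving frame of a Combescure sequence *)

Section normal_vector.
Context {K : comNzRingType} {n : nat}.

(** The generalised cross product of the rows of [M]. Being polynomial in the entries it depends
    smoothly on the point, whereas the unit normals in the hypotheses are only chosen pointwise. *)
Definition normal_covector (M : 'M[K]_(n, n + 1)) : 'rV[K]_(n + 1) :=
  \row_r cofactor (col_mx M 0) (rshift n ord0) r.

(* The cofactors along the last row do not depend on that row. *)
Lemma det_col_mx_normal (M : 'M[K]_(n, n + 1)) (w : 'rV[K]_(n + 1)) :
  \det (col_mx M w) = \sum_r w 0 r * normal_covector M 0 r.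
Proof.
rewrite (expand_det_row _ (rshift n ord0)); apply: eq_bigr => r _.
rewrite col_mxEd mxE; congr (_ * (_ * \det _)).
apply/matrixP => a b; rewrite !mxE.
case: splitP => // j; rewrite (ord1 j) => e.
have := neq_lift (rshift n ord0) a; rewrite -val_eqE /= in e *.
by rewrite e eqxx.
Qed.

(** The pairing is a determinant with row [j] repeated. *)
Lemma normal_covector_orth (M : 'M[K]_(n, n + 1)) (j : 'I_n) :
  \sum_r M j r * normal_covector M 0 r = 0.
Proof.
have <- : \sum_r (row j M) 0 r * normal_covector M 0 r =
    \sum_r M j r * normal_covector M 0 r by apply: eq_bigr => r _; rewrite mxE.
rewrite -det_col_mx_normal.
apply: (@determinant_alternate _ _ _ (lshift 1 j) (rshift n ord0)).
  by rewrite eq_lrshift.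
by move=> r; rewrite col_mxEu col_mxEd mxE.
Qed.

Lemma mulmx_normal (M : 'M[K]_(n, n + 1)) : M *m (normal_covector M)^T = 0.
Proof.
apply/colP => j; rewrite [LHS]mxE [RHS]mxE -[RHS](normal_covector_orth M j).
by apply: eq_bigr => r _; rewrite [in LHS]mxE.
Qed.

End normal_vector.

Section dotv_theory.
Context {R : realType} {m : nat}.
Implicit Types a b : 'cV[R]_m.

Lemma dotv_mulmx a b : (a^T *m b) 0 0 = dotv a b.
Proof. by rewrite mxE; apply: eq_bigr => r _; rewrite mxE. Qed.

Lemma dotvC a b : dotv a b = dotv b a.
Proof. by apply: eq_bigr => r _; rewrite mulrC. Qed.

Lemma dotvZl c a b : dotv (c *: a) b = c * dotv a b.
Proof. by rewrite /dotv mulr_sumr; apply: eq_bigr => r _; rewrite mxE mulrA. Qed.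

Lemma dotvZr c a b : dotv a (c *: b) = c * dotv a b.
Proof. by rewrite dotvC dotvZl dotvC. Qed.

Lemma dotv_gt0 a : a != 0 -> 0 < dotv a a.
Proof.
move=> a0; rewrite lt_neqAle eq_sym; apply/andP; split; last first.
  by apply: sumr_ge0 => r _; rewrite -expr2 sqr_ge0.
apply: contra a0 => /eqP H; apply/eqP/colP => r; rewrite mxE.
have /psumr_eq0P/(_ H r isT)/eqP : forall r : 'I_m, true -> 0 <= a r 0 * a r 0.
  by move=> i _; rewrite -expr2 sqr_ge0.
by rewrite mulf_eq0 orbb => /eqP.
Qed.

Lemma mulmx_rows n (e : 'I_n -> 'cV[R]_m) (v : 'cV[R]_m) :
  (\matrix_(j, r) e j r 0) *m v = \col_j dotv (e j) v.
Proof.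
by apply/colP => j; rewrite !mxE; apply: eq_bigr => r _; rewrite mxE.
Qed.

Lemma gram_rows n (e : 'I_n -> 'cV[R]_m) :
  (\matrix_(j, r) e j r 0) *m (\matrix_(j, r) e j r 0)^T = \matrix_(i, j) dotv (e i) (e j).
Proof.
by apply/matrixP => i j; rewrite !mxE; apply: eq_bigr => r _; rewrite !mxE.
Qed.

End dotv_theory.

(** A unit normal v completes M to an orthogonal matrix X. The cross product w is orthogonal to the
    rows of M and pairs with v to det X, so its coordinates in X are (0, det X), and (det X)^2 =
    1. *)
Lemma unit_normal {R : realType} {n : nat} (M : 'M[R]_(n, n + 1)) (v : 'cV[R]_(n + 1)) :
  M *m M^T = 1%:M -> M *m v = 0 -> dotv v v = 1 ->
  normal_covector M *m (normal_covector M)^T = 1%:M.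
Proof.
move=> MM Mv vv.
have vT : v^T *m v = 1%:M.
  by apply/matrixP => a b; rewrite (ord1 a) (ord1 b) dotv_mulmx vv mxE eqxx.
pose X := col_mx M v^T.
have XX : X *m X^T = 1%:M.
  rewrite /X tr_col_mx trmxK mul_col_row MM Mv vT.
  by rewrite -trmx_mul Mv trmx0 -scalar_mx_block.
have XtX : X^T *m X = 1%:M by apply: mulmx1C.
pose w := normal_covector M.
have Mw : M *m w^T = 0 by exact: mulmx_normal.
have dw : (v^T *m w^T) 0 0 = \det X.
  rewrite /X det_col_mx_normal mxE; apply: eq_bigr => r _.
  by rewrite [w^T _ _]mxE.
have Xw : X *m w^T = col_mx 0 (\det X)%:M.
  rewrite /X mul_col_mx Mw; congr col_mx.
  by apply/matrixP => a b; rewrite (ord1 a) (ord1 b) dw mxE eqxx mulr1n.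
have wE : w^T = X^T *m col_mx 0 (\det X)%:M by rewrite -Xw mulmxA XtX mul1mx.
rewrite -/w -[X in X *m _]trmxK wE trmx_mul trmxK -mulmxA (mulmxA X) XX mul1mx.
rewrite tr_col_mx mul_row_col trmx0 mul0mx add0r tr_scalar_mx -scalar_mxM.
congr (_%:M); have := congr1 determinant XX.
by rewrite det_mulmx det_tr det1.
Qed.

(** * Common frame and rotation coefficients *)

Section combescure_geometry.
Context {R : realType} {n k : nat}.
Variable D : set 'rV[R]_n.
Hypothesis oD : open D.
Variable f : 'I_n -> 'rV[R]_n -> 'cV[R]_(n + 1).
Hypothesis comb : combescure_seq n k D f.
Variable i0 : 'I_n.
Hypothesis i0_0 : i0 = 0%N :> nat.
Implicit Types x y : 'rV[R]_n.

Lemma comb_smooth l : smooth_on D (f l).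
Proof. by have [H _] := comb; case: (H l) => -[]. Qed.

Lemma scale_cancel (F : fieldType) (V : lmodType F) (a b : F) (v w : V) :
  a != 0 -> a^-1 *: v = b *: w -> v = (a * b) *: w.
Proof. by move=> a0 H; rewrite -scalerA -H scalerA divff // scale1r. Qed.

Lemma row_free_neq0 (F : fieldType) p q (M : 'M[F]_(p, q)) j : row_free M -> row j M != 0.
Proof.
move=> /row_freeP[B MB]; apply/eqP => z.
have := congr1 (fun A => (row j A) 0 j) MB.
by rewrite row_mul z mul0mx !mxE eqxx => /esym/eqP; rewrite oner_eq0.
Qed.

Lemma pd_f_neq0 l j x : D x -> pd j (f l) x != 0.
Proof.
move=> Dx; have [H _] := comb; have [[_ /(_ x Dx)[rf _]] _] := H l.
have := row_free_neq0 j rf; rewrite rowK; apply: contra => /eqP ->.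
by rewrite trmx0.
Qed.

(** The functions [u] in the definition of a Combescure sequence carry no regularity, so the lengths
    are recomputed as positive square roots from the first hypersurface. The resulting [coef] are
    smooth and may be negative for the other hypersurfaces. *)
Definition len j x : R := Num.sqrt (dotv (pd j (f i0) x) (pd j (f i0) x)).
Definition frame_vec j x : 'cV[R]_(n + 1) := (len j x)^-1 *: pd j (f i0) x.
Definition coef l j x : R := dotv (pd j (f l) x) (frame_vec j x).

Lemma len_gt0 j x : D x -> 0 < len j x.
Proof. by move=> Dx; rewrite sqrtr_gt0 dotv_gt0 // pd_f_neq0. Qed.

Lemma frame_vec_orthonormal i j x : D x ->
  dotv (frame_vec i x) (frame_vec j x) = (i == j)%:R.
Proof.
move=> Dx; rewrite dotvZl dotvZr; have [<-|ij] := eqVneq i j.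
  have l0 := len_gt0 i Dx; have ln : len i x != 0 by rewrite gt_eqF.
  have E : dotv (pd i (f i0) x) (pd i (f i0) x) = len i x * len i x.
    by rewrite -expr2 sqr_sqrtr // ltW // dotv_gt0 // pd_f_neq0.
  by rewrite E mulr1n; field.
have [H _] := comb; have [[_ /(_ x Dx)[_ [N [_ [_ HN]]]]] _] := H i0.
have [e _] := HN i j ij.
by rewrite e; move: (len i x) (len j x) => a b; rewrite !mulr0.
Qed.

(** The coefficients differ from the given [u] by a nonzero factor [s j] independent of [l], so
    independence survives multiplication by an invertible diagonal matrix. *)
Lemma coef_facts x : D x ->
  (forall l j, pd j (f l) x = coef l j x *: frame_vec j x) /\
  row_free (\matrix_(l < n) \row_(j < n) coef l j x).
Proof.
move=> Dx; have [_ [_ [u [u2 [u0 urf]]]]] := comb.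
have un l j : u l j x != 0.
  apply/eqP => z; have := u2 l j x Dx; rewrite z expr0n /=.
  by move/eqP; rewrite eq_sym gt_eqF // dotv_gt0 // pd_f_neq0.
pose s j := len j x / u i0 j x.
have sn j : s j != 0.
  by rewrite mulf_neq0 ?invr_eq0 // gt_eqF // len_gt0.
have E l j : pd j (f l) x = (u l j x * s j) *: frame_vec j x.
  apply: (etrans (scale_cancel (un l j) (u0 l i0 j x i0_0 Dx))).
  rewrite /frame_vec !scalerA; congr (_ *: _); rewrite /s.
  have ln : len j x != 0 by rewrite (gt_eqF (len_gt0 j Dx)).
  have u1 := un i0 j. by field; rewrite ln u1.
have cE l j : coef l j x = u l j x * s j.
  by rewrite /coef E dotvZl frame_vec_orthonormal // eqxx mulr1.
split=> [l j|]; first by rewrite cE.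
have -> : (\matrix_(l < n) \row_(j < n) coef l j x) =
    (\matrix_(l < n) \row_(j < n) u l j x) *m diag_mx (\row_j s j).
  apply/matrixP => l j; rewrite mul_mx_diag !mxE.
  by rewrite cE.
rewrite row_free_unit unitmx_mul -row_free_unit (urf x Dx) /=.
rewrite unitmxE det_diag unitfE; apply/prodf_neq0 => j _.
by rewrite mxE.
Qed.

Lemma smooth_dotv (g h : 'rV[R]_n -> 'cV[R]_(n + 1)) : smooth_on D g -> smooth_on D h ->
  smooth_on D (fun x => dotv (g x) (h x)).
Proof.
move=> /(smooth_mxP oD) sg /(smooth_mxP oD) sh.
by apply: (smooth_sum oD) => r _; exact: (smoothM oD (sg r 0) (sh r 0)).
Qed.

Lemma smooth_len j : smooth_on D (len j).
Proof.
apply: (smooth_sqrt oD).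
  by move=> x Dx; rewrite dotv_gt0 // pd_f_neq0.
have s := smooth_pd j (comb_smooth i0); exact: smooth_dotv.
Qed.

Lemma smooth_frame_vec j : smooth_on D (frame_vec j).
Proof.
have s := (smooth_mxP oD _).1 (smooth_pd j (comb_smooth i0)).
have sl : smooth_on D (fun x => (len j x)^-1).
  apply: (smoothV oD); last exact: smooth_len.
  by move=> x Dx; rewrite gt_eqF // len_gt0.
apply/(smooth_mxP oD) => a b.
by apply: (eq_smooth oD (smoothM oD sl (s a b))) => x _; rewrite [RHS]mxE.
Qed.

Lemma smooth_coef l j : smooth_on D (coef l j).
Proof.
have s := smooth_pd j (comb_smooth l); have s' := smooth_frame_vec j.
exact: smooth_dotv.
Qed.

Definition frame_rows x : 'M[R]_(n, n + 1) := \matrix_(j, r) frame_vec j x r 0.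
Definition frame x : 'M[R]_(n + 1) :=
  (col_mx (frame_rows x) (normal_covector (frame_rows x)))^T.

Lemma frame_rows_orth x : D x -> frame_rows x *m (frame_rows x)^T = 1%:M.
Proof.
move=> Dx; rewrite gram_rows; apply/matrixP => i j; rewrite [LHS]mxE [RHS]mxE.
exact: frame_vec_orthonormal.
Qed.

Lemma frame_orth x : D x -> (frame x)^T *m frame x = 1%:M.
Proof.
move=> Dx; have MM := frame_rows_orth Dx.
have [H _] := comb; have [[_ /(_ x Dx)[_ [N [NN [Np _]]]]] _] := H i0.
have MN : frame_rows x *m N = 0.
  rewrite mulmx_rows; apply/colP => j; rewrite [LHS]mxE [RHS]mxE dotvZl dotvC (Np j).
  exact: mulr0.
have ww := unit_normal MM MN NN.
set w := normal_covector _ in ww *.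
have Mw : frame_rows x *m w^T = 0 by exact: mulmx_normal.
rewrite /frame -/w trmxK tr_col_mx mul_col_row MM Mw ww.
have -> : w *m (frame_rows x)^T = 0 by rewrite -[w]trmxK -trmx_mul Mw trmx0.
by rewrite -scalar_mx_block.
Qed.

Lemma smooth_frame : smooth_on D frame.
Proof.
have sr : forall a b, smooth_on D (fun x => frame_rows x a b).
  move=> a b; have s := (smooth_mxP oD _).1 (smooth_frame_vec a) b 0.
  by apply: (eq_smooth oD s) => x _; rewrite [RHS]mxE.
have s0 : smooth_on D (fun x => col_mx (frame_rows x) (0 : 'rV[R]_(n + 1))).
  apply/(smooth_mxP oD) => a b; rewrite -(splitK a); case: (fintype.split a) => j /=.
    by apply: (eq_smooth oD (sr j b)) => x _; rewrite col_mxEu.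
  apply: (eq_smooth oD (smooth_cst oD (0 : R))) => x _.
  by rewrite col_mxEd mxE.
apply: (smooth_trmx oD); apply/(smooth_mxP oD) => a b.
rewrite -(splitK a); case: (fintype.split a) => j /=.
  by apply: (eq_smooth oD (sr j b)) => x _; rewrite col_mxEu.
have sd : smooth_on D (fun x => cofactor (col_mx (frame_rows x) 0) (rshift n ord0) b).
  apply: (smoothM oD); first exact: smooth_cst.
  apply: (smooth_det oD); apply/(smooth_mxP oD) => c d.
  have s1 := (smooth_mxP oD _).1 s0 (lift (rshift n ord0) c) (lift b d).
  by apply: (eq_smooth oD s1) => x _; rewrite [RHS]mxE [RHS]mxE.
by apply: (eq_smooth oD sd) => x _; rewrite col_mxEd [RHS]mxE.
Qed.

Definition conn i x : 'M[R]_(n + 1) := (frame x)^T *m pd i frame x.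

Lemma moving_frame_derive i x : D x -> is_derive x (ev i) frame (frame x *m conn i x).
Proof.
move=> Dx; have d := smooth_is_derive i smooth_frame Dx.
apply: (is_derive_eq d); rewrite /conn mulmxA.
by rewrite (mulmx1C (frame_orth Dx)) mul1mx.
Qed.

Lemma conn_skew i x : D x -> (conn i x)^T = - conn i x.
Proof.
move=> Dx; apply/eqP; rewrite -addr_eq0; apply/eqP.
have d := smooth_is_derive i smooth_frame Dx.
have d1 := is_derive_mulmx (is_derive_trmx d) d.
have d2 : is_derive x (ev i) (fun y => (frame y)^T *m frame y) 0.
  apply: (eq_on_is_derive oD _ Dx (is_derive_cst (1%:M : 'M[R]_(n + 1)) x (ev i))).
  by move=> y Dy; rewrite frame_orth.
by rewrite /conn trmx_mul trmxK -(pd_val d1) (pd_val d2).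
Qed.

Lemma conn_skewE i x a b : D x -> conn i x a b = - conn i x b a.
Proof. by move=> Dx; have := congr1 (fun A : 'M[R]__ => A b a) (conn_skew i Dx); rewrite !mxE. Qed.

(* Otherwise unification compares partial derivatives by unfolding limits. *)
#[local] Opaque pd len coef conn.

Lemma frame_vecE j x : frame_vec j x = frame x *m delta_mx (lshift 1 j) 0.
Proof.
rewrite -colE; apply/colP => r.
by rewrite [RHS]mxE [RHS]mxE col_mxEu [RHS]mxE.
Qed.

Lemma pd_fE l j x : D x -> pd j (f l) x = coef l j x *: (frame x *m delta_mx (lshift 1 j) 0).
Proof. by move=> Dx; rewrite -frame_vecE; have [H _] := coef_facts Dx; exact: H. Qed.

Lemma is_derive_scale (c : 'rV[R]_n -> R) p q (A : 'rV[R]_n -> 'M[R]_(p, q)) x v dc dA :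
  is_derive x v c dc -> is_derive x v A dA ->
  is_derive x v (fun y => c y *: A y) (dc *: A x + c x *: dA).
Proof.
move=> d1 /is_derive_mxP d2; apply/is_derive_mxP => a b.
have d := is_derive_mul d1 (d2 a b).
rewrite !mxE; under eq_fun do rewrite mxE.
exact: d.
Qed.

(** The component along frame vector [b] of d_i d_j f_l = d_j d_i f_l. *)
Lemma coef_compat l i j x (b : 'I_(n + 1)) : D x ->
  pd i (coef l j) x * (b == lshift 1 j)%:R + coef l j x * conn i x b (lshift 1 j) =
  pd j (coef l i) x * (b == lshift 1 i)%:R + coef l i x * conn j x b (lshift 1 i).
Proof.
move=> Dx.
have E i' j' : (frame x)^T *m pd i' (pd j' (f l)) x =
    pd i' (coef l j') x *: delta_mx (lshift 1 j') 0 +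
    coef l j' x *: (conn i' x *m delta_mx (lshift 1 j') 0).
  have dc := smooth_is_derive i' (smooth_coef l j') Dx.
  have dA := is_derive_mulmx (moving_frame_derive i' Dx)
    (is_derive_cst (delta_mx (lshift 1 j') 0 : 'cV[R]_(n + 1)) x (ev i')).
  have d := is_derive_scale dc dA.
  have d' := eq_on_is_derive oD (fun y Dy => esym (pd_fE l j' Dy)) Dx d.
  rewrite (pd_val d') mulmx0 addr0 mulmxDr -!scalemxAr !mulmxA.
  by rewrite (frame_orth Dx) !mul1mx.
have P := congr1 (fun A => (frame x)^T *m A) (pd_mx_comm oD i j (comb_smooth l) Dx).
have := congr1 (fun A : 'cV[R]_(n + 1) => A b 0) (etrans (esym (E i j)) (etrans P (E j i))).
move: (pd i (coef l j) x) (pd j (coef l i) x) (coef l j x) (coef l i x) => c1 c2 c3 c4.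
move: (conn i x) (conn j x) => m1 m2.
by rewrite -!colE !mxE !eqxx !andbT.
Qed.

Lemma compat_off (c1 c2 c3 c4 m1 m2 : R) (b1 b2 : bool) :
  c1 * b1%:R + c3 * m1 = c2 * b2%:R + c4 * m2 -> b1 = false -> b2 = false ->
  c3 * m1 + (c4 * - m2 + 0) = 0.
Proof.
move=> H e1 e2; move: H; rewrite e1 e2 !mulr0 !add0r => ->.
by rewrite addr0 mulrN subrr.
Qed.

Lemma compat_on (c1 c2 c3 c4 m1 m2 : R) (b1 b2 : bool) :
  c1 * b1%:R + c3 * m1 = c2 * b2%:R + c4 * m2 -> b1 = true -> b2 = false ->
  m1 = 0 -> c1 = c4 * m2.
Proof.
by move=> H e1 e2 e3; move: H; rewrite e1 e2 e3 mulr1 !mulr0 addr0 add0r.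
Qed.

Lemma skew_diag (a : R) : a = - a -> a = 0.
Proof. by move=> H; lra. Qed.

Lemma coef_inj x (c : 'I_n -> R) : D x ->
  (forall l, \sum_j coef l j x * c j = 0) -> forall j, c j = 0.
Proof.
move=> Dx H j; have [_ rf] := coef_facts Dx.
rewrite row_free_unit in rf.
have E : (\matrix_(l < n) \row_(j < n) coef l j x) *m (\col_j c j) = 0.
  apply/colP => l; rewrite !mxE -[RHS](H l); apply: eq_bigr => j' _.
  by rewrite !mxE.
have := congr1 (fun A => invmx (\matrix_(l < n) \row_(j < n) coef l j x) *m A) E.
rewrite /= mulmxA mulVmx // mul1mx mulmx0 => /colP/(_ j).
by rewrite !mxE.
Qed.

(** For b distinct from i and j, compatibility reads v_lj conn_i(b, j) = v_li conn_j(b, i) for every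
    l. This is a linear relation satisfied by all the vectors v_l, and these span, so both
    coefficients vanish. For b = j skewness suffices. *)
Lemma conn_zero i j x (b : 'I_(n + 1)) : D x -> i != j -> b != lshift 1 i ->
  conn i x b (lshift 1 j) = 0.
Proof.
move=> Dx ij bi; have [->|bj] := eqVneq b (lshift 1 j).
  exact: skew_diag (conn_skewE i (lshift 1 j) (lshift 1 j) Dx).
pose c j' := if j' == j then conn i x b (lshift 1 j)
  else if j' == i then - conn j x b (lshift 1 i) else 0.
have ji : (i == j) = false by exact/negbTE.
have /coef_inj : forall l, \sum_j' coef l j' x * c j' = 0.
  move=> l; rewrite (bigD1 j) //= (bigD1 i) //= big1; last first.
    by move=> j' /andP[a1 a2]; rewrite /c (negbTE a1) (negbTE a2) mulr0.
  rewrite /c eqxx ji eqxx.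
  exact: compat_off (coef_compat l i j b Dx) (negbTE bj) (negbTE bi).
by move=> /(_ Dx j); rewrite /c eqxx.
Qed.

Lemma coef_derive_off l i j x : D x -> i != j ->
  pd i (coef l j) x = coef l i x * conn j x (lshift 1 j) (lshift 1 i).
Proof.
move=> Dx ij.
have z : conn i x (lshift 1 j) (lshift 1 j) = 0.
  exact: skew_diag (conn_skewE i (lshift 1 j) (lshift 1 j) Dx).
have e : (lshift 1 j == lshift 1 i) = false by rewrite eq_lshift eq_sym (negbTE ij).
exact: compat_on (coef_compat l i j (lshift 1 j) Dx) (eqxx _) e z.
Qed.

Lemma coef_null l x : D x -> \sum_j eps n k j * (coef l j x * coef l j x) = 0.
Proof.
move=> Dx; have [H _] := comb; have [_ /(_ x Dx) E] := H l.
have F j : dotv (pd j (f l) x) (pd j (f l) x) = coef l j x * coef l j x.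
  have [H1 _] := coef_facts Dx; rewrite {1 2}H1 dotvZl dotvZr.
  by rewrite frame_vec_orthonormal // eqxx mulr1.
rewrite (bigID (fun j : 'I_n => (j < n - k)%N)) /=.
apply/eqP; rewrite addr_eq0; apply/eqP.
transitivity (\sum_(j < n | (j < n - k)%N) dotv (pd j (f l) x) (pd j (f l) x)).
  by apply: eq_bigr => j Hj; rewrite /eps Hj mul1r F.
rewrite E -sumrN; apply: eq_big => [j|j Hj]; first by rewrite -leqNgt.
by rewrite /eps ltnNge Hj /= mulN1r opprK F.
Qed.

Lemma eps_sq j : eps n k j * eps n k j = 1 :> R.
Proof. by rewrite /eps; case: ifP => _; rewrite ?mulr1 // mulrNN mulr1. Qed.

(** Obtained by solving row [i] of [conn i = omega_i] for F and gamma: off the diagonal that row is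
    - eps_i F_ib, and its last entry is - eps_i gamma_i. *)
Definition rotF x : 'M[R]_n := \matrix_(i, j)
  if i == j then 0 else - eps n k i * conn i x (lshift 1 i) (lshift 1 j).
Definition rotg x : 'cV[R]_n := \col_i
  (- eps n k i * conn i x (lshift 1 i) (rshift n ord0)).

Lemma rotF_diag i x : rotF x i i = 0.
Proof. by rewrite mxE eqxx. Qed.

Lemma rotF_off i j x : i != j ->
  rotF x i j = - eps n k i * conn i x (lshift 1 i) (lshift 1 j).
Proof. by move=> /negbTE ij; rewrite mxE ij. Qed.

Lemma coef_neq0 l j x : D x -> coef l j x != 0.
Proof.
move=> Dx; have := pd_f_neq0 l j Dx; apply: contra => /eqP z.
by have [H _] := coef_facts Dx; rewrite H z scale0r.
Qed.

Lemma eps_cancel (a c h : R) : a * a = 1 -> c * h = - a * (- a * h) * c.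
Proof.
by move=> aa; transitivity ((a * a) * (c * h)); [rewrite aa mul1r|ring].
Qed.

(** Substituting the known derivatives, the differentiated condition becomes 2 v_i (ep_i dv_i -
    sum_j F_j v_j) = 0. Cancelling v_i is legitimate here because each hypersurface is immersed. *)
Lemma null_derivative (I : finType) (i : I) (ep v dv F : I -> R) :
  \sum_j ep j * (dv j * v j + v j * dv j) = 0 -> (forall j, ep j * ep j = 1) ->
  v i != 0 -> F i = 0 -> (forall j, j != i -> dv j = - ep j * F j * v i) ->
  dv i = ep i * \sum_j F j * v j.
Proof.
move=> E ee vi Fi dvE.
have S : \sum_(j | j != i) ep j * (dv j * v j + v j * dv j) =
    - (2 * v i * \sum_j F j * v j).
  rewrite [in RHS](bigD1 i) //= Fi mul0r add0r mulr_sumr -sumrN.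
  apply: eq_bigr => j ji; rewrite dvE //.
  transitivity (- (ep j * ep j) * (2 * v i * (F j * v j))); first by ring.
  by rewrite ee mulN1r.
move: E; rewrite (bigD1 i) //= S => /eqP; rewrite subr_eq0 => /eqP E.
have v2 : 2 * v i != 0 by rewrite mulf_neq0 // pnatr_eq0.
apply: (mulfI v2); rewrite mulrCA -E.
transitivity ((ep i * ep i) * (2 * v i * dv i)); first by rewrite ee mul1r.
by ring.
Qed.

(* Differentiate the null condition, the other derivatives being known. *)
Lemma coef_derive_diag l i x : D x ->
  pd i (coef l i) x = eps n k i * \sum_j rotF x j i * coef l j x.
Proof.
move=> Dx.
have d : is_derive x (ev i) (fun y => \sum_j eps n k j * (coef l j y * coef l j y))
   (\sum_j eps n k j * (pd i (coef l j) x * coef l j x + coef l j x * pd i (coef l j) x)).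
  have -> : (fun y => \sum_j eps n k j * (coef l j y * coef l j y)) =
      \sum_j (fun y => eps n k j * (coef l j y * coef l j y)).
    by apply/funext => y; rewrite fct_sumE.
  apply: is_derive_sum => j; have dj := smooth_is_derive i (smooth_coef l j) Dx.
  have d' := is_derive_mul (is_derive_cst (eps n k j : R) x (ev i)) (is_derive_mul dj dj).
  by apply: (is_derive_eq d'); rewrite mul0r add0r.
have d0 : is_derive x (ev i) (fun y => \sum_j eps n k j * (coef l j y * coef l j y)) (0 : R).
  apply: (eq_on_is_derive oD _ Dx (is_derive_cst (0 : R) x (ev i))).
  by move=> y Dy; rewrite coef_null.
have := etrans (esym (pd_val d)) (pd_val d0).
move=> E; apply: (@null_derivative _ i (eps n k) (fun j => coef l j x)
  (fun j => pd i (coef l j) x) (fun j => rotF x j i) E eps_sq (coef_neq0 l i Dx)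
  (rotF_diag i x)) => j ji.
have ij : i != j by rewrite eq_sym.
rewrite (coef_derive_off l Dx ij) (rotF_off x ji).
exact: eps_cancel (eps_sq j).
Qed.

Lemma Eii_mul p (M : 'M[R]_(n, p)) i : Eii i *m M = \matrix_(a, b) ((a == i)%:R * M i b).
Proof.
apply/matrixP => a b; rewrite !mxE (bigD1 i) //= big1 ?addr0.
  by rewrite mxE eqxx andbT.
by move=> j ji; rewrite mxE (negbTE ji) andbF mul0r.
Qed.

Lemma mul_Eii p (M : 'M[R]_(p, n)) i : M *m Eii i = \matrix_(a, b) (M a i * (b == i)%:R).
Proof.
apply/matrixP => a b; rewrite !mxE (bigD1 i) //= big1 ?addr0.
  by rewrite mxE eqxx.
by move=> j ji; rewrite mxE (negbTE ji) mulr0.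
Qed.

Lemma Jm_mul p (M : 'M[R]_(n, p)) : Jm n k *m M = \matrix_(a, b) (eps n k a * M a b).
Proof. by apply/matrixP => a b; rewrite mul_diag_mx !mxE. Qed.

Lemma mul_Jm p (M : 'M[R]_(p, n)) : M *m Jm n k = \matrix_(a, b) (M a b * eps n k b).
Proof. by apply/matrixP => a b; rewrite mul_mx_diag !mxE. Qed.

Lemma omega_ul (F : 'M[R]_n) g i a b : omega_i n k F g i (lshift 1 a) (lshift 1 b) =
  - ((a == i)%:R * (eps n k i * F i b)) + F i a * eps n k i * (b == i)%:R.
Proof.
rewrite block_mxEul mxE; congr (_ + _).
  by rewrite mxE -mulmxA Eii_mul Jm_mul !mxE.
by rewrite mul_Eii mul_Jm !mxE.
Qed.

Lemma omega_ur (F : 'M[R]_n) g i a : omega_i n k F g i (lshift 1 a) (rshift n ord0) =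
  - ((a == i)%:R * (eps n k i * g i 0)).
Proof. by rewrite block_mxEur mxE -mulmxA Eii_mul Jm_mul !mxE. Qed.

Lemma omega_dl (F : 'M[R]_n) g i b : omega_i n k F g i (rshift n ord0) (lshift 1 b) =
  g i 0 * eps n k i * (b == i)%:R.
Proof. by rewrite block_mxEdl mul_Eii mul_Jm !mxE. Qed.

(** Row [i] is the definition of [rotF] and [rotg], column [i] follows by skewness, and all
    remaining entries vanish by [conn_zero] and skewness, as they do in omega. *)
Lemma conn_omega i x : D x -> conn i x = omega_i n k (rotF x) (rotg x) i.
Proof.
move=> Dx; apply/matrixP => a b.
have gE : rotg x i 0 = - eps n k i * conn i x (lshift 1 i) (rshift n ord0).
  by rewrite mxE.
have ee := eps_sq i.
rewrite -(splitK a) -(splitK b); case: (fintype.split a) => {}a; case: (fintype.split b) => {}b /=.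
- rewrite omega_ul; have [->|bi] := eqVneq b i; have [->|ai] := eqVneq a i.
  + rewrite rotF_diag (skew_diag (conn_skewE i (lshift 1 i) (lshift 1 i) Dx)).
    by rewrite !mulr0 !mul0r oppr0 add0r.
  + have ia : i != a by rewrite eq_sym.
    rewrite (rotF_off x ia) (conn_skewE i (lshift 1 a) (lshift 1 i) Dx).
    move: (conn i x _ _) => h; transitivity (- ((eps n k i * eps n k i) * h)).
      by rewrite ee mul1r.
    by rewrite mulr0n mulr1n; ring.
  + have ib : i != b by rewrite eq_sym.
    rewrite (rotF_off x ib).
    move: (conn i x _ _) => h; transitivity ((eps n k i * eps n k i) * h).
      by rewrite ee mul1r.
    by rewrite mulr0n mulr1n; ring.
  + have ib : i != b by rewrite eq_sym.
    have e : lshift 1 a != lshift 1 i by rewrite eq_lshift.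
    by rewrite (conn_zero Dx ib e) mulr0n mul0r mulr0 oppr0 addr0.
- rewrite (ord1 b) omega_ur gE; have [->|ai] := eqVneq a i.
    move: (conn i x _ _) => h; transitivity ((eps n k i * eps n k i) * h).
      by rewrite ee mul1r.
    by rewrite mulr1n; ring.
  have ia : i != a by rewrite eq_sym.
  have e : rshift n ord0 != lshift 1 i :> 'I_(n + 1) by rewrite eq_rlshift.
  rewrite (conn_skewE i (lshift 1 a) (rshift n ord0) Dx) (conn_zero Dx ia e).
  by rewrite mulr0n mul0r.
- rewrite (ord1 a) omega_dl gE; have [->|bi] := eqVneq b i.
    rewrite (conn_skewE i (rshift n ord0) (lshift 1 i) Dx).
    move: (conn i x _ _) => h; transitivity (- ((eps n k i * eps n k i) * h)).
      by rewrite ee mul1r.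
    by rewrite mulr1n; ring.
  have ib : i != b by rewrite eq_sym.
  have e : rshift n ord0 != lshift 1 i :> 'I_(n + 1) by rewrite eq_rlshift.
  by rewrite (conn_zero Dx ib e) mulr0n mulr0.
- rewrite (ord1 a) (ord1 b) block_mxEdr [RHS]mxE.
  exact: skew_diag (conn_skewE i (rshift n ord0) (rshift n ord0) Dx).
Qed.

Definition coef_mx x : 'M[R]_n := \matrix_(j, l) coef l j x.

Lemma JmK p (M : 'M[R]_(n, p)) : Jm n k *m (Jm n k *m M) = M.
Proof. by rewrite !Jm_mul; apply/matrixP => a b; rewrite !mxE mulrA eps_sq mul1r. Qed.

(** Row [i] is the derivative found from the null condition; the other rows are the off-diagonal
    equations. Multiplying by J is what turns these two types of equation into the single matrix -
    tau. *)
Lemma coef_mx_derive i x : D x ->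
  is_derive x (ev i) (fun y => Jm n k *m coef_mx y)
    (- tau_i n k (rotF x) i *m (Jm n k *m coef_mx x)).
Proof.
move=> Dx; apply/is_derive_mxP => a l.
have ds := smooth_is_derive i (smooth_coef l a) Dx.
have d := is_derive_mul (is_derive_cst (eps n k a : R) x (ev i)) ds.
have -> : (fun y => (Jm n k *m coef_mx y) a l) = (fun y => eps n k a * coef l a y).
  by apply/funext => y; rewrite Jm_mul !mxE.
apply: (is_derive_eq d); rewrite mul0r add0r.
rewrite mulNmx /tau_i -mulmxA JmK mulmxBl -!mulmxA Eii_mul Eii_mul.
have -> : (- (rotF x *m (\matrix_(a, b) ((a == i)%:R * coef_mx x i b)) -
    \matrix_(a, b) ((a == i)%:R * ((rotF x)^T *m coef_mx x) i b))) a l =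
    - (rotF x a i * coef l i x) + (a == i)%:R * \sum_j rotF x j i * coef l j x.
  rewrite !mxE opprB addrC; congr (_ + _).
    congr (- _); rewrite (bigD1 i) //= big1 ?addr0.
      by rewrite !mxE eqxx mul1r.
    by move=> j /negbTE ji; rewrite !mxE ji mul0r mulr0.
  by congr (_ * _); apply: eq_bigr => j _; rewrite !mxE.
have [->|ai] := eqVneq a i.
  rewrite (coef_derive_diag l i Dx) mulrA eps_sq rotF_diag.
  by rewrite mul0r oppr0 add0r.
have ia : i != a by rewrite eq_sym.
rewrite (coef_derive_off l Dx ia) (rotF_off x ai) mulr0n mul0r addr0.
by rewrite !mulNr opprK mulrCA mulrC.
Qed.

Lemma coef_mx_unit x : D x -> coef_mx x \in unitmx.
Proof.
move=> Dx; have [_ rf] := coef_facts Dx; rewrite row_free_unit in rf.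
rewrite -unitmx_tr; rewrite (_ : (coef_mx x)^T = \matrix_(l < n) \row_(j < n) coef l j x) //.
by apply/matrixP => l j; rewrite !mxE.
Qed.

(** The two factors J cancel; they are inserted so that [W] and the upper right block of theta
    become visible. *)
Lemma position_derive i x : D x ->
  is_derive x (ev i) (fun y => \matrix_(r, l) f l y r 0)
    (frame x *m col_mx (Eii i) 0 *m Jm n k *m (Jm n k *m coef_mx x)).
Proof.
move=> Dx; apply/is_derive_mxP => r l.
have ds := smooth_is_derive i (comb_smooth l) Dx.
have /is_derive_mxP/(_ r 0) d := ds.
under eq_fun do rewrite mxE.
apply: (is_derive_eq d); rewrite (pd_fE l i Dx) -!mulmxA JmK mul_col_mx mul0mx Eii_mul.
rewrite scalemxAr [LHS]mxE [RHS]mxE; apply: eq_bigr => c _; congr (_ * _).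
rewrite -(splitK c); case: (fintype.split c) => j /=.
  by rewrite col_mxEu !mxE eq_lshift eqxx andbT mulrC.
by rewrite col_mxEd !mxE eq_rlshift mulr0.
Qed.

Lemma smooth_conn i a b : smooth_on D (fun x => conn i x a b).
Proof.
have s := smooth_mulmx oD (smooth_trmx oD smooth_frame) (smooth_pd i smooth_frame).
exact: ((smooth_mxP oD _).1 s a b).
Qed.

Lemma smooth_rotF : smooth_on D rotF.
Proof.
apply/(smooth_mxP oD) => i j; have [ij|ij] := eqVneq i j.
  apply: (eq_smooth oD (smooth_cst oD (0 : R))) => x _.
  by rewrite ij rotF_diag.
have s := smoothM oD (smooth_cst oD (- eps n k i : R)) (smooth_conn i (lshift 1 i) (lshift 1 j)).
by apply: (eq_smooth oD s) => x _; rewrite (rotF_off x ij).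
Qed.

Lemma smooth_rotg : smooth_on D rotg.
Proof.
apply/(smooth_mxP oD) => i b; rewrite (ord1 b).
have s := smoothM oD (smooth_cst oD (- eps n k i : R)) (smooth_conn i (lshift 1 i) (rshift n ord0)).
by apply: (eq_smooth oD s) => x _; rewrite [RHS]mxE.
Qed.

Lemma smooth_coef_mx : smooth_on D (fun x => Jm n k *m coef_mx x).
Proof.
apply/(smooth_mxP oD) => a l.
have s := smoothM oD (smooth_cst oD (eps n k a : R)) (smooth_coef l a).
by apply: (eq_smooth oD s) => x _; rewrite Jm_mul !mxE.
Qed.

(** Interface between geometry and integration: the construction of the extended frame relies on
    these data, the smoothness of the [f l] and their vanishing at the origin. *)
Lemma combescure_frame :
  exists (A : 'rV[R]_n -> 'M[R]_(n + 1)) (W F : 'rV[R]_n -> 'M[R]_n)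
    (g : 'rV[R]_n -> 'cV[R]_n),
  [/\ [/\ smooth_on D A, smooth_on D W, smooth_on D F & smooth_on D g],
      (forall x i, F x i i = 0),
      (forall x, D x -> (A x)^T *m A x = 1%:M /\ W x \in unitmx /\
        forall l, (col l (W x))^T *m Jm n k *m col l (W x) = 0) &
      (forall x i, D x ->
        [/\ is_derive x (ev i) A (A x *m omega_i n k (F x) (g x) i),
            is_derive x (ev i) W (- tau_i n k (F x) i *m W x) &
            is_derive x (ev i) (fun y => \matrix_(r, l) f l y r 0)
              (A x *m col_mx (Eii i) 0 *m Jm n k *m W x)])].
Proof.
exists frame, (fun x => Jm n k *m coef_mx x), rotF, rotg; split.
- split; [exact: smooth_frame|exact: smooth_coef_mx|exact: smooth_rotF|exact: smooth_rotg].
- by move=> x i; exact: rotF_diag.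
- move=> x Dx; split; first exact: frame_orth.
  split.
    have := coef_mx_unit Dx; rewrite -{1}(JmK (coef_mx x)) unitmx_mul => /andP[].
    by [].
  move=> l; have : forall j, (Jm n k *m coef_mx x) j l = eps n k j * coef l j x.
    by move=> j; rewrite Jm_mul !mxE.
  move: (Jm n k *m coef_mx x) => w wE.
  apply/matrixP => a b; rewrite (ord1 a) (ord1 b) -mulmxA Jm_mul [LHS]mxE [RHS]mxE.
  rewrite -[RHS](coef_null l Dx); apply: eq_bigr => j _.
  rewrite !mxE wE; move: (coef l j x) (eps_sq j) => c ee.
  by transitivity (eps n k j * eps n k j * (eps n k j * (c * c))); [ring|rewrite ee mul1r].
- move=> x i Dx; split.
  + by rewrite -(conn_omega i Dx); exact: moving_frame_derive.
  + exact: coef_mx_derive.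
  + exact: position_derive.
Qed.

End combescure_geometry.

(** * Pairs of smooth maps and flatness of logarithmic derivatives *)

Section assembly_tools.
Context {R : realType} {n : nat}.
Variable D : set 'rV[R]_n.
Hypothesis oD : open D.

Lemma smooth_pair (V W : normedModType R) (h : 'rV[R]_n -> V) (k : 'rV[R]_n -> W) :
  smooth_on D h -> smooth_on D k -> smooth_on D (fun x => (h x, k x)).
Proof.
move=> sh sk.
apply: (@smooth_ind _ _ D oD (V * W)%type (fun f => exists h k,
  [/\ smooth_on D h, smooth_on D k & f = fun x => (h x, k x)])); last by exists h, k.
- move=> _ [h' [k' [sh' sk' ->]]] x Dx.
  exact: (cvg_pair (smooth_continuous sh' Dx) (smooth_continuous sk' Dx)).
- move=> _ [h' [k' [sh' sk' ->]]] i.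
  exists (fun x => (pd i h' x, pd i k' x)).
    by exists (pd i h'), (pd i k'); split=> //; [exact: (smooth_pd i sh')|exact: (smooth_pd i sk')].
  move=> x Dx; apply: is_derive_cvg.
  have [d1 _] := smooth_is_derive i sh' Dx; have [d2 _] := smooth_is_derive i sk' Dx.
  exact: (cvg_pair d1 d2).
Qed.

(** Symmetry of the second derivatives of [X], expanded by dX = X w, with the invertible factor [X]
    cancelled. *)
Lemma flat_of_frame m (X : 'rV[R]_n -> 'M[R]_m) (w : 'I_n -> 'rV[R]_n -> 'M[R]_m) :
  smooth_on D X -> (forall i, smooth_on D (w i)) ->
  (forall x, D x -> X x \in unitmx) ->
  (forall x i, D x -> is_derive x (ev i) X (X x *m w i x)) -> flat_on D w.
Proof.
move=> sX sw uX dX i j x Dx.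
have E a b : pd a (pd b X) x = X x *m w a x *m w b x + X x *m pd a (w b) x.
  have d := is_derive_mulmx (dX x a Dx) (smooth_is_derive a (sw b) Dx).
  have d' : is_derive x (ev a) (pd b X) (X x *m w a x *m w b x + X x *m pd a (w b) x).
    apply: (eq_on_is_derive oD _ Dx d) => y Dy.
    by rewrite (pd_val (dX y b Dy)).
  exact: (pd_val d').
have P := etrans (esym (E i j)) (etrans (pd_mx_comm oD i j sX Dx) (E j i)).
move: P; move: (pd i (w j) x) (pd j (w i) x) (w i x) (w j x) => p q wi wj P.
apply: (can_inj (mulKmx (uX x Dx))); rewrite mulmx0 mulmxDr !mulmxBr !mulmxA.
move/eqP: P; rewrite -subr_eq0 => /eqP P.
by apply: etrans P; rewrite opprD [RHS]addrACA [LHS]addrC.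
Qed.

End assembly_tools.

(** * Constancy on the domain and derivatives of complex-valued maps *)

Section constancy.
Context {R : realType} {n : nat}.
Variable D : set 'rV[R]_n.
Hypothesis oD : open D.
Hypothesis scD : simply_connected D.
Hypothesis D0 : D 0.

Lemma constant_on_mx p q (M : 'rV[R]_n -> 'M[R]_(p, q)) :
  (forall x i, D x -> is_derive x (ev i) M 0) -> forall x, D x -> M x = M 0.
Proof.
move=> dM x Dx; apply/matrixP => a b.
apply: (constant_on oD scD (f := fun x => M x a b)) => // y i Dy.
have /is_derive_mxP/(_ a b) := dM y i Dy.
by rewrite mxE.
Qed.

Definition cderiv (x v : 'rV[R]_n) (h : 'rV[R]_n -> R[i]) (dh : R[i]) :=
  is_derive x v (fun y => complex.Re (h y)) (complex.Re dh) /\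
  is_derive x v (fun y => complex.Im (h y)) (complex.Im dh).

Lemma cderiv_cst x v (c : R[i]) : cderiv x v (fun _ => c) 0.
Proof. by split; exact: is_derive_cst. Qed.

Lemma cderiv_add x v h k dh dk : cderiv x v h dh -> cderiv x v k dk ->
  cderiv x v (fun y => h y + k y) (dh + dk).
Proof.
move=> [h1 h2] [k1 k2]; split.
- rewrite ReD; under eq_fun do rewrite ReD; exact: is_deriveD.
- rewrite ImD; under eq_fun do rewrite ImD; exact: is_deriveD.
Qed.

Lemma cderiv_eq x v h dh dk : cderiv x v h dh -> dh = dk -> cderiv x v h dk.
Proof. by move=> H <-. Qed.

Lemma cderiv_mul x v h k dh dk : cderiv x v h dh -> cderiv x v k dk ->
  cderiv x v (fun y => h y * k y) (dh * k x + h x * dk).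
Proof.
move=> [h1 h2] [k1 k2]; split.
- under eq_fun do rewrite ReM.
  have d := is_deriveB (is_derive_mul h1 k1) (is_derive_mul h2 k2).
  by apply: (is_derive_eq d); rewrite ReD !ReM; ring.
- under eq_fun do rewrite ImM.
  have d := is_deriveD (is_derive_mul h1 k2) (is_derive_mul h2 k1).
  by apply: (is_derive_eq d); rewrite ImD !ImM; ring.
Qed.

Lemma cderiv_sum (I : Type) (r : seq I) x v (h : I -> 'rV[R]_n -> R[i]) (dh : I -> R[i]) :
  (forall i, cderiv x v (h i) (dh i)) ->
  cderiv x v (fun y => \sum_(i <- r) h i y) (\sum_(i <- r) dh i).
Proof.
move=> H; elim: r => [|i r IH].
  rewrite big_nil; under eq_fun do rewrite big_nil; exact: cderiv_cst.
rewrite big_cons; under eq_fun do rewrite big_cons; exact: cderiv_add.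
Qed.

Lemma cderiv_constant (h : 'rV[R]_n -> R[i]) :
  (forall x i, D x -> cderiv x (ev i) h 0) -> forall x, D x -> h x = h 0.
Proof.
move=> dh x Dx; apply/eqP; rewrite eq_complex; apply/andP; split; apply/eqP.
  apply: (constant_on oD scD (f := fun x => complex.Re (h x))) => // y i Dy.
  by have [] := dh y i Dy.
apply: (constant_on oD scD (f := fun x => complex.Im (h x))) => // y i Dy.
by have [] := dh y i Dy.
Qed.

Lemma cderiv_mulmx p q r (A : 'rV[R]_n -> 'M[R[i]]_(p, q)) (B : 'rV[R]_n -> 'M[R[i]]_(q, r))
    x v (dA : 'M[R[i]]_(p, q)) (dB : 'M[R[i]]_(q, r)) :
  (forall a b, cderiv x v (fun y => A y a b) (dA a b)) ->
  (forall a b, cderiv x v (fun y => B y a b) (dB a b)) ->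
  forall a b, cderiv x v (fun y => (A y *m B y) a b) ((dA *m B x + A x *m dB) a b).
Proof.
move=> HA HB a b.
have d := cderiv_sum (index_enum 'I_q) (fun j => cderiv_mul (HA a j) (HB j b)).
under eq_fun do rewrite mxE.
by apply: (cderiv_eq d); rewrite !mxE -big_split.
Qed.

Lemma conjE (z : R[i]) : z^* = conjc z.
Proof. by []. Qed.

End constancy.

(** * The extended frame *)

Section series_frame.
Context {R : realType} {n p : nat}.
Variable D : set 'rV[R]_n.
Hypothesis oD : open D.
Variable kappa : 'I_n -> 'rV[R]_n -> 'M[R]_p.
Hypothesis smooth_kappa : forall i, smooth_on D (kappa i).
Variable Q : nat -> 'rV[R]_n -> 'M[R]_p.
Hypothesis Q_0 : Q 0%N = (fun _ => 1%:M).
Hypothesis Q_at0 : forall m, Q m.+1 0 = 0.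
Hypothesis derive_Q : forall m x i, D x ->
  is_derive x (ev i) (Q m.+1) (Q m x *m kappa i x).
Hypothesis growth_Q : forall x, D x -> forall rho, 0 < rho ->
  exists C, \forall y \near x, forall m, `|Q m y| * rho ^+ m <= C.
Variable S : 'rV[R]_n -> 'M[R]_p.
Hypothesis smooth_S : smooth_on D S.

(** An entry of Q_m S, with the smooth factor written first as [frame_mul] expects. *)
Definition frame_coef a b (m : nat) x : R := \sum_c S x c b * Q m x a c.

Definition series_frame x (l : R[i]) : 'M[R[i]]_p :=
  \matrix_(a, b) csum (frame_coef a b) x l.

Lemma series_frameE x l a b : series_frame x l a b = csum (frame_coef a b) x l.
Proof. exact: mxE. Qed.

Lemma frame_coefE a b m x : frame_coef a b m x = (Q m x *m S x) a b.
Proof. by rewrite mxE; apply: eq_bigr => c _; rewrite mulrC. Qed.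

Lemma frame_coef_seq a b : frame_seq D Q (frame_coef a b).
Proof.
apply: frame_sum => c; apply: frame_mul; last exact: frame_base.
by have /(smooth_mxP oD) := smooth_S; apply.
Qed.

Lemma series_frame_smooth : jointly_smooth D series_frame.
Proof.
have fc a b := frame_coef_seq a b.
apply: (smooth_pair (open_cyl oD)); apply/(smooth_mxP (open_cyl oD)) => a b.
- apply: (eq_smooth (open_cyl oD)
    (re_part_smooth oD smooth_kappa Q_0 derive_Q growth_Q (fc a b))) => z _.
  rewrite re_partE [RHS]mxE; congr complex.Re.
  exact: (esym (series_frameE (lsubmx z) (lam z) a b)).
- apply: (eq_smooth (open_cyl oD)
    (im_part_smooth oD smooth_kappa Q_0 derive_Q growth_Q (fc a b))) => z _.
  rewrite im_partE [RHS]mxE; congr complex.Im.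
  exact: (esym (series_frameE (lsubmx z) (lam z) a b)).
Qed.

Lemma series_frame_at0 x : series_frame x 0 = toC (S x).
Proof.
apply/matrixP => a b; rewrite series_frameE csum_at0 frame_coefE Q_0 mul1mx.
exact: (esym (mxE _ _ _ _)).
Qed.

(** All terms with m >= 1 vanish at the origin, so the initial value does not depend on lambda. *)
Lemma series_frame_base l : series_frame 0 l = toC (S 0).
Proof.
rewrite -series_frame_at0; apply/matrixP => a b.
rewrite (series_frameE 0 l a b) (series_frameE 0 0 a b) /csum.
have c0 m : frame_coef a b m.+1 0 = 0 by rewrite frame_coefE Q_at0 mul0mx mxE.
have e (h : R[i] -> R) : (fun m => h (l ^+ m) * frame_coef a b m 0) =
    (fun m => h (0 ^+ m) * frame_coef a b m 0).
  by apply/funext => m; case: m => [|m]; [rewrite !expr0|rewrite c0 !mulr0].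
by rewrite (e (@complex.Re R)) (e (@complex.Im R)).
Qed.

Lemma is_derive_series_frame x (l : R[i]) : D x ->
  is_derive (l : (R[i])^o) (1 : (R[i])^o) (series_frame x : (R[i])^o -> 'M[R[i]]_p)
    (\matrix_(a, b) dcsum (frame_coef a b) x l).
Proof.
move=> Dx; apply: is_derive_complex_mx => a b e e0.
have fq := frame_coef_seq a b.
have [r0 r1 i0 i1] := part_derive_rshift oD smooth_kappa Q_0 derive_Q growth_Q l fq Dx.
have sr := re_part_smooth oD smooth_kappa Q_0 derive_Q growth_Q fq.
have si := im_part_smooth oD smooth_kappa Q_0 derive_Q growth_Q fq.
have [d1 d1_gt0 H1] := part_expand oD sr Dx r0 r1 e0.
have [d2 d2_gt0 H2] := part_expand oD si Dx i0 i1 e0.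
exists (Num.min d1 d2); first by rewrite lt_min d1_gt0.
move=> h; rewrite !lt_min => /andP[ha1 ha2] /andP[hb1 hb2].
have := H1 h ha1 hb1; have := H2 h ha2 hb2.
have re_cpoint l' : re_part (frame_coef a b) (cpoint x l') =
    complex.Re (csum (frame_coef a b) x l').
  by rewrite re_partE lsubmx_cpoint lam_cpoint.
have im_cpoint l' : im_part (frame_coef a b) (cpoint x l') =
    complex.Im (csum (frame_coef a b) x l').
  by rewrite im_partE lsubmx_cpoint lam_cpoint.
rewrite (re_cpoint (l + h)) (re_cpoint l) (im_cpoint (l + h)) (im_cpoint l).
rewrite (series_frameE x (l + h)) (series_frameE x l) [X in h * X]mxE.
move: (csum _ _ (l + h)) (csum _ _ l) (dcsum _ _ _) => [u1 u2] [v1 v2] [t1 t2].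
case: h {ha1 ha2 hb1 hb2} => h1 h2 /= K2 K1; split.
- by apply: le_trans K1; rewrite le_eqVlt; apply/orP; left; apply/eqP; congr `|_|; ring.
- by apply: le_trans K2; rewrite le_eqVlt; apply/orP; left; apply/eqP; congr `|_|; ring.
Qed.

Lemma series_frame_conj x (l : R[i]) : D x ->
  map_mx (fun z => z^*) (series_frame x (l^*)) = series_frame x l.
Proof.
move=> Dx; apply/matrixP => a b; rewrite [LHS]mxE (series_frameE x l^*) (series_frameE x l).
rewrite [in LHS]conjE [l^*]conjE (csum_conj oD growth_Q l (frame_coef_seq a b) Dx).
exact: conjcK.
Qed.

(** Conjugation by a diagonal matrix of signs multiplies the (a, b) entry by u_a u_b; the hypothesis
    says that this sign is (-1)^m wherever the entry of Q_m S is nonzero. *)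
Lemma series_frame_neg (u : 'I_p -> R) x (l : R[i]) : D x ->
  (forall a, u a ^+ 2 = 1) ->
  (forall m a b, (Q m x *m S x) a b = u a * u b * (-1) ^+ m * (Q m x *m S x) a b) ->
  toC (diag_mx (\row_a u a)) *m series_frame x (- l) *m toC (diag_mx (\row_a u a)) =
  series_frame x l.
Proof.
move=> Dx u2 H; apply/matrixP => a b.
have E m : frame_coef a b m x = u a * u b * (-1) ^+ m * frame_coef a b m x.
  by rewrite frame_coefE; exact: H.
have N := csum_neg oD growth_Q l E (frame_coef_seq a b) Dx.
have tcd : toC (diag_mx (\row_a u a)) = diag_mx (\row_a Complex (u a) 0).
  apply/matrixP => c d; rewrite !mxE; case: eqP => _ //.
rewrite tcd mul_diag_mx mul_mx_diag [LHS]mxE [X in X * _]mxE (series_frameE x (- l)) (series_frameE x l) N.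
rewrite [X in X * _ * _]mxE [X in _ * X]mxE.
move: (csum _ _ _) => [v1 v2]; apply/eqP; rewrite eq_complex /=.
have ua := u2 a; have ub := u2 b; rewrite !expr2 in ua ub.
apply/andP; split; apply/eqP.
- transitivity ((u a * u a) * (u b * u b) * v1); first ring.
  by rewrite ua ub !mul1r.
- transitivity ((u a * u a) * (u b * u b) * v2); first ring.
  by rewrite ua ub !mul1r.
Qed.

Lemma shift_frame_coefE a c m x :
  shift_seq (frame_coef a c) m x = (if m is m'.+1 then Q m' x *m S x else 0) a c.
Proof. by case: m => [|m]; [rewrite mxE|exact: frame_coefE]. Qed.

(** Since kappa S = S K, one has d(Q_(m+1) S) = Q_(m+1) S T + Q_m S K. Multiplied by lambda^(m+1)
    and summed, the second term becomes lambda times the series times K; this is where the shift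
    enters. *)
Lemma series_frame_derive i (K : 'M[R]_p) (T : 'rV[R]_n -> 'M[R]_p) x l : D x ->
  smooth_on D T ->
  (forall y, D y -> is_derive y (ev i) S (S y *m T y)) ->
  (forall y, D y -> kappa i y *m S y = S y *m K) ->
  forall a b, cderiv x (ev i) (fun y => series_frame y l a b)
    ((series_frame x l *m (toC (T x) + l *: toC K)) a b).
Proof.
move=> Dx sT dS kS a b.
pose q' m y := \sum_c (T y c b * frame_coef a c m y + K c b * shift_seq (frame_coef a c) m y).
have fc c := frame_coef_seq a c.
have sTc c : smooth_on D (fun y => T y c b) by have /(smooth_mxP oD) := sT; apply.
have sKc c : smooth_on D (fun _ : 'rV[R]_n => K c b) by exact: smooth_cst.
have f1 c : frame_seq D Q (fun m y => T y c b * frame_coef a c m y).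
  exact: (frame_mul (sTc c) (fc c)).
have f2 c : frame_seq D Q (fun m y => K c b * shift_seq (frame_coef a c) m y).
  exact: (frame_mul (sKc c) (frame_shift (fc c))).
have Fq' : frame_seq D Q q'.
  by apply: frame_sum => c; exact: (frame_add (f1 c) (f2 c)).
have q'E m y : q' m y =
    (Q m y *m S y *m T y + (if m is m'.+1 then Q m' y *m S y else 0) *m K) a b.
  rewrite [RHS]mxE [X in X + _]mxE [X in _ + X]mxE -big_split; apply: eq_bigr => c _.
  by rewrite frame_coefE shift_frame_coefE mulrC [K c b * _]mulrC.
have dq m y : D y -> is_derive y (ev i) (frame_coef a b m) (q' m y).
  move=> Dy; have e : frame_coef a b m = (fun z => (Q m z *m S z) a b).
    by apply/funext => z; exact: frame_coefE.
  rewrite e q'E.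
  suff d : is_derive y (ev i) (fun z => Q m z *m S z)
      (Q m y *m S y *m T y + (if m is m'.+1 then Q m' y *m S y else 0) *m K).
    by have /is_derive_mxP/(_ a b) := d.
  case: m {e} => [|m].
    have e0 : (fun z => Q 0%N z *m S z) = S by apply/funext => z; rewrite Q_0 mul1mx.
    by rewrite e0; apply: (is_derive_eq (dS y Dy)); rewrite Q_0 mul1mx mul0mx addr0.
  have d := is_derive_mulmx (derive_Q m i Dy) (dS y Dy).
  apply: (is_derive_eq d); rewrite addrC mulmxA; congr (_ + _).
  by rewrite -!mulmxA kS.
have e : (fun y => series_frame y l a b) = (fun y => csum (frame_coef a b) y l).
  by apply/funext => y; exact: series_frameE.
have [d1 d2] := csum_derive oD smooth_kappa Q_0 derive_Q growth_Q l (fc b) Fq' dq Dx.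
have V : csum q' x l = (series_frame x l *m (toC (T x) + l *: toC K)) a b.
  have H := csum_sum oD growth_Q (index_enum 'I_p) l (fun c => frame_add (f1 c) (f2 c)) Dx.
  apply: (etrans H); rewrite [RHS]mxE; apply: eq_bigr => c _.
  rewrite (csumD oD growth_Q l (f1 c) (f2 c) Dx).
  rewrite (csumZ oD growth_Q (fun y => T y c b) l (fc c) Dx).
  rewrite (csumZ oD growth_Q (fun _ => K c b) l (frame_shift (fc c)) Dx).
  rewrite (csum_shift oD growth_Q l (fc c) Dx) (series_frameE x l a c).
  rewrite [X in _ = _ * X]mxE [X in _ = _ * (X + _)]mxE [X in _ = _ * (_ + X)]mxE.
  rewrite [X in _ = _ * (_ + _ * X)]mxE.
  move: (csum _ _ _) => z; rewrite mulrDr mulrC; congr (_ + _).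
  by rewrite mulrCA mulrA mulrC.
by rewrite e -V.
Qed.

End series_frame.

Lemma toCM {R : realType} p q r (M : 'M[R]_(p, q)) (N : 'M[R]_(q, r)) :
  toC (M *m N) = toC M *m toC N.
Proof. exact: (map_mxM (real_complex R) M N). Qed.

Lemma toC_tr {R : realType} p q (M : 'M[R]_(p, q)) : toC M^T = (toC M)^T.
Proof. by rewrite /toC map_trmx. Qed.

Lemma toCD {R : realType} p q (M N : 'M[R]_(p, q)) : toC (M + N) = toC M + toC N.
Proof. exact: (map_mxD (real_complex R) M N). Qed.

Lemma toC1 {R : realType} p : toC (1%:M : 'M[R]_p) = 1%:M.
Proof. exact: (map_mx1 (real_complex R)). Qed.

Lemma toC0 {R : realType} p q : toC (0 : 'M[R]_(p, q)) = 0.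
Proof. exact: (map_mx0 (real_complex R)). Qed.

Lemma toCN {R : realType} p q (M : 'M[R]_(p, q)) : toC (- M) = - toC M.
Proof. exact: (map_mxN (real_complex R) M). Qed.

Lemma toC_block {R : realType} p1 p2 q1 q2 (M1 : 'M[R]_(p1, q1)) (M2 : 'M[R]_(p1, q2))
    (M3 : 'M[R]_(p2, q1)) (M4 : 'M[R]_(p2, q2)) :
  toC (block_mx M1 M2 M3 M4) = block_mx (toC M1) (toC M2) (toC M3) (toC M4).
Proof. exact: map_block_mx. Qed.

Lemma cpd_cderiv {R : realType} {n p : nat} (H : 'rV[R]_n -> 'M[R[i]]_p) i x
    (dH : 'M[R[i]]_p) :
  (forall a b, cderiv x (ev i) (fun y => H y a b) (dH a b)) -> cpd i H x = dH.
Proof.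
move=> HH.
have d1 : is_derive x (ev i) (fun y => map_mx (@complex.Re R) (H y)) (map_mx (@complex.Re R) dH).
  apply/is_derive_mxP => a b; have [d _] := HH a b; rewrite mxE.
  by under eq_fun do rewrite mxE.
have d2 : is_derive x (ev i) (fun y => map_mx (@complex.Im R) (H y)) (map_mx (@complex.Im R) dH).
  apply/is_derive_mxP => a b; have [_ d] := HH a b; rewrite mxE.
  by under eq_fun do rewrite mxE.
rewrite /cpd (pd_val d1) (pd_val d2); apply/matrixP => a b; rewrite !mxE.
by case: (dH a b).
Qed.

Definition Ipm_sign {R : realType} n (a : 'I_(n + 1 + n)) : R :=
  (row_mx (const_mx 1) (const_mx (-1)) : 'rV_(n + 1 + n)) 0 a.

Lemma Ipm_diag {R : realType} n : Ipm n = diag_mx (\row_a Ipm_sign a) :> 'M[R]_(n + 1 + n).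
Proof.
have -> : \row_a Ipm_sign a = row_mx (const_mx 1) (const_mx (-1)) :> 'rV[R]_(n + 1 + n).
  by apply/rowP => a; rewrite mxE.
by rewrite diag_mx_row !diag_const_mx /Ipm -[(-1)%:M]scalemx1 scaleN1r.
Qed.

Lemma Ipm_sign_sq {R : realType} n (a : 'I_(n + 1 + n)) : Ipm_sign a ^+ 2 = 1 :> R.
Proof.
rewrite /Ipm_sign mxE; case: (fintype.split a) => b; rewrite mxE ?expr1n //.
by rewrite sqrrN expr1n.
Qed.

Lemma Ipm_sq {R : realType} n : Ipm n *m Ipm n = 1%:M :> 'M[R]_(n + 1 + n).
Proof.
by rewrite /Ipm mulmx_block !mulmx0 !mul0mx !addr0 !add0r mulmxN !mulmx1 opprK -scalar_mx_block.
Qed.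

(** * Integration of the frame data *)

Section frame_system.
Context {R : realType} {n k : nat}.
Variable D : set 'rV[R]_n.
Hypothesis oD : open D.
Hypothesis scD : simply_connected D.
Hypothesis D0 : D 0.
Variables (A : 'rV[R]_n -> 'M[R]_(n + 1)) (W F : 'rV[R]_n -> 'M[R]_n)
  (g : 'rV[R]_n -> 'cV[R]_n) (X : 'rV[R]_n -> 'M[R]_(n + 1, n)).
Hypotheses (sA : smooth_on D A) (sW : smooth_on D W) (sX : smooth_on D X).
Hypothesis A_orth : forall x, D x -> (A x)^T *m A x = 1%:M.
Hypothesis W_unit : forall x, D x -> W x \in unitmx.
Hypothesis dA : forall x i, D x -> is_derive x (ev i) A (A x *m omega_i n k (F x) (g x) i).
Hypothesis dW : forall x i, D x -> is_derive x (ev i) W (- tau_i n k (F x) i *m W x).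
Hypothesis dX : forall x i, D x ->
  is_derive x (ev i) X (A x *m col_mx (Eii i) 0 *m Jm n k *m W x).
Hypothesis X0 : X 0 = 0.
Notation J := (Jm n k).

Lemma J_tr : J^T = J :> 'M[R]_n.
Proof. exact: tr_diag_mx. Qed.

Lemma J_sq : J *m J = 1%:M :> 'M[R]_n.
Proof. by have := JmK (k := k) (1%:M : 'M[R]_n); rewrite mulmx1. Qed.

Lemma Eii_tr (i : 'I_n) : (Eii i : 'M[R]_n)^T = Eii i.
Proof. by rewrite trmx_delta. Qed.

Definition tau_core x i : 'M[R]_n := F x *m Eii i - Eii i *m (F x)^T.

Lemma tau_core_skew x i : (tau_core x i)^T = - tau_core x i.
Proof. by rewrite /tau_core linearB /= !trmx_mul trmxK Eii_tr opprB. Qed.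

Lemma tau_skew x i : tau_i n k (F x) i *m J + J *m (tau_i n k (F x) i)^T = 0.
Proof.
rewrite /tau_i -/(tau_core x i) trmx_mul J_tr tau_core_skew -mulmxA J_sq mulmx1.
by rewrite mulmxA J_sq mul1mx subrr.
Qed.

Lemma omega_skew x i : omega_i n k (F x) (g x) i + (omega_i n k (F x) (g x) i)^T = 0.
Proof.
have e q (M : 'M[R]_(n, q)) : (Eii i *m J *m M)^T = M^T *m J *m Eii i.
  by rewrite !trmx_mul Eii_tr J_tr mulmxA.
have e' q (M : 'M[R]_(n, q)) : (M^T *m J *m Eii i)^T = Eii i *m J *m M.
  by rewrite -e trmxK.
rewrite /omega_i tr_block_mx trmx0 add_block_mx addr0 linearD /= !linearN /= !e !e'.
by rewrite addNr subrr addrA addrK addNr block_mx0.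
Qed.

Lemma smooth_cstmul p q r (M : 'M[R]_(p, q)) (H : 'rV[R]_n -> 'M[R]_(q, r)) :
  smooth_on D H -> smooth_on D (fun x => M *m H x).
Proof. by move=> sH; exact: (smooth_mulmx oD (smooth_cst oD M) sH). Qed.

Lemma smooth_mulcst p q r (H : 'rV[R]_n -> 'M[R]_(p, q)) (M : 'M[R]_(q, r)) :
  smooth_on D H -> smooth_on D (fun x => H x *m M).
Proof. by move=> sH; exact: (smooth_mulmx oD sH (smooth_cst oD M)). Qed.

(* [Binv] preserves the form J, so that [B] is its inverse. *)
Definition Binv x := W x *m invmx (W 0).
Definition B x := J *m (Binv x)^T *m J.

Lemma Binv_derive x i : D x -> is_derive x (ev i) Binv (- tau_i n k (F x) i *m Binv x).
Proof.
move=> Dx; have d := is_derive_mulmx (dW i Dx) (is_derive_cst (invmx (W 0)) x (ev i)).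
by apply: (is_derive_eq d); rewrite mulmx0 addr0 /Binv mulmxA.
Qed.

Lemma Binv0 : Binv 0 = 1%:M.
Proof. exact: mulmxV (W_unit D0). Qed.

Lemma smooth_Binv : smooth_on D Binv.
Proof. exact: smooth_mulcst. Qed.

Lemma smooth_B : smooth_on D B.
Proof. by apply: smooth_mulcst; apply: smooth_cstmul; exact: (smooth_trmx oD smooth_Binv). Qed.

(** The coefficient tau lies in the Lie algebra of the form J, so the expression has zero
    derivative, and at the origin [Binv] is the identity. *)
Lemma Binv_form x : D x -> (Binv x)^T *m J *m Binv x = J.
Proof.
suff H x' i : D x' -> is_derive x' (ev i) (fun y => (Binv y)^T *m J *m Binv y) 0.
  move=> Dx; have /= -> := constant_on_mx oD scD D0 H Dx.
  by rewrite Binv0 trmx1 mul1mx mulmx1.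
move: x' => y Dy; have d := Binv_derive i Dy.
have d1 := is_derive_mulmx (is_derive_mulmx (is_derive_trmx d) (is_derive_cst J y (ev i))) d.
apply: (is_derive_eq d1); rewrite mulmx0 addr0 trmx_mul.
have E : (- tau_i n k (F y) i)^T *m J + J *m (- tau_i n k (F y) i) = 0.
  rewrite /tau_i -/(tau_core y i) linearN /= trmx_mul J_tr tau_core_skew.
  by rewrite !mulmxN !mulNmx opprK mulmxA subrr.
transitivity ((Binv y)^T *m ((- tau_i n k (F y) i)^T *m J + J *m (- tau_i n k (F y) i)) *m Binv y).
  by rewrite mulmxDr mulmxDl !mulmxA.
by rewrite E mulmx0 mul0mx.
Qed.

Lemma B_Binv x : D x -> B x *m Binv x = 1%:M.
Proof. by move=> Dx; rewrite /B -!mulmxA [(Binv x)^T *m _]mulmxA Binv_form // J_sq. Qed.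

Lemma B_derive x i : D x -> is_derive x (ev i) B (B x *m tau_i n k (F x) i).
Proof.
move=> Dx; have d := is_derive_trmx (Binv_derive i Dx).
have d1 := is_derive_mulmx (is_derive_mulmx (is_derive_cst J x (ev i)) d)
  (is_derive_cst J x (ev i)).
apply: (is_derive_eq d1); rewrite mulmx0 addr0 mul0mx add0r trmx_mul /B -!mulmxA.
congr (_ *m (_ *m _)); rewrite /tau_i -/(tau_core x i) linearN /= trmx_mul J_tr tau_core_skew.
by rewrite mulmxN opprK mulmxA.
Qed.

Definition E0 x : 'M[R]_(n + 1 + n) := block_mx (A x) 0 0 (B x).
Definition E0inv x : 'M[R]_(n + 1 + n) := block_mx (A x)^T 0 0 (Binv x).
Definition theta0 i x : 'M[R]_(n + 1 + n) :=
  block_mx (omega_i n k (F x) (g x) i) 0 0 (tau_i n k (F x) i).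
Definition Kmx (i : 'I_n) : 'M[R]_(n + 1 + n) :=
  block_mx 0 (- (col_mx (Eii i) 0 *m J)) (row_mx (Eii i) 0) 0.

Lemma E0K x : D x -> E0 x *m E0inv x = 1%:M.
Proof.
move=> Dx; rewrite /E0 /E0inv mulmx_block !mulmx0 !mul0mx !addr0 !add0r.
by rewrite (mulmx1C (A_orth Dx)) B_Binv // -scalar_mx_block.
Qed.

Lemma E0invK x : D x -> E0inv x *m E0 x = 1%:M.
Proof. by move=> Dx; exact: (mulmx1C (E0K Dx)). Qed.

Lemma is_derive_block p1 p2 q1 q2 (M1 : 'rV[R]_n -> 'M[R]_(p1, q1))
    (M2 : 'rV[R]_n -> 'M[R]_(p1, q2)) (M3 : 'rV[R]_n -> 'M[R]_(p2, q1))
    (M4 : 'rV[R]_n -> 'M[R]_(p2, q2)) x v d1 d2 d3 d4 :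
  is_derive x v M1 d1 -> is_derive x v M2 d2 -> is_derive x v M3 d3 ->
  is_derive x v M4 d4 ->
  is_derive x v (fun y => block_mx (M1 y) (M2 y) (M3 y) (M4 y)) (block_mx d1 d2 d3 d4).
Proof.
move=> /is_derive_mxP H1 /is_derive_mxP H2 /is_derive_mxP H3 /is_derive_mxP H4.
apply/is_derive_mxP => a b; rewrite -(splitK a) -(splitK b).
case: (fintype.split a) => {}a; case: (fintype.split b) => {}b /=.
- by rewrite block_mxEul; under eq_fun do rewrite block_mxEul.
- by rewrite block_mxEur; under eq_fun do rewrite block_mxEur.
- by rewrite block_mxEdl; under eq_fun do rewrite block_mxEdl.
- by rewrite block_mxEdr; under eq_fun do rewrite block_mxEdr.
Qed.

Lemma smooth_block p1 p2 q1 q2 (M1 : 'rV[R]_n -> 'M[R]_(p1, q1))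
    (M2 : 'rV[R]_n -> 'M[R]_(p1, q2)) (M3 : 'rV[R]_n -> 'M[R]_(p2, q1))
    (M4 : 'rV[R]_n -> 'M[R]_(p2, q2)) :
  smooth_on D M1 -> smooth_on D M2 -> smooth_on D M3 -> smooth_on D M4 ->
  smooth_on D (fun y => block_mx (M1 y) (M2 y) (M3 y) (M4 y)).
Proof.
move=> /(smooth_mxP oD) H1 /(smooth_mxP oD) H2 /(smooth_mxP oD) H3 /(smooth_mxP oD) H4.
apply/(smooth_mxP oD) => a b; rewrite -(splitK a) -(splitK b).
case: (fintype.split a) => {}a; case: (fintype.split b) => {}b /=.
- by apply: (eq_smooth oD (H1 a b)) => x _; rewrite block_mxEul.
- by apply: (eq_smooth oD (H2 a b)) => x _; rewrite block_mxEur.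
- by apply: (eq_smooth oD (H3 a b)) => x _; rewrite block_mxEdl.
- by apply: (eq_smooth oD (H4 a b)) => x _; rewrite block_mxEdr.
Qed.

Lemma smooth_E0 : smooth_on D E0.
Proof.
by apply: smooth_block; [exact: sA|exact: smooth_cst|exact: smooth_cst|exact: smooth_B].
Qed.

Lemma smooth_E0inv : smooth_on D E0inv.
Proof.
apply: smooth_block; [exact: (smooth_trmx oD sA)|exact: smooth_cst|exact: smooth_cst|].
exact: smooth_Binv.
Qed.

Lemma E0_derive x i : D x -> is_derive x (ev i) E0 (E0 x *m theta0 i x).
Proof.
move=> Dx; have d := is_derive_block (dA i Dx) (is_derive_cst 0 x (ev i))
  (is_derive_cst 0 x (ev i)) (B_derive i Dx).
apply: (is_derive_eq d).
by rewrite /E0 /theta0 mulmx_block !mulmx0 !mul0mx !addr0 !add0r.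
Qed.

Lemma smooth_theta0 i : smooth_on D (theta0 i).
Proof.
apply: (eq_smooth oD (smooth_mulmx oD smooth_E0inv (smooth_pd i smooth_E0))) => x Dx.
by rewrite (pd_val (E0_derive i Dx)) mulmxA E0invK // mul1mx.
Qed.

Lemma smooth_omega i : smooth_on D (fun x => omega_i n k (F x) (g x) i).
Proof.
apply: (eq_smooth oD (smooth_mulmx oD (smooth_trmx oD sA) (smooth_pd i sA))) => x Dx.
by rewrite (pd_val (dA i Dx)) mulmxA A_orth // mul1mx.
Qed.

Lemma smooth_tau i : smooth_on D (fun x => tau_i n k (F x) i).
Proof.
apply: (eq_smooth oD (smooth_mulmx oD smooth_Binv (smooth_pd i smooth_B))) => x Dx.
by rewrite (pd_val (B_derive i Dx)) mulmxA (mulmx1C (B_Binv Dx)) mul1mx.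
Qed.

Lemma omega_flat : flat_on D (fun i x => omega_i n k (F x) (g x) i).
Proof.
apply: (flat_of_frame oD sA smooth_omega) => // x Dx.
by have := A_orth Dx => /mulmx1_unit[].
Qed.

Lemma tau_flat : flat_on D (fun i x => tau_i n k (F x) i).
Proof.
apply: (flat_of_frame oD smooth_B smooth_tau); last exact: B_derive.
by move=> x Dx; have := B_Binv Dx => /mulmx1_unit[].
Qed.

Definition Ymx x : 'M[R]_(n + 1, n) := - (X x *m invmx (W 0)).
Definition Zmx x : 'M[R]_(n + 1 + n) := block_mx 0 (Ymx x) (- (J *m (Ymx x)^T)) 0.
Definition kappa i x : 'M[R]_(n + 1 + n) := E0 x *m Kmx i *m E0inv x.

Lemma kappaE i x : kappa i x =
  block_mx 0 (- (A x *m col_mx (Eii i) 0 *m J *m Binv x))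
           (B x *m row_mx (Eii i) 0 *m (A x)^T) 0.
Proof.
rewrite /kappa /E0 /E0inv /Kmx !mulmx_block !mulmx0 !mul0mx !addr0 !add0r.
by rewrite mulmxN mulNmx !mulmxA !mul0mx.
Qed.

Lemma Zmx_derive x i : D x -> is_derive x (ev i) Zmx (kappa i x).
Proof.
move=> Dx.
have dY : is_derive x (ev i) Ymx (- (A x *m col_mx (Eii i) 0 *m J *m Binv x)).
  have d := is_derive_mulmx (dX i Dx) (is_derive_cst (invmx (W 0)) x (ev i)).
  apply: (is_derive_eq (is_deriveN d)).
  by rewrite mulmx0 addr0 /Binv !mulmxA.
have d2 := is_deriveN (is_derive_mulmx (is_derive_cst J x (ev i)) (is_derive_trmx dY)).
have d := is_derive_block (is_derive_cst 0 x (ev i)) dY d2 (is_derive_cst 0 x (ev i)).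
apply: (is_derive_eq d); rewrite kappaE; congr block_mx.
rewrite mul0mx add0r linearN /= mulmxN opprK !trmx_mul J_tr tr_col_mx trmx0 Eii_tr.
by rewrite /B /Binv trmx_mul !mulmxA.
Qed.

Lemma Zmx0 : Zmx 0 = 0.
Proof. by rewrite /Zmx /Ymx X0 mul0mx oppr0 trmx0 mulmx0 oppr0 block_mx0. Qed.

Lemma smooth_Kappa i : smooth_on D (kappa i).
Proof. exact: (smooth_mulmx oD (smooth_mulcst (Kmx i) smooth_E0) smooth_E0inv). Qed.

Lemma smooth_Z : smooth_on D Zmx.
Proof.
have sY : smooth_on D Ymx.
  have s := smooth_mulcst (- invmx (W 0)) sX.
  by apply: (eq_smooth oD s) => x _; rewrite mulmxN.
apply: smooth_block; [exact: smooth_cst|exact: sY| |exact: smooth_cst].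
have s := smooth_cstmul (- J) (smooth_trmx oD sY).
by apply: (eq_smooth oD s) => x _; rewrite mulNmx.
Qed.

Lemma closed_kappa i j x : D x -> pd i (kappa j) x = pd j (kappa i) x.
Proof.
move=> Dx.
have E a b : pd a (kappa b) x = pd a (pd b Zmx) x.
  by apply: (eq_on_pd oD a _ Dx) => y Dy; rewrite (pd_val (Zmx_derive b Dy)).
exact: (etrans (E i j) (etrans (pd_mx_comm oD i j smooth_Z Dx) (esym (E j i)))).
Qed.

(** Products of distinct diagonal matrix units vanish, also with the diagonal J between them. *)
Lemma Kmx_mul i j : i != j -> Kmx i *m Kmx j = 0.
Proof.
move=> ij.
have e1 : Eii i *m J *m Eii j = 0 :> 'M[R]_n.
  rewrite -mulmxA Eii_mul Jm_mul; apply/matrixP => a b.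
  by rewrite !mxE (negbTE ij) /= !mulr0.
have e2 : Eii i *m Eii j = 0 :> 'M[R]_n.
  by rewrite Eii_mul; apply/matrixP => a b; rewrite !mxE (negbTE ij) /= mulr0.
rewrite /Kmx mulmx_block !mulmx0 !mul0mx !addr0 !add0r.
rewrite mulNmx -mulmxA mulmxN [row_mx _ _ *m _]mulmxA mul_row_col mulmx0 addr0 e2 mul0mx oppr0.
have -> : col_mx (Eii i) 0 *m (J *m row_mx (Eii j) 0) = 0 :> 'M[R]_(n + 1).
  by rewrite mul_mx_row mulmx0 mul_col_row mulmxA e1 !mulmx0 !mul0mx block_mx0.
by rewrite oppr0 block_mx0.
Qed.

Lemma comm_kappa i j x : D x -> kappa i x *m kappa j x = kappa j x *m kappa i x.
Proof.
move=> Dx; have [->//|ij] := eqVneq i j.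
have E a b : kappa a x *m kappa b x = E0 x *m (Kmx a *m Kmx b) *m E0inv x.
  by rewrite /kappa -!mulmxA [E0inv x *m _]mulmxA E0invK // mul1mx.
by rewrite !E !Kmx_mul // eq_sym.
Qed.

(** Membership in the Lie algebra of the form G, in the transposed version: since dE = E theta, the
    expression whose derivative closes up is E G E^T. *)
Lemma G_form (i : 'I_n) : Kmx i *m Gm n k + Gm n k *m (Kmx i)^T = 0.
Proof.
rewrite /Kmx /Gm tr_block_mx !mulmx_block !trmx0 !mulmx0 !mul0mx !addr0 !add0r.
rewrite !mulmx1 !mul1mx mulNmx -mulmxA J_sq mulmx1 linearN /= trmx_mul J_tr mulmxN mulmxA J_sq mul1mx.
rewrite tr_col_mx tr_row_mx trmx0 Eii_tr trmx0 add_block_mx addr0 addr0.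
by rewrite addNr subrr block_mx0.
Qed.

Lemma theta0_form i x : theta0 i x *m Gm n k + Gm n k *m (theta0 i x)^T = 0.
Proof.
rewrite /theta0 /Gm tr_block_mx !mulmx_block !trmx0 !mulmx0 !mul0mx !addr0 !add0r.
by rewrite !mulmx1 !mul1mx add_block_mx omega_skew tau_skew !addr0 block_mx0.
Qed.

Lemma theta_split i x (l : R[i]) :
  theta_i n k (F x) (g x) l i = toC (theta0 i x) + l *: toC (Kmx i).
Proof.
rewrite /theta_i /theta0 /Kmx; move: (omega_i _ _ _ _ _) (tau_i _ _ _ _) => u v.
rewrite !toC_block !toC0 toCN scale_block_mx add_block_mx.
by rewrite !scaler0 !addr0 !add0r scalerN scaleNr.
Qed.

Lemma theta_form i x (l : R[i]) :
  theta_i n k (F x) (g x) l i *m toC (Gm n k) +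
  toC (Gm n k) *m (theta_i n k (F x) (g x) l i)^T = 0.
Proof.
rewrite theta_split mulmxDl linearD /= linearZ /= mulmxDr -scalemxAl -scalemxAr.
rewrite -!toC_tr -!toCM addrACA -toCD theta0_form toC0 add0r -scalerDr -toCD.
by rewrite G_form toC0 scaler0.
Qed.

Lemma E0_base : E0 0 *m Gm n k *m (E0 0)^T = Gm n k.
Proof.
have B0 : B 0 = 1%:M by rewrite /B Binv0 trmx1 mulmx1 J_sq.
rewrite /E0 /Gm B0 tr_block_mx !mulmx_block !trmx0 trmx1.
rewrite !mulmx0 !mul0mx !addr0 !add0r !mulmx1 !mul1mx.
by rewrite (mulmx1C (A_orth D0)) mul0mx.
Qed.

Lemma Gm_sq : Gm n k *m Gm n k = 1%:M :> 'M[R]_(n + 1 + n).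
Proof.
by rewrite /Gm mulmx_block !mulmx0 !mul0mx !addr0 !add0r mul1mx J_sq -scalar_mx_block.
Qed.

Lemma Ipm_E0 x : Ipm n *m E0 x *m Ipm n = E0 x.
Proof.
rewrite /Ipm /E0 !mulmx_block !(mulmx0, mul0mx, addr0, add0r, mul1mx, mulmx1).
by rewrite mulNmx mulmxN mul1mx mulmx1 opprK.
Qed.

Lemma Ipm_kappa i x : Ipm n *m kappa i x *m Ipm n = - kappa i x.
Proof.
rewrite kappaE; move: (- (A x *m _ *m _ *m _)) (B x *m _ *m _) => M N.
rewrite /Ipm !mulmx_block !(mulmx0, mul0mx, addr0, add0r, mul1mx, mulmx1).
by rewrite mulNmx mulmxN mul1mx mulmx1 opp_block_mx !oppr0.
Qed.

Lemma extended_frame_exists : exists E, extended_frame n k D F g E /\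
  forall x, D x -> dE_dlambda0 (E x) *m invmx (E x 0) = toC (Zmx x).
Proof.
have [Q [Q0 sQ Q00 dQ]] := iterated_integrals oD scD D0 smooth_Kappa closed_kappa comm_kappa.
have gQ x : D x -> forall rho : R, 0 < rho ->
    exists C : R, \forall y \near x, forall m, `|Q m y| * rho ^+ m <= C.
  move=> Dx rho r0; have [r rp [_ H]] := growth oD scD D0 smooth_Kappa Q0 Q00 sQ dQ Dx.
  have [C HC] := H rho r0; exists C.
  by apply: filterS (nbhsx_ballx x r rp) => y By; exact: (HC y By).
(* Both maps have differential kappa and vanish at the origin. *)
have Q1 x : D x -> Q 1%N x = Zmx x.
  move=> Dx; apply/eqP; rewrite -subr_eq0; apply/eqP.
  have H y i : D y -> is_derive y (ev i) (fun y => Q 1%N y - Zmx y) 0.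
    move=> Dy; have d := is_deriveB (dQ 0%N y i Dy) (Zmx_derive i Dy).
    by apply: (is_derive_eq d); rewrite Q0 mul1mx subrr.
  have /= -> := constant_on_mx oD scD D0 H Dx.
  by rewrite Q00 Zmx0 subrr.
(* Conjugation by [Ipm] changes the sign of kappa, hence contributes one sign per integration. *)
have par m x : D x -> Ipm n *m Q m x *m Ipm n = (-1) ^+ m *: Q m x.
  elim: m x => [|m IH] x Dx; first by rewrite Q0 mulmx1 Ipm_sq scale1r.
  apply/eqP; rewrite -subr_eq0; apply/eqP.
  have H y i : D y -> is_derive y (ev i)
      (fun y => Ipm n *m Q m.+1 y *m Ipm n - (-1) ^+ m.+1 *: Q m.+1 y) 0.
    move=> Dy; have d := dQ m y i Dy.
    have d1 := is_derive_mulmx (is_derive_mulmx (is_derive_cst (Ipm n) y (ev i)) d)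
      (is_derive_cst (Ipm n) y (ev i)).
    have d2 := is_derive_scale (is_derive_cst ((-1) ^+ m.+1 : R) y (ev i)) d.
    apply: (is_derive_eq (is_deriveB d1 d2)).
    rewrite mul0mx add0r mulmx0 addr0 scale0r ?addr0 ?add0r.
    have -> : Ipm n *m (Q m y *m kappa i y) *m Ipm n =
        (Ipm n *m Q m y *m Ipm n) *m (Ipm n *m kappa i y *m Ipm n).
      by rewrite !mulmxA -[_ *m Ipm n *m Ipm n]mulmxA Ipm_sq mulmx1.
    by rewrite IH // Ipm_kappa mulmxN -scalemxAl exprS mulN1r scaleNr subrr.
  have /= -> := constant_on_mx oD scD D0 H Dx.
  by rewrite Q00 mulmx0 mul0mx scaler0 subrr.
pose E := series_frame Q E0.
have dE x l i : D x -> forall a b, cderiv x (ev i) (fun y => E y l a b)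
    ((E x l *m theta_i n k (F x) (g x) l i) a b).
  move=> Dx; rewrite theta_split.
  apply: (series_frame_derive oD smooth_Kappa Q0 dQ gQ smooth_E0 l Dx (smooth_theta0 i)).
    by move=> y Dy; exact: E0_derive.
  by move=> y Dy; rewrite /kappa -[LHS]mulmxA E0invK // mulmx1.
(* E G E^T is constant because theta G + G theta^T = 0, and it equals G at the origin. *)
have EGE x l : D x -> E x l *m toC (Gm n k) *m (E x l)^T = toC (Gm n k).
  move=> Dx; have base : E 0 l *m toC (Gm n k) *m (E 0 l)^T = toC (Gm n k).
    by rewrite /E series_frame_base // -toC_tr -!toCM E0_base.
  rewrite -[RHS]base; apply/matrixP => a b.
  apply: (cderiv_constant oD scD D0 (h := fun y =>
    (E y l *m toC (Gm n k) *m (E y l)^T) a b) _ Dx) => y i Dy.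
  pose dEy := E y l *m theta_i n k (F y) (g y) l i.
  have dtr c d : cderiv y (ev i) (fun z => (E z l)^T c d) (dEy^T c d).
    have e : (fun z => (E z l)^T c d) = (fun z => E z l d c).
      by apply/funext => z; exact: mxE.
    by rewrite e [X in cderiv _ _ _ X]mxE; exact: (dE y l i Dy d c).
  have dG c d : cderiv y (ev i) (fun z => toC (Gm n k) c d) ((0 : 'M[R[i]]_(n + 1 + n)) c d).
    by rewrite [X in cderiv _ _ _ X]mxE; exact: cderiv_cst.
  have := cderiv_mulmx (cderiv_mulmx (dE y l i Dy) dG) dtr a b.
  move/cderiv_eq; apply.
  rewrite mulmx0 addr0 /dEy trmx_mul -!mulmxA -mulmxDr [toC _ *m (_ *m _)]mulmxA.
  by rewrite [_ *m (toC _ *m _)]mulmxA -mulmxDl theta_form mul0mx mulmx0 mxE.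
have GG : toC (Gm n k) *m toC (Gm n k) = 1%:M :> 'M[R[i]]_(n + 1 + n).
  by rewrite -toCM Gm_sq toC1.
have EG x l : D x -> E x l *m (toC (Gm n k) *m (E x l)^T *m toC (Gm n k)) = 1%:M.
  by move=> Dx; rewrite !mulmxA EGE.
(* The relation with the transpose on the other side: G E^T G is a right inverse of E, hence also a
   left inverse, and G squares to the identity. *)
have EtGE x l : D x -> (E x l)^T *m toC (Gm n k) *m E x l = toC (Gm n k).
  move=> Dx; have := congr1 (mulmx (toC (Gm n k))) (mulmx1C (EG x l Dx)).
  by rewrite !mulmxA GG mul1mx mulmx1.
have uE x l : D x -> E x l \in unitmx by move=> /(EG x l)/mulmx1_unit[].
have dl x l : D x -> is_derive (l : (R[i])^o) (1 : (R[i])^o) (E x : (R[i])^o -> 'M[R[i]]_(n + 1 + n))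
    (\matrix_(a, b) dcsum (frame_coef Q E0 a b) x l).
  by move=> Dx; exact: (is_derive_series_frame oD smooth_Kappa Q0 dQ gQ smooth_E0 l Dx).
exists E; split.
  split; first exact: (series_frame_smooth oD smooth_Kappa Q0 dQ gQ smooth_E0).
  split; first by move=> x Dx l; have [d _] := dl x l Dx; exact: d.
  move=> x l Dx; split; first exact: (EtGE x l Dx).
  split.
    by move=> i; rewrite (cpd_cderiv (dE x l i Dx)) mulKmx // uE.
  split; first exact: (series_frame_conj oD gQ smooth_E0 l Dx).
  have -> : invmx (toC (Ipm n)) = toC (Ipm n) :> 'M[R[i]]_(n + 1 + n).
    have H : toC (Ipm n) *m toC (Ipm n) = 1%:M :> 'M[R[i]]_(n + 1 + n).
      by rewrite -toCM Ipm_sq toC1.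
    have [u _] := mulmx1_unit H.
    by rewrite -[LHS]mulmx1 -H mulKmx.
  rewrite Ipm_diag; apply: (series_frame_neg oD gQ smooth_E0 l Dx).
    exact: Ipm_sign_sq.
  move=> m a b.
  have H : Ipm n *m (Q m x *m E0 x) *m Ipm n = (-1) ^+ m *: (Q m x *m E0 x).
    rewrite -{1}(Ipm_E0 x) !mulmxA -[_ *m Ipm n *m Ipm n]mulmxA Ipm_sq mulmx1.
    by rewrite par // scalemxAl.
  move: (Q m x *m E0 x) H => M H.
  have := congr1 (fun N : 'M[R]_(n + 1 + n) => N a b) H.
  rewrite Ipm_diag mul_diag_mx mul_mx_diag !mxE -/(Ipm_sign a) -/(Ipm_sign b) => Hab.
  transitivity ((-1) ^+ m * (Ipm_sign a * M a b * Ipm_sign b)); last by ring.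
  by rewrite Hab mulrA -expr2 sqrr_sign mul1r.
move=> x Dx.
(* Only the linear term of the series contributes at lambda = 0, while E(x, 0) = E_0, so E_0 cancels
   and Q_1 = Z remains. *)
have -> : dE_dlambda0 (E x) = toC (Q 1%N x *m E0 x).
  have [_ d] := dl x 0 Dx; rewrite /dE_dlambda0 d; apply/matrixP => a b.
  by rewrite [LHS]mxE dcsum_at0 frame_coefE [RHS]mxE.
have u0 := uE x 0 Dx.
have e0 : E x 0 = toC (E0 x) by exact: series_frame_at0.
by rewrite toCM -e0 mulmxK // Q1.
Qed.

End frame_system.

Theorem theorem4p3 (R : realType) (n k : nat)
  (hn : (2 <= n)%N) (hk1 : (1 <= k)%N) (hk2 : (k <= n - 1)%N)
  (D : set 'rV[R]_n) (f : 'I_n -> 'rV[R]_n -> 'cV[R]_(n + 1)) :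
  open D -> simply_connected D -> D 0 ->
  combescure_seq n k D f ->
  (forall i, f i 0 = 0) ->
  exists (F : 'rV[R]_n -> 'M[R]_n) (g : 'rV[R]_n -> 'cV[R]_n)
         (E : 'rV[R]_n -> R[i] -> 'M[R[i]]_(n + 1 + n))
         (c : 'I_n -> 'cV[R]_n) (Y : 'rV[R]_n -> 'M[R]_(n + 1, n)),
    solves_system n k D F g /\
    extended_frame n k D F g E /\
    null_basis n k c /\
    (forall x, D x ->
       dE_dlambda0 (E x) *m invmx (E x 0) =
       toC (block_mx 0 (Y x) (- (Jm n k *m (Y x)^T)) 0)) /\
    (forall (l : 'I_n) x, D x -> f l x = Y x *m c l).
Proof.
move=> oD scD D0 comb f0.
have i0_0 : Ordinal (ltnW hn) = 0%N :> nat by [].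
have [A [W [F [g [[sA sW sF sg] F_diag frame derive]]]]] := combescure_frame oD comb i0_0.
pose X x : 'M[R]_(n + 1, n) := \matrix_(r, l) f l x r 0.
have X0 : X 0 = 0 by apply/matrixP => r l; rewrite mxE f0 !mxE.
have sX : smooth_on D X.
  apply/(smooth_mxP oD) => r l; have /(smooth_mxP oD)/(_ r 0) s := comb_smooth comb l.
  by apply: (eq_smooth oD s) => x _; rewrite mxE.
have A_orth x : D x -> (A x)^T *m A x = 1%:M by move=> /frame[].
have W_unit x : D x -> W x \in unitmx by move=> /frame[_ []].
have dA x i : D x -> is_derive x (ev i) A (A x *m omega_i n k (F x) (g x) i).
  by move=> /derive-/(_ i)[].
have dW x i : D x -> is_derive x (ev i) W (- tau_i n k (F x) i *m W x).
  by move=> /derive-/(_ i)[].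
have dX x i : D x -> is_derive x (ev i) X (A x *m col_mx (Eii i) 0 *m Jm n k *m W x).
  by move=> /derive-/(_ i)[].
have [E [EF EY]] := extended_frame_exists oD scD D0 sA sW sX A_orth W_unit dA dW dX X0.
have u0 := W_unit 0 D0.
(* With Y = - X W(0)^-1, the sign of c_l cancels that of Y and leaves column [l] of X, which is
   f_l. *)
exists F, g, E, (fun l => - col l (W 0)), (Ymx W X); split; last split; last split.
- split=> //; split=> //; split; first by move=> x _ i; exact: F_diag.
  split; first exact: (omega_flat oD sA A_orth dA).
  exact: (tau_flat oD scD D0 sW W_unit dW).
- exact: EF.
- split.
    move=> l /=; have [_ [_ /(_ l)]] := frame 0 D0.
    move: (col l (W 0)) => v; have -> : (- v)^T = - v^T by apply/rowP => j; rewrite !mxE.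
    by rewrite mulmxN !mulNmx opprK.
  have -> : \matrix_(l < n) (- col l (W 0))^T = - (W 0)^T.
    by apply/matrixP => a b; rewrite !mxE.
  have u : - (W 0)^T \in unitmx by rewrite -scaleN1r unitmxZ ?unitrN1 // unitmx_tr.
  by rewrite row_free_unit row_full_unit.
- split; first by move=> x Dx; exact: (EY x Dx).
  move=> l x Dx /=; rewrite /Ymx mulNmx mulmxN opprK.
  transitivity (col l (X x)); first by apply/colP => r; rewrite !mxE.
  by rewrite -[X in col l X](mulmxKV u0) !colE mulmxA.
Qed.
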